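(* Let $z:(0,\infty)\to[0,\infty)$ be nonincreasing and lower semi-continuous, set $c(\phi)=z(\phi)\phi$ for $\phi>0$, $c(0)=0$, and assume $\int_0^1\sqrt{c(\phi)}\,d\phi<\infty$. Let $\tau^z(w)=\inf\{F^c[\psi]\mid\psi:\mathbb{R}\to[0,\infty),\ \int_{\mathbb{R}}\psi\,dy=w\}$ and let $w>0$ be such that $\tau^z(w)\neq(\tau^z)'(0)\,w$, where $(\tau^z)'(0)$ is the right derivative at $0$. Then the infimum defining $\tau^z(w)$ is attained by a minimizer $\psi\in H^1(\mathbb{R})$ which is nonnegative, bounded, continuous, even, and nonincreasing on $[0,\infty)$.
   Context: For $c:[0,\infty)\to[0,\infty)$ and $\psi:\mathbb{R}\to\mathbb{R}$ (with locally integrable weak derivative; otherwise the energy is $+\infty$), $F^c[\psi]=\int_{\mathbb{R}}\frac12|\psi'(y)|^2+c(|\psi(y)|)\,dy$. *)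

(* Defs.v *)
From HB Require Import structures.
From mathcomp Require Import all_boot all_order all_algebra.
From mathcomp Require Import all_classical all_reals all_analysis.
Set Implicit Arguments. Unset Strict Implicit. Unset Printing Implicit Defensive.
Import Order.TTheory GRing.Theory Num.Theory.
Import numFieldNormedType.Exports.
Local Open Scope classical_set_scope.
Local Open Scope ring_scope.

Section Defs.
Variable R : realType.
Local Notation mu := (@lebesgue_measure R).

Definition loc_integrable (g : R -> R) : Prop :=
  forall a b : R, mu.-integrable `[a, b] (EFin \o g).

Definition test_function (phi : R -> R) : Prop :=
  (forall (n : nat) (x : R), derivable (derive1n n phi) x 1) /\
  (exists M : R, forall x, M < `|x| -> phi x = 0).

Definition weak_deriv (psi g : R -> R) : Prop :=
  loc_integrable psi /\ loc_integrable g /\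
  forall phi, test_function phi ->
    (\int[mu]_x (psi x * derive1 phi x)%:E = - \int[mu]_x (g x * phi x)%:E)%E.

(* F^c[psi] = int 1/2 |psi'|^2 + c(|psi|), and +oo if psi has no locally
   integrable weak derivative (inf over the empty set is +oo) *)
Definition energy (c : R -> R) (psi : R -> R) : \bar R :=
  ereal_inf [set (\int[mu]_y ((2^-1 * `|g y| ^+ 2 + c `|psi y|)%:E))%E
            | g in [set g | weak_deriv psi g]].

Definition c_of (z : R -> R) (p : R) : R := if 0 < p then z p * p else 0.

Definition tau (z : R -> R) (w : R) : \bar R :=
  ereal_inf [set energy (c_of z) psi | psi in
     [set psi : R -> R | (forall y, 0 <= psi y) /\
                         (\int[mu]_y (psi y)%:E = w%:E)%E]].

Definition H1 (psi : R -> R) : Prop :=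
  exists g, weak_deriv psi g /\
    (\int[mu]_y (psi y ^+ 2)%:E < +oo)%E /\
    (\int[mu]_y (g y ^+ 2)%:E < +oo)%E.
End Defs.

(* Main.v *)
(** The energy is compared on profiles: even functions that are nonnegative and
    nonincreasing on the half-line. The symmetric decreasing rearrangement turns
    every competitor into a profile with the same mass, the same potential energy
    and no larger Dirichlet energy. The Dirichlet energy of a profile [u] is
    measured by the sums of [(u (k h) - u ((k + 1) h)) ^+ 2 / h], so that bounds
    on it survive pointwise limits; conversely such a bound makes the associated
    Stieltjes measure absolutely continuous with a square integrable density.

    A minimizing sequence of profiles of mass [w] has a pointwise convergent
    subsequence, whose limit [v] has mass [m <= w]. Far from the origin the
    profiles are small, so the mass [w - m] that escapes to infinity costs at
    least [z d * (w - m)] for every [d > 0]. If [m > 0], the stretched profile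
    [v (x * m / w)] has mass [w], and stretching costs at most [sup z] per unit of
    mass and does not increase the Dirichlet energy: it is a minimizer. If [m = 0],
    then [tau z w = sup z * w]; since [sup z] is also the right derivative of
    [tau z] at [0], this case is excluded. If [tau z w] is infinite, every
    profile of mass [w] is a minimizer. *)

Require Import Defs.
From HB Require Import structures.
From mathcomp Require Import all_boot all_order all_algebra.
From mathcomp Require Import all_classical all_reals all_analysis.
From mathcomp Require Import unstable measurable_realfun lra ring.
Set Implicit Arguments. Unset Strict Implicit. Unset Printing Implicit Defensive.
Import Order.TTheory GRing.Theory Num.Theory.
Import numFieldNormedType.Exports.
Local Open Scope classical_set_scope.
Local Open Scope ring_scope.

(** * Smooth step functions *)

(** The energy is defined by testing against smooth functions, while rearrangement and compactness
    are pointwise. So a competitor is first replaced by the continuous representative that its weak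
    derivative provides (du Bois-Reymond), and later every profile carries only a grid bound, from
    which a derivative is rebuilt when an energy has to be evaluated. The obstacle is the mass lost
    at infinity. One inequality settles all cases: the limit [v] satisfies
    [b + k + z d * (w - m) <= T] for every [d > 0], where [b] bounds its Dirichlet energy, [k] is
    its potential energy and [T] is the infimum. If [0 < m < w], this forces [z] to be bounded, and
    the slack [T - b - k] is just what stretching can consume. If [m = w], nothing has to be paid,
    so [z] may be unbounded near [0]. If [m = 0], it gives [sup z * w <= T], and the reverse
    inequality comes from wide flat tents, whose Dirichlet energy is arbitrarily small. *)

Section smooth.
Variable R : realType.
Implicit Types f g : R -> R.

Fixpoint Ck n f : Prop :=
  (forall x : R, derivable f x 1) /\ if n is m.+1 then Ck m f^`()%classic else True.

Definition smooth f := forall n, Ck n f.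

Lemma CkW n f : Ck n.+1 f -> Ck n f.
Proof.
elim: n f => [|n ih] f [df Cf]; first by split.
by split => //; exact: ih.
Qed.

Lemma smooth_derive1n f : smooth f ->
  forall n (x : R), derivable (derive1n n f) x 1.
Proof.
move=> sf n; move: (sf n); elim: n f {sf} => [|n ih] f [df Cf] //.
by move=> x; rewrite derive1Sn; exact: ih.
Qed.

Lemma derive1P f (x df : R) : is_derive x 1 f df -> f^`()%classic x = df.
Proof. by move=> h; rewrite derive1E derive_val. Qed.

Lemma derivable_is_derive1 f (x : R) : derivable f x 1 -> is_derive x 1 f (f^`()%classic x).
Proof. by move=> h; rewrite derive1E; exact/derivableP. Qed.

(** A coinduction principle: a class of derivable functions closed under derivation consists of
    smooth functions. It serves for constants and for the family [flat P]. *)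
Lemma smooth_family (P : (R -> R) -> Prop) :
  (forall f, P f -> (forall x : R, derivable f x 1) /\ P f^`()%classic) ->
  forall f, P f -> smooth f.
Proof.
move=> H f Pf n; elim: n f Pf => [|n ih] f Pf; first by have [] := H f Pf.
by have [df Pf'] := H f Pf; split => //; exact: ih.
Qed.

Lemma CkD n f g : Ck n f -> Ck n g -> Ck n (f \+ g).
Proof.
elim: n f g => [|n ih] f g [df Cf] [dg Cg].
  by split => // x; exact: derivableD.
split; first by move=> x; exact: derivableD.
suff -> : (f \+ g)^`()%classic = f^`()%classic \+ g^`()%classic by exact: ih.
apply/funext => x; apply: derive1P.
by apply: is_deriveD; exact: derivable_is_derive1.
Qed.

Lemma CkM n f g : Ck n f -> Ck n g -> Ck n (f \* g).
Proof.
elim: n f g => [|n ih] f g [df Cf] [dg Cg].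
  by split => // x; exact: derivableM.
split; first by move=> x; exact: derivableM.
have -> : (f \* g)^`()%classic = (f \* g^`()%classic) \+ (g \* f^`()%classic).
  apply/funext => x; apply: derive1P.
  by apply: is_deriveM; exact: derivable_is_derive1.
by apply: CkD; apply: ih => //; exact: CkW.
Qed.

Lemma CkN n f : Ck n f -> Ck n (\- f).
Proof.
elim: n f => [|n ih] f [df Cf].
  by split => // x; exact: derivableN.
split; first by move=> x; exact: derivableN.
suff -> : (\- f)^`()%classic = \- f^`()%classic by exact: ih.
apply/funext => x; apply: derive1P.
by apply: is_deriveN; exact: derivable_is_derive1.
Qed.

(** The inverse reappears in its own derivative [- f' * f^-1 * f^-1], but one level lower, where the
    induction hypothesis applies. *)
Lemma CkV n f : (forall x, f x != 0) -> Ck n f -> Ck n (fun x => (f x)^-1).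
Proof.
move=> f0; elim: n => [|n ih] [df Cf].
  by split => // x; exact: derivableV.
split; first by move=> x; exact: derivableV.
have -> : (fun x => (f x)^-1)^`()%classic =
    \- (f^`()%classic \* ((fun x => (f x)^-1) \* (fun x => (f x)^-1))).
  apply/funext => x; rewrite derive1E deriveV// -derive1E/=.
  by rewrite /GRing.scale/= mulNr -expr2 exprVn mulrC.
have CfV : Ck n (fun x => (f x)^-1) by apply: ih; exact: CkW.
by apply: CkN; apply: CkM => //; exact: CkM.
Qed.

Lemma is_derive_affine f (a b x : R) : derivable f (a * x + b) 1 ->
  is_derive x 1 (fun y => f (a * y + b)) (a * f^`()%classic (a * x + b)).
Proof.
move=> df.
have h1 : is_derive x 1 (fun y => a * y + b) a.
  by apply: is_derive_eq; rewrite addr0 /GRing.scale/= mulr1.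
rewrite mulrC; exact: (@is_derive1_comp _ f (fun y => a * y + b) _ _ _
  (derivable_is_derive1 df) h1).
Qed.

Lemma Ck_affine n f (a b : R) : Ck n f -> Ck n (fun x => f (a * x + b)).
Proof.
elim: n f => [|n ih] f [df Cf].
  by split => // x; case: (@is_derive_affine f a b x).
split; first by move=> x; case: (@is_derive_affine f a b x).
have -> : (fun x => f (a * x + b))^`()%classic =
    (cst a) \* (fun x => f^`()%classic (a * x + b)).
  by apply/funext => x; exact/derive1P/is_derive_affine.
apply: CkM; last exact: ih.
apply: (@smooth_family (fun f => exists a, f = cst a)); last by exists a.
move=> _ [c ->]; split => //.
by exists 0; apply/funext => x; apply: derive1P.
Qed.

Definition flat (P : {poly R}) (x : R) : R :=
  if 0 < x then P.[x^-1] * expR (- x^-1) else 0.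

(** For [y >= 1] every monomial is at most [y ^+ size P], and [y ^+ n <= n! * expR y] by the
    exponential series. *)
Lemma horner_expR_bound (P : {poly R}) :
  exists2 C, 0 <= C & forall y, 1 <= y -> `|P.[y]| * expR (- y) <= C.
Proof.
exists (\sum_(i < size P) `|P`_i| * (size P)`!%:R).
  by apply: sumr_ge0 => i _; rewrite mulr_ge0.
move=> y y1; have y0 : 0 <= y by lra.
rewrite horner_coef.
apply: (@le_trans _ _ ((\sum_(i < size P) `|P`_i| * y ^+ size P) * expR (- y))).
  rewrite ler_wpM2r ?expR_ge0// (le_trans (ler_norm_sum _ _ _))//.
  apply: ler_sum => i _; rewrite normrM ler_wpM2l// ger0_norm ?exprn_ge0//.
  by apply: ler_weXn2l => //; exact: ltnW.
rewrite mulr_suml; apply: ler_sum => i _; rewrite -mulrA ler_wpM2l//.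
rewrite expRN ler_pdivrMr ?expR_gt0//.
case: (size P) => [|n]; first by rewrite expr0 fact0 mul1r (le_trans _ (expR_ge1Dx _))// lerDl.
have := expR_ge1Dxn n y0.
by rewrite -ler_pdivrMl ?ltr0n ?fact_gt0// mulrC; lra.
Qed.

(** Applying the previous bound to [P * 'X^2] at [x^-1] gains the factor [x ^+ 2], which makes the
    derivative at the origin vanish. *)
Lemma flat_bound (P : {poly R}) :
  exists2 C, 0 <= C & forall x, x <= 1 -> `|flat P x| <= C * x ^+ 2.
Proof.
have [C C0 H] := horner_expR_bound (P * 'X^2); exists C => // x x1.
rewrite /flat; case: ifPn => [x0|_]; last by rewrite normr0 mulr_ge0// sqr_ge0.
have y1 : 1 <= x^-1 by rewrite invf_ge1.
have := H _ y1; rewrite hornerM hornerXn normrM.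
rewrite [`|_ ^+ 2|]ger0_norm ?sqr_ge0// normrM [`|expR _|]ger0_norm ?expR_ge0//.
move=> h; rewrite -ler_pdivrMr ?exprn_gt0// -exprVn mulrAC.
by [].
Qed.

Lemma is_derive_flat (P : {poly R}) (x : R) :
  is_derive x 1 (flat P) (flat ('X^2 * (P - P^`())) x).
Proof.
have [x0|x0|->] := ltgtP x 0.
- rewrite {2}/flat ltNge (ltW x0)/=.
  apply: (@near_eq_is_derive _ _ _ (cst 0)).
  near=> y; rewrite /flat ltNge; suff -> : y <= 0 by [].
  by apply: ltW; near: y; exact: lt_nbhsl.
- rewrite {2}/flat x0.
  have xN0 : x != 0 by rewrite gt_eqF.
  have hV : is_derive x 1 (fun x : R => x^-1) (- x ^- 2).
    apply: DeriveDef; first exact: derivableV.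
    by rewrite deriveV// derive_id /GRing.scale/= mulr1.
  have hP := @is_derive1_comp _ (horner P) _ _ _ _ (is_derive_poly P x^-1) hV.
  have hE := @is_derive1_comp _ expR (fun x : R => - x^-1) x _ _ (is_derive_expR _)
    (is_deriveN hV).
  have hPE := is_deriveM hP hE.
  have ->: ('X^2 * (P - P^`())).[x^-1] * expR (- x^-1) =
      (horner P \o (fun x : R => x^-1)) x *: (expR (- x^-1) * - - x ^- 2) +
      (expR \o (fun x : R => - x^-1)) x *: (P^`().[x^-1] * - x ^- 2).
    by rewrite /GRing.scale/= hornerM hornerXn hornerD hornerN -exprVn; ring.
  refine (near_eq_is_derive _ hPE).
  near=> y; rewrite /flat/=; suff -> : 0 < y by [].
  by near: y; exact: lt_nbhsr.
rewrite {2}/flat ltxx.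
have [C C0 H] := flat_bound P.
(* By the quadratic bound the difference quotient at [0] is at most [C * |h|]. *)
have h : h^-1 *: ((flat P \o shift 0) (h *: 1) - flat P 0) @[h --> 0^'] --> (0 : R).
  apply/cvgrPdist_le => e e0; near=> h.
  have hN0 : h != 0 by near: h; exact: nbhs_dnbhs_neq.
  rewrite sub0r normrN /flat ltxx -/(flat P _) subr0 /= addr0 /GRing.scale/= mulr1.
  rewrite normrM normfV ler_pdivrMl ?normr_gt0//.
  have h1 : `|h| < 1 by near: h; apply: dnbhs0_lt.
  have hh : h <= 1 by rewrite (le_trans (ler_norm _))// ltW.
  apply: (le_trans (H h hh)).
  rewrite -real_normK ?num_real// expr2 mulrCA ler_wpM2l//.
  have : `|h| < e / (C + 1) by near: h; apply: dnbhs0_lt; rewrite divr_gt0// ltr_wpDl.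
  rewrite ltr_pdivlMr ?ltr_wpDl// => h2.
  by have := normr_ge0 h; lra.
apply: DeriveDef; first by apply/cvg_ex; exists 0.
by apply/cvg_lim => //.
Unshelve. all: by end_near. Qed.

Lemma smooth_flat P : smooth (flat P).
Proof.
apply: (@smooth_family (fun f => exists P, f = flat P)); last by exists P.
move=> _ [Q ->]; split; first by move=> x; have [] := is_derive_flat Q x.
exists ('X^2 * (Q - Q^`())); apply/funext => x; exact/derive1P/is_derive_flat.
Qed.

Lemma flat1_ge0 x : 0 <= flat 1 x.
Proof. by rewrite /flat hornerC mul1r; case: ifP => // _; exact: expR_ge0. Qed.

Lemma flat1_gt0 x : 0 < x -> 0 < flat 1 x.
Proof. by rewrite /flat hornerC mul1r => ->; exact: expR_gt0. Qed.

Lemma flat1_eq0 x : x <= 0 -> flat 1 x = 0.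
Proof. by rewrite /flat ltNge => ->. Qed.

(** The classical quotient [e x / (e x + e (1 - x))]: the denominator is positive because [x] or
    [1 - x] is. *)
Lemma smooth_step : exists H : R -> R, [/\ smooth H,
  forall x, x <= 0 -> H x = 0 & forall x, 1 <= x -> H x = 1].
Proof.
pose e := flat 1; pose d := e \+ (fun x => e (-1 * x + 1)).
have d_neq0 x : d x != 0.
  rewrite gt_eqF// /d /=; have [x0|x0] := leP x 0.
    by rewrite ltr_wpDl ?flat1_ge0// flat1_gt0//; lra.
  by rewrite ltr_wpDr ?flat1_ge0// flat1_gt0.
exists (e \* (fun x => (d x)^-1)); split.
- move=> n; apply: CkM; first exact: smooth_flat.
  apply: CkV => //; apply: CkD; first exact: smooth_flat.
  exact/Ck_affine/smooth_flat.
- by move=> x x0 /=; rewrite /e flat1_eq0// mul0r.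
- move=> x x1 /=; have : e (-1 * x + 1) = 0 by apply: flat1_eq0; lra.
  have := d_neq0 x; rewrite /d /= => + h; rewrite h addr0 => ex.
  by rewrite divff.
Qed.

End smooth.

(** * Primitives and weak derivatives *)

Section primitive.
Variable R : realType.
Local Notation mu := (@lebesgue_measure R).
Implicit Types u g phi : R -> R.

(** Increments are prescribed instead of values from a base point, so no constant of integration has
    to be carried along. *)
Definition primitive u g := loc_integrable g /\
  forall a b, a <= b -> u b - u a = \int[mu]_(t in `[a, b]) g t.

Lemma loc_integrable_measurable g : loc_integrable g -> measurable_fun setT g.
Proof.
move=> ig.
have -> : [set: R] = \bigcup_n `[- n%:R, n%:R]%classic.
  apply/seteqP; split=> // x _; exists (Num.bound x) => //=.
  rewrite in_itv/=; apply/andP; split; apply: ltW; last exact: ltr_bound.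
  by rewrite ltrNl; exact: ltrNbound.
apply/measurable_fun_bigcup => // n.
by have /integrableP[/measurable_EFinP] := ig (- n%:R) n%:R.
Qed.

Lemma Rintegral_chasles g (a b c : R) : loc_integrable g -> a <= b -> b <= c ->
  \int[mu]_(t in `[a, c]) g t =
  \int[mu]_(t in `[a, b]) g t + \int[mu]_(t in `[b, c]) g t.
Proof.
move=> ig ab bc; apply/eqP; rewrite addrC -subr_eq Rintegral_itvB//.
rewrite Rintegral_itv_obnd_cbnd//.
by apply: (integrableS _ _ _ (ig b c)) => //; exact: subset_itv_oc_cc.
Qed.

Lemma exists_primitive g : loc_integrable g -> exists u, primitive u g.
Proof.
move=> ig; exists (fun x => if 0 <= x then \int[mu]_(t in `[0, x]) g t
  else - \int[mu]_(t in `[x, 0]) g t); split => // a b ab.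
have [b0|b0] := leP 0 b; have [a0|a0] := leP 0 a.
- by rewrite (Rintegral_chasles ig a0 ab) [X in X - _]addrC addrK.
- by rewrite (Rintegral_chasles ig (ltW a0) b0) opprK addrC.
- by have := lt_le_trans b0 (le_trans a0 ab); rewrite ltxx.
- by rewrite (Rintegral_chasles ig ab (ltW b0)) opprK addrC -addrA subrr addr0.
Qed.

Lemma primitive_continuous u g : primitive u g -> continuous u.
Proof.
move=> [ig ug] x.
have x1 : x - 1 < x + 1 by lra.
have := parameterized_integral_continuous (ltW x1) (ig (x - 1) (x + 1)).
move=> /(continuous_within_itvP _ x1)[+ _ _] => /(_ x).
have xin : x \in `]x - 1, x + 1[ by rewrite in_itv/=; apply/andP; split; lra.
move=> /(_ xin) cx.
have -> : u = (fun y => (u y - \int[mu]_(t in `[x - 1, y]) g t) + \int[mu]_(t in `[x - 1, y]) g t).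
  by apply/funext => y; rewrite subrK.
rewrite /continuous_at [X in _ --> X](_ : _ = u (x - 1) + \int[mu]_(t in `[x - 1, x]) g t); last first.
  by rewrite -ug; lra.
apply: cvgD => //.
(* The difference equals [u (x - 1)] only to the right of [x - 1], which is enough near [x]. *)
apply: (@cvg_near_cst _ _ (u (x - 1))).
near=> y.
suff xy : x - 1 <= y.
  by rewrite -ug// opprB addrC subrK.
by apply: ltW; near: y; apply: lt_nbhsr; lra.
Unshelve. all: by end_near. Qed.

Lemma continuous_seg_integrable g (a b : R) : continuous g ->
  mu.-integrable `[a, b] (EFin \o g).
Proof.
move=> cg; apply: continuous_compact_integrable; first exact: segment_compact.
exact: continuous_subspaceT.
Qed.

Lemma integral_derive1 phi (a b : R) : (forall x : R, derivable phi x 1) ->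
  continuous (derive1 phi) -> a <= b ->
  (\int[mu]_(x in `[a, b]) (derive1 phi x)%:E = (phi b - phi a)%:E)%E.
Proof.
move=> dphi cphi; rewrite le_eqVlt => /predU1P[->|ab].
  by rewrite set_itv1 integral_set1 subrr.
rewrite (@continuous_FTC2 _ _ phi a b ab); [by []|exact: continuous_subspaceT| |by []].
split; first by move=> x _; exact: dphi.
  + apply: cvg_at_right_filter.
    by apply: differentiable_continuous; exact/derivable1_diffP.
  + apply: cvg_at_left_filter.
    by apply: differentiable_continuous; exact/derivable1_diffP.
Qed.

Lemma patch_id (D : set R) (h : R -> R) :
  (forall x, ~ D x -> h x = 0) -> h \_ D = h.
Proof.
move=> h0; apply/funext => x; rewrite patchE; case: ifPn => //.
by move=> /negP xD; rewrite h0// => Dx; apply: xD; rewrite inE.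
Qed.

Lemma supp_integrable (D : set R) (h : R -> R) : measurable D ->
  (forall x, ~ D x -> h x = 0) -> mu.-integrable D (EFin \o h) ->
  mu.-integrable setT (EFin \o h).
Proof. by move=> mD h0 /integrable_mkcond -/(_ mD); rewrite restrict_EFin patch_id. Qed.

Lemma supp_integral (D : set R) (h : R -> R) :
  (forall x, ~ D x -> h x = 0) ->
  (\int[mu]_(x in D) (h x)%:E = \int[mu]_x (h x)%:E)%E.
Proof. by move=> h0; rewrite integral_mkcond restrict_EFin patch_id. Qed.

Lemma integrable_patch (D : set R) g : measurable D ->
  mu.-integrable D (EFin \o g) -> mu.-integrable setT (EFin \o (g \_ D)).
Proof.
by move=> mD; have [+ _] := integrable_mkcond (mu := mu) (EFin \o g) mD; rewrite restrict_EFin.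
Qed.

(** The radius is enlarged by [1] so that [phi] vanishes on a neighbourhood of every point outside,
    and its derivative vanishes there too. *)
Lemma test_function_supp phi : test_function phi -> exists M : R, [/\ 0 < M,
  forall x, M <= `|x| -> phi x = 0 & forall x, M <= `|x| -> derive1 phi x = 0].
Proof.
move=> [_ [M' HM']]; exists (`|M'| + 1); split; first by rewrite ltr_wpDl.
  by move=> x hx; apply: HM'; have := ler_norm M'; lra.
move=> x hx; apply: derive1P.
have h0 : \forall y \near x, cst 0 y = phi y.
  near=> y; rewrite HM'//.
  have : `|x - y| < 1.
    by near: y; exact: (@cvgr_dist_lt _ _ _ (nbhs x) _ id x).
  move=> xy; have := ler_normD (x - y) y; rewrite subrK.
  by have := ler_norm M'; lra.
exact: (near_eq_is_derive h0).
Unshelve. all: by end_near. Qed.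

Lemma supp_bounded (M : R) phi : 0 < M -> continuous phi ->
  (forall x, M <= `|x| -> phi x = 0) -> exists C, forall x, `|phi x| <= C.
Proof.
move=> M0 cphi phi0.
have cn : {within `[- M, M], continuous (fun x => `|phi x|)}.
  by apply: continuous_subspaceT => x; exact: (cvg_norm (cphi x)).
have [|c _ Hc] := @EVT_max _ (fun x => `|phi x|) (- M) M _ cn; first lra.
exists `|phi c| => x; have [xM|xM] := leP M `|x|; first by rewrite phi0// normr0.
by apply: Hc; move: xM; rewrite ltr_norml in_itv/= => /andP[/ltW -> /ltW ->].
Qed.

Lemma mul_supp_integrable g phi (M : R) : 0 < M -> loc_integrable g ->
  continuous phi -> (forall x, M <= `|x| -> phi x = 0) ->
  mu.-integrable setT (EFin \o (g \* phi)).
Proof.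
move=> M0 ig cphi phi0.
have [C HC] := supp_bounded M0 cphi phi0.
have iq := integrable_patch (measurable_itv _) (ig (- M) M).
have iCq : mu.-integrable setT (fun t => (C%:E * (EFin \o (g \_ `[- M, M])%R) t)%E).
  exact: integrableZl.
apply: (le_integrable measurableT _ _ iCq).
  apply/measurable_EFinP; apply: measurable_funM.
    exact: loc_integrable_measurable.
  exact: continuous_measurable_fun.
move=> t _ /=; rewrite lee_fin patchE; case: ifPn => [tD|/negP].
  rewrite !normrM mulrC ler_wpM2r// (le_trans (HC t))//.
  by rewrite ler_norm.
rewrite inE/= in_itv/= => /negP tD; rewrite mulr0 phi0 ?mulr0// leNgt.
by apply: contra tD; rewrite ltr_norml => /andP[/ltW -> /ltW ->].
Qed.

(* Fubini for [phi' x * g t] on the half-plane [t <= x]. *)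
Lemma primitive_integration_by_parts u g phi : primitive u g ->
  test_function phi ->
  (\int[mu]_x (u x * derive1 phi x)%:E = - \int[mu]_x (g x * phi x)%:E)%E.
Proof.
move=> pug tphi; have cu := primitive_continuous pug.
have [ig ug] := pug.
have [M [M0 phi0 p0]] := test_function_supp tphi.
have dphi (x : R) : derivable phi x 1 by have [/(_ 0%N x)] := tphi.
have cphi : continuous phi.
  by move=> x; apply: differentiable_continuous; exact/derivable1_diffP.
have cp : continuous (derive1 phi).
  move=> x; apply: differentiable_continuous; apply/derivable1_diffP.
  by have [/(_ 1%N x)] := tphi.
pose p := derive1 phi; pose D := `[- M, M]%classic : set R.
have DN x : ~ D x -> M <= `|x|.
  rewrite /D/= in_itv/= => /negP; rewrite negb_and -!ltNge => /orP[|] h.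
    by rewrite ler_normr; apply/orP; right; lra.
  by rewrite (le_trans (ltW h))// ler_norm.
(* [g] is only locally integrable; cutting it off outside the support of [phi] makes the double
   integral absolutely convergent. *)
pose q := g \_ D.
have mD : measurable D by exact: measurable_itv.
have iq : mu.-integrable setT (EFin \o q).
  by apply: integrable_patch => //; exact: (ig (- M) M).
have iphi_supp (h : R -> R) : (forall x, M <= `|x| -> h x = 0) -> continuous h ->
    mu.-integrable setT (EFin \o h).
  move=> h0 ch; apply: (@supp_integrable D) => //.
    by move=> x /DN; exact: h0.
  exact: continuous_seg_integrable.
have ip : mu.-integrable setT (EFin \o p) by exact: iphi_supp.
pose RR := (measurableTypeR R * measurableTypeR R)%type.
pose T := [set xt : RR | xt.2 <= xt.1].
pose f (xt : RR) : \bar R := (p xt.1 * q xt.2 * \1_T xt)%:E.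
have mT : measurable T.
  have -> : T = (fun xt : RR => xt.1 - xt.2) @^-1` `[0, +oo[.
    by apply/seteqP; split=> xt /=; rewrite in_itv/= andbT subr_ge0.
  rewrite -[X in measurable X]setTI.
  by apply: measurable_funB => //; exact: measurable_itv.
have mf : measurable_fun setT f.
  apply/measurable_EFinP; apply: measurable_funM; last exact: measurable_indic.
  apply: measurable_funM.
    apply: (measurableT_comp _ measurable_fst).
    exact: continuous_measurable_fun.
  apply: (measurableT_comp _ measurable_snd).
  by have /integrableP[/measurable_EFinP] := iq.
have intf : (mu \x mu)%E.-integrable setT f.
  apply/(integrable12ltyP _ _ mf).
  apply: (@le_lt_trans _ _ (\int[mu]_x ((\int[mu]_t `|(q t)%:E|) * `|(p x)%:E|))%E).
    apply: ge0_le_integral => //.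
    - by move=> x _; exact: integral_ge0.
    - apply: (@measurable_fun_fubini_tonelli_F _ _ _ _ _ mu (abse \o f)); first exact: measurableT_comp.
      by move=> ?; exact: abse_ge0.
    - apply: measurable_funeM; apply: measurableT_comp => //.
      by apply/measurable_EFinP; exact: continuous_measurable_fun.
    move=> x _; rewrite -ge0_integralZr//; last first.
      by apply: measurableT_comp => //; have /integrableP[] := iq.
    apply: ge0_le_integral => //.
    - apply: measurableT_comp => //.
      exact: (measurableT_comp mf (pair1_measurable x)).
    - under eq_fun do rewrite muleC.
      apply: measurable_funeM.
      by apply: measurableT_comp => //; have /integrableP[] := iq.
    - move=> t _; rewrite muleC /f /= !normrM -EFinM lee_fin.
      by rewrite ler_piMr ?mulr_ge0// indicE; case: (_ \in _); rewrite ?normr1 ?normr0.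
  rewrite ge0_integralZl//; last 2 first.
    by apply: measurableT_comp => //; have /integrableP[] := ip.
    by rewrite integral_ge0.
  rewrite lte_mul_pinfty//.
  - by rewrite integral_ge0.
  - by apply: (@integrable_fin_num _ _ _ mu setT) => //; exact: integrable_abse.
  - by have /integrableP[] := ip.
have inner1 x : (\int[mu]_t f (x, t) = (p x * (u x - u (- M)))%:E)%E.
  have [xD|/DN xD] := pselect (D x); last first.
    rewrite /f /p /= p0//; under eq_integral do rewrite !mul0r.
    by rewrite integral0 mul0r.
  move: (xD); rewrite /D/= in_itv/= => /andP[xM1 xM2].
  transitivity (\int[mu]_t ((p x)%:E * (EFin \o (g \_ `[- M, x])%R) t))%E.
    apply: eq_integral => t _; rewrite /f /= -mulrA -EFinM; congr ((p x * _)%:E).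
    rewrite indicE /T /q !patchE; case: (boolP (t \in D)); last first.
      move=> tD; rewrite mul0r; case: ifPn => // tx; exfalso; move: tD => /negP; apply.
      move: tx; rewrite !inE /D/= !in_itv/= => /andP[-> tx]; exact: le_trans tx xM2.
    rewrite !inE /D /= in_itv/= => /andP[t1 t2].
    case: ifPn => [|/negP]; rewrite inE/= in_itv/= t1/=.
      by move=> tx; rewrite mem_set//= mulr1.
    by move=> tx; rewrite memNset ?mulr0.
  have igx : mu.-integrable setT (EFin \o (g \_ `[- M, x])).
    by apply: integrable_patch => //; exact: (ig (- M) x).
  rewrite integralZl// ug// EFinM; congr (_ * _)%E.
  rewrite [RHS]fineK; last by apply: integrable_fin_num => //; exact: (ig (- M) x).
  by rewrite [in RHS]integral_mkcond restrict_EFin.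
have inner2 t : (\int[mu]_x f (x, t) = (- (g t * phi t))%:E)%E.
  have [tD|tD] := pselect (D t); last first.
    rewrite phi0; last exact: DN.
    rewrite mulr0 oppr0 /f /q /=; under eq_integral.
      move=> x _; rewrite patchE memNset// mulr0 mul0r; over.
    by rewrite integral0.
  move: (tD); rewrite /D/= in_itv/= => /andP[tM1 tM2].
  transitivity (\int[mu]_x ((g t)%:E * (EFin \o (p \_ `[t, M])%R) x))%E.
    apply: eq_integral => x _; rewrite /f /= /q patchE mem_set//.
    rewrite -EFinM [p x * _]mulrC -mulrA; congr ((g t * _)%:E).
    rewrite indicE /T patchE.
    case: ifPn => [|/negP]; rewrite inE/= in_itv/=.
      by move=> /andP[tx _]; rewrite mem_set//= mulr1.
    move=> /negP; rewrite negb_and -!ltNge => /orP[] h.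
      by rewrite memNset ?mulr0//=; apply/negP; rewrite -ltNge.
    by rewrite /p p0 ?mul0r// (le_trans (ltW h))// ler_norm.
  have ipx : mu.-integrable setT (EFin \o (p \_ `[t, M])).
    apply: integrable_patch => //.
    exact: continuous_seg_integrable.
  rewrite integralZl// -mulrN EFinM; congr (_ * _)%E.
  rewrite -restrict_EFin -integral_mkcond integral_derive1// phi0 ?sub0r//.
  by rewrite ger0_norm// ltW.
have := Fubini intf.
under eq_integral do rewrite inner1.
under [RHS]eq_integral do rewrite inner2.
move=> H.
have igphi : mu.-integrable setT (fun t => (g t * phi t)%:E).
  exact: mul_supp_integrable M0 ig cphi phi0.
rewrite -integralN; last exact: integrable_add_def.
rewrite -[RHS]H.
have ipu : mu.-integrable setT (EFin \o (fun x => p x * (u x - u (- M)))).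
  apply: iphi_supp; first by move=> x hx; rewrite /p p0// mul0r.
  move=> x; apply: cvgM; first exact: cp.
  by apply: cvgB; [exact: cu|exact: cvg_cst].
transitivity (\int[mu]_x ((p x * (u x - u (- M)))%:E + (u (- M))%:E * (p x)%:E))%E.
  by apply: eq_integral => x _; rewrite -EFinM -EFinD; congr EFin; rewrite /p; ring.
rewrite integralD//; last exact: integrableZl.
rewrite integralZl//.
(* The constant [u (- M)] contributes nothing because [phi] vanishes at both ends. *)
have -> : (\int[mu]_x (p x)%:E = 0)%E.
  rewrite -(@supp_integral D); last by move=> x /DN; exact: p0.
  rewrite integral_derive1//; last lra.
  by rewrite !phi0 ?subrr// ?normrN ger0_norm// ltW.
by rewrite mule0 adde0.
Qed.

Lemma primitive_weak_deriv u g : primitive u g -> weak_deriv u g.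
Proof.
move=> pug; split; last split.
- move=> a b; apply: continuous_seg_integrable; exact: primitive_continuous pug.
- by case: pug.
- by move=> phi; exact: primitive_integration_by_parts.
Qed.

End primitive.

(** * The du Bois-Reymond lemma: continuous representatives of weakly differentiable functions *)

Section weak_derivative.
Variable R : realType.
Local Notation mu := (@lebesgue_measure R).
Implicit Types u g v phi : R -> R.

Lemma loc_integrable_locally g : loc_integrable g ->
  locally_integrable [set: R] g.
Proof.
move=> ig; split; [exact: loc_integrable_measurable|exact: openT|].
move=> K _ cK.
have [M HM] : exists M, forall x, K x -> `|x| <= M.
  have [M [Mr HM]] := compact_bounded cK.
  by exists (M + 1) => x Kx; apply: HM Kx; rewrite ltrDl.
have /integrableP[mg] := ig (- M) M; apply: le_lt_trans.
apply: ge0_subset_integral => //.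
- exact: compact_measurable.
- by apply/measurable_EFinP; apply: measurableT_comp => //; exact/measurable_EFinP.
- by move=> x /HM; rewrite ler_norml /= in_itv.
Qed.

(** The kernels have width and inverse height of order [1 / (n + 1)], so the error is at most a
    constant times the mean oscillation of [v] on a shrinking ball, which tends to [0] at a Lebesgue
    point. The factor [2] in [2 * C] comes from the length [2 * r] of the ball. *)
Lemma lebesgue_pt_mollify v (a : R) (eta : nat -> R -> R) (C : R) :
  loc_integrable v -> lebesgue_pt v a ->
  (forall n, continuous (eta n)) ->
  (forall n x, n.+1%:R^-1 <= `|x - a| -> eta n x = 0) ->
  (forall n x, `|eta n x| <= C * n.+1%:R) ->
  (forall n, \int[mu]_x eta n x = 1) ->
  (fun n => \int[mu]_x (v x * eta n x)) @ \oo --> v a.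
Proof.
move=> iv lv ceta eta0 etaC eta1.
have C0 : 0 <= C.
  by have := etaC 0%N 0; rewrite mulr1; exact: le_trans.
have supp n x : `|a| + 1 <= `|x| -> eta n x = 0.
  move=> xa; apply: eta0; apply: (@le_trans _ _ 1).
    by rewrite invf_le1// ?ltr0n// ler1n.
  by have := ler_dist_dist x a; have := ler_norm (`|x| - `|a|); lra.
have a1 : 0 < `|a| + 1 by rewrite ltr_wpDl.
have ive n : mu.-integrable setT (EFin \o (fun x => v x * eta n x)).
  exact: (mul_supp_integrable a1 iv (ceta n) (supp n)).
have ice n : mu.-integrable setT (EFin \o (fun x => v a * eta n x)).
  have := @mul_supp_integrable _ (cst (v a)) (eta n) _ a1 _ (ceta n) (supp n).
  by apply=> x y; apply: continuous_seg_integrable => z; exact: cvg_cst.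
have iet n : mu.-integrable setT (EFin \o eta n).
  have := @mul_supp_integrable _ (cst 1) (eta n) _ a1 _ (ceta n) (supp n).
  have -> : cst 1 \* eta n = eta n by apply/funext => x /=; rewrite mul1r.
  by apply=> x y; apply: continuous_seg_integrable => z; exact: cvg_cst.
have key n : (`|v a - \int[mu]_x (v x * eta n x)|%:E <=
    (2 * C)%:E * davg v a (n.+1%:R^-1))%E.
  set r := n.+1%:R^-1; have r0 : 0 < r by rewrite invr_gt0 ltr0n.
  have -> : v a - \int[mu]_x (v x * eta n x) =
      \int[mu]_x ((v a - v x) * eta n x).
    under [RHS]eq_Rintegral do rewrite mulrBl.
    by rewrite RintegralB// RintegralZl// eta1 mulr1.
  have E0 x : ~ ball a r x -> (v a - v x) * eta n x = 0.
    move=> bx; rewrite eta0 ?mulr0// leNgt; apply/negP => xr; apply: bx.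
    by rewrite /ball/= distrC.
  have iE : mu.-integrable setT (EFin \o (fun x => (v a - v x) * eta n x)).
    have -> : EFin \o (fun x => (v a - v x) * eta n x) =
      ((EFin \o (fun x => v a * eta n x)%R) \- (EFin \o (fun x => v x * eta n x)%R))%E.
      by apply/funext => x /=; rewrite mulrBl.
    exact: integrableB.
  rewrite EFin_normr_Rintegral//.
  apply: (le_trans (le_abse_integral mu measurableT _)).
    by have /integrableP[] := iE.
  rewrite /davg /iavg lebesgue_measure_ball ?(ltW r0)//.
  rewrite (_ : (\int[mu]_x `|((v a - v x) * eta n x)%:E| =
    \int[mu]_(x in ball a r) `|((v a - v x) * eta n x)%:E|)%E); last first.
    rewrite [RHS]integral_mkcond; apply: eq_integral => x _.
    rewrite patchE; case: ifPn => // /negP; rewrite inE => bx.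
    by rewrite E0// abse0.
  have mball : measurable (ball a r) by exact: measurable_ball.
  have mv : measurable_fun setT v by exact: loc_integrable_measurable.
  apply: (@le_trans _ _ (\int[mu]_(x in ball a r)
      ((C * n.+1%:R)%:E * `|(v x - v a)%:E|))%E).
    apply: ge0_le_integral => //.
    - apply: measurableT_comp => //; apply: measurable_funTS.
      by have /integrableP[] := iE.
    - apply: measurable_funeM; apply: measurable_funTS; apply: measurableT_comp => //.
      by apply/measurable_EFinP; apply: measurable_funB.
    - move=> x _; rewrite -EFinM lee_fin normrM distrC mulrC ler_wpM2r//.
  rewrite ge0_integralZl//; last 2 first.
    apply: measurable_funTS; apply: measurableT_comp => //.
    by apply/measurable_EFinP; apply: measurable_funB.
    by rewrite lee_fin mulr_ge0.
  rewrite inver ifF; last by rewrite gt_eqF// mulrn_wgt0.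
  rewrite muleA -EFinM.
  suff -> : 2 * C * (r *+ 2)^-1 = C * n.+1%:R by [].
  by rewrite -[r *+ 2]mulr_natr invfM /r invrK; field.
apply/cvgrPdist_lt => e e0.
move/fine_cvgP: lv => [dfin dcvg].
have e1 : 0 < e / (2 * C + 1) by rewrite divr_gt0// ltr_wpDl// mulr_ge0.
have near_small : \forall r \near (0:R)^'+,
    davg v a r \is a fin_num /\ fine (davg v a r) < e / (2 * C + 1).
  near=> r; split; first by near: r.
  have : `|0 - (fine \o davg v a) r| < e / (2 * C + 1).
    by near: r; exact: cvgr_dist_lt.
  by rewrite sub0r normrN /= => /(le_lt_trans (ler_norm _)).
have [d d0 Hd] := near_small.
near=> n.
have nd : n.+1%:R^-1 < d.
  have : `|0 - harmonic n| < d by near: n; apply: cvgr_dist_lt => //; exact: cvg_harmonic.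
  by rewrite sub0r normrN /harmonic gtr0_norm// invr_gt0 ltr0n.
have [||fin small] := Hd n.+1%:R^-1; rewrite /= ?invr_gt0 ?ltr0n//.
  by rewrite sub0r normrN gtr0_norm// invr_gt0 ltr0n.
have := key n; rewrite -(fineK fin) -EFinM lee_fin => /le_lt_trans; apply.
move: small; rewrite ltr_pdivlMr ?ltr_wpDl// ?mulr_ge0// => small.
apply: le_lt_trans small; rewrite mulrC ler_wpM2l ?lerDl//.
by apply: fine_ge0; exact: davg_ge0.
Unshelve. all: by end_near. Qed.

Lemma ae_exists (P : R -> Prop) : {ae mu, forall x, P x} -> exists x, P x.
Proof.
move=> [N [mN N0 HN]]; apply: contrapT => /forallNP nP.
have : (mu `[0%R, 1%R]%classic <= mu N)%E.
  by apply: le_measure; rewrite ?inE// => x _; apply: HN => /=; exact: nP.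
by rewrite N0 lebesgue_measure_itv/= lte01 oppr0 adde0 leNgt lte01.
Qed.

(** Take as test function the difference of two smooth steps, one rising just after [a] and one just
    after [b]. Its derivative is the difference of two approximate identities, so the mollified
    values of [v] at [a] and [b] agree, and so do their limits. *)
Lemma weak_deriv0_lebesgue_pt v (a b : R) : loc_integrable v ->
  (forall phi, test_function phi -> \int[mu]_x (v x * derive1 phi x) = 0) ->
  lebesgue_pt v a -> lebesgue_pt v b -> v a = v b.
Proof.
move=> iv Hv la lb.
have [H [sH H0 H1]] := smooth_step R.
pose p := derive1 H.
have dH (x : R) : derivable H x 1 by have [] := sH 0%N.
have cp : continuous p.
  move=> x; apply: differentiable_continuous; apply/derivable1_diffP.
  by have [_ []] := sH 1%N.
have p_out x : x < 0 \/ 1 < x -> p x = 0.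
  move=> hx; apply: derive1P.
  have hn : \forall y \near x, cst (H x) y = H y.
    case: hx => hx; near=> y.
      rewrite /= !H0//; last exact: ltW.
      by apply: ltW; near: y; exact: lt_nbhsl.
    rewrite /= !H1//; last exact: ltW.
    by apply: ltW; near: y; exact: lt_nbhsr.
  exact: (near_eq_is_derive hn).
(* At the ends [0] and [1] the step [H] is constant on one side only; continuity of [p] supplies the
   value there. *)
have p0 : p 0 = 0.
  have : p x @[x --> 0^'-] --> p 0 by apply: cvg_at_left_filter; exact: cp.
  move/cvg_unique; apply => //; apply: cvg_near_cst.
  by near=> x; apply: p_out; left; near: x; exact: nbhs_left_lt.
have p1 : p 1 = 0.
  have : p x @[x --> 1^'+] --> p 1 by apply: cvg_at_right_filter; exact: cp.
  move/cvg_unique; apply => //; apply: cvg_near_cst.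
  by near=> x; apply: p_out; right; near: x; exact: nbhs_right_gt.
have p_supp x : x <= 0 \/ 1 <= x -> p x = 0.
  rewrite !le_eqVlt => -[/predU1P[->//|xl]|/predU1P[<-//|xl]]; apply: p_out.
    by left.
  by right.
have [C HC] : exists C, forall x, `|p x| <= C.
  apply: (@supp_bounded _ 1) => // x; rewrite ler_normr => /orP[] h.
    by apply: p_supp; right.
  by apply: p_supp; left; lra.
pose N n : R := n.+1%:R.
have N0 n : 0 < N n by rewrite /N ltr0n.
pose step (c : R) n x := H (N n * x + - (N n * c)).
pose eta c n x := N n * p (N n * x + - (N n * c)).
have dstep c n (x : R) : is_derive x 1 (step c n) (eta c n x).
  exact: is_derive_affine.
have ceta c n : continuous (eta c n).
  move=> x; apply: cvgM; first exact: cvg_cst.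
  apply: (@continuous_comp _ _ _ (fun x => N n * x + - (N n * c)) p); last exact: cp.
  by apply: cvgD; [apply: cvgM; [exact: cvg_cst|exact: cvg_id]|exact: cvg_cst].
have eta0 c n x : (N n)^-1 <= `|x - c| -> eta c n x = 0.
  move=> h; rewrite /eta p_supp ?mulr0// -mulrBr.
  have {}h : 1 <= N n * `|x - c| by rewrite -ler_pdivrMl ?mulr1.
  move: h; have [xc|xc] := leP 0 (x - c).
    by rewrite ger0_norm// => h; right.
  by rewrite ltr0_norm// mulrN => h; left; lra.
have etaC c n x : `|eta c n x| <= C * N n.
  by rewrite normrM (gtr0_norm (N0 n)) mulrC ler_wpM2r// ltW.
have step_lo c n x : x <= c -> step c n x = 0.
  move=> xc; apply: H0.
  by rewrite -mulrBr pmulr_rle0// subr_le0.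
have step_hi c n x : c + 1 <= x -> step c n x = 1.
  move=> xc; apply: H1; rewrite -mulrBr.
  have N1 : 1 <= N n by rewrite /N ler1n.
  by rewrite -[1]mulr1; apply: ler_pM => //; lra.
have d1step c n : derive1 (step c n) = eta c n.
  by apply/funext => x; exact: derive1P.
have supp_eta c n x : `|c| + 1 <= `|x| -> eta c n x = 0.
  move=> xc; apply: eta0; apply: (@le_trans _ _ 1).
    by rewrite invf_le1// ler1n.
  by have := ler_dist_dist x c; have := ler_norm (`|x| - `|c|); lra.
have eta1 c n : \int[mu]_x eta c n x = 1.
  rewrite /Rintegral -(@supp_integral _ `[- (`|c| + 1), `|c| + 1]); last first.
    move=> x /=; rewrite in_itv/= => /negP xc; apply: supp_eta.
    rewrite leNgt; apply: contra xc.
    by rewrite ltr_norml => /andP[/ltW -> /ltW ->].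
  have st (x : R) : derivable (step c n) x 1 by case: (dstep c n x).
  have cst_ : continuous (derive1 (step c n)) by rewrite d1step.
  have lec : - (`|c| + 1) <= `|c| + 1 by have := normr_ge0 c; lra.
  rewrite -d1step (integral_derive1 st cst_ lec) /= step_hi; last first.
    by rewrite lerD2r ler_norm.
  by rewrite step_lo ?subr0//; have := ler_norm (- c); rewrite normrN; lra.
(* A single step has unbounded support; far to the right the two steps cancel. *)
have test n : test_function (step a n \+ (\- step b n)).
  split.
    apply: smooth_derive1n => k; apply: CkD; last apply: CkN; exact: Ck_affine.
  exists (`|a| + `|b| + 1) => x xab /=.
  have := ler_norm a; have := ler_norm b.
  have := ler_norm (- a); have := ler_norm (- b); rewrite !normrN => h1 h2 h3 h4.
  have := normr_ge0 a; have := normr_ge0 b => a0 b0.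
  move: xab; rewrite ltr_normr => /orP[] xab.
    by rewrite !step_hi ?subrr//; lra.
  by rewrite !step_lo ?subrr//; lra.
have dtest n : derive1 (step a n \+ (\- step b n)) = eta a n \- eta b n.
  by apply/funext => x; apply: derive1P.
have lima := lebesgue_pt_mollify iv la (ceta a) (eta0 a) (etaC a) (eta1 a).
have limb := lebesgue_pt_mollify iv lb (ceta b) (eta0 b) (etaC b) (eta1 b).
have E : (fun n => \int[mu]_x (v x * eta a n x)) = (fun n => \int[mu]_x (v x * eta b n x)).
  apply/funext => n; apply/eqP; rewrite -subr_eq0; apply/eqP.
  have := Hv _ (test n); rewrite dtest => <-.
  rewrite -RintegralB//.
  - by apply: eq_Rintegral => x _ /=; rewrite mulrBr.
  - by apply: (mul_supp_integrable _ iv (ceta a n) (supp_eta a n)); rewrite ltr_wpDl.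
  - by apply: (mul_supp_integrable _ iv (ceta b n) (supp_eta b n)); rewrite ltr_wpDl.
rewrite E in lima.
exact: cvg_unique lima limb.
Unshelve. all: by end_near. Qed.

(** Subtracting a primitive of [g] leaves a function with zero weak derivative, hence with the same
    value at all Lebesgue points, that is almost everywhere. *)
Lemma weak_deriv_primitive v g : weak_deriv v g ->
  exists u, primitive u g /\ {ae mu, forall x, v x = u x}.
Proof.
move=> [iv [ig Hv]].
have [G pG] := exists_primitive ig.
have cG := primitive_continuous pG.
pose d := v \- G.
have id : loc_integrable d.
  move=> a b; have -> : EFin \o d = ((EFin \o v) \- (EFin \o G))%E by [].
  by apply: integrableB => //; exact: continuous_seg_integrable.
have Hd phi : test_function phi -> \int[mu]_x (d x * derive1 phi x) = 0.
  move=> tphi.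
  have [M [M0 phi0 p0]] := test_function_supp tphi.
  have cp : continuous (derive1 phi).
    move=> x; apply: differentiable_continuous; apply/derivable1_diffP.
    by have [/(_ 1%N x)] := tphi.
  have iGp := @mul_supp_integrable _ G _ M M0
    (fun a b => continuous_seg_integrable a b cG) cp p0.
  have ivp := mul_supp_integrable M0 iv cp p0.
  under eq_Rintegral do rewrite mulrBl.
  rewrite RintegralB// /Rintegral Hv//.
  by rewrite (primitive_integration_by_parts pG tphi) subrr.
have lae := lebesgue_differentiation (loc_integrable_locally id).
have [a la] := ae_exists lae.
exists (fun x => G x + d a); split.
  case: pG => _ HG; split => // x y xy.
  by rewrite -HG//; lra.
apply: filterS lae; first exact: (ae_filter_ringOfSetsType mu).
move=> x lx.
by rewrite -(weak_deriv0_lebesgue_pt id Hd lx la) /d /=; lra.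
Qed.

End weak_derivative.

(** * Grid bounds and absolute continuity *)

Section fatou_bound.
Variable R : realType.
Local Notation mu := (@lebesgue_measure R).

Lemma measurable_limn_einf (f : nat -> R -> \bar R) :
  (forall n, measurable_fun setT (f n)) ->
  measurable_fun setT (fun x => limn_einf (f^~ x)).
Proof.
move=> mf.
have -> : (fun x => limn_einf (f^~ x)) =
    (fun x => - limn_esup ((fun n => -%E \o f n)^~ x))%E.
  apply/funext => x.
  by rewrite -limn_einfN; congr limn_einf; apply/funext => n /=; rewrite oppeK.
apply: measurableT_comp => //; apply: measurable_fun_limn_esup => n.
by rewrite /=; apply: measurableT_comp => //; exact: mf.
Qed.

(** Fatou's lemma in the form that serves three times: for squared difference quotients, for the
    potential energy and for the mass of the limit. *)
Lemma fatou_bound (f : nat -> R -> \bar R) (g : R -> \bar R)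
    (a : nat -> \bar R) (L : \bar R) :
  (forall n, measurable_fun setT (f n)) -> (forall n x, 0 <= f n x)%E ->
  measurable_fun setT g -> (forall x, 0 <= g x)%E ->
  {ae mu, forall x, (g x <= limn_einf (f^~ x))%E} ->
  (forall n, \int[mu]_x f n x <= a n)%E -> a @ \oo --> L ->
  (\int[mu]_x g x <= L)%E.
Proof.
move=> mf f0 mg g0 fg fa aL.
apply: (@le_trans _ _ (\int[mu]_x limn_einf (f^~ x))%E).
  apply: ae_ge0_le_integral => //.
  - move=> x _; rewrite limn_einf_lim; apply: lime_ge.
      exact: is_cvg_einfs.
    by apply: nearW => n; apply: le_ereal_inf_tmp => _ [m _ <-].
  - exact: measurable_limn_einf.
  - by apply: filterS fg; [exact: (ae_filter_ringOfSetsType mu)|move=> x ? _].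
apply: (le_trans (fatou mu measurableT mf _)); first by move=> n x _.
rewrite -(cvg_limn_einf_sup aL).1 !limn_einf_lim.
apply: lee_lim; [exact: is_cvg_einfs|exact: is_cvg_einfs|].
apply: nearW => n; apply: le_ereal_inf_tmp => _ [m nm <-].
apply: (le_trans _ (fa m)).
by apply: ereal_inf_lbound; exists m.
Qed.

End fatou_bound.

(** * Squared increments on uniform grids *)

Section grid.
Variable R : realType.
Local Notation mu := (@lebesgue_measure R).
Implicit Types (F f : R -> R) (h x : R) (n k : nat).

Definition gridpt n h k : R := (k%:R - n%:R) * h.

(** Riesz's criterion for [F'] to be square integrable with integral of [F' ^+ 2] at most [A], with
    the division by [h] cleared. Only grids through the origin are tested; each has [n] cells on
    either side. *)
Definition grid_bound F (A : R) := forall n h, 0 < h ->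
  \sum_(k < n + n) (F (gridpt n h k.+1) - F (gridpt n h k)) ^+ 2 <= A * h.

Lemma gridptS n h k : gridpt n h k.+1 = gridpt n h k + h.
Proof. by rewrite /gridpt -natr1; ring. Qed.

Lemma gridpt_le n h k l : 0 < h -> (k <= l)%N -> gridpt n h k <= gridpt n h l.
Proof. by move=> h0 kl; rewrite ler_wpM2r ?(ltW h0)// lerD2r ler_nat. Qed.

Lemma gridpt_locate n h x : 0 < h -> `|x| < n%:R * h ->
  exists2 k, (k < n + n)%N & gridpt n h k <= x < gridpt n h k.+1.
Proof.
move=> h0; rewrite ltr_norml => /andP[x1 x2].
have y0 : 0 <= x / h + n%:R.
  by rewrite -lerBlDr sub0r ler_pdivlMr// mulNr ltW.
have /andP[k1 k2] := truncn_itv y0.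
exists (Num.truncn (x / h + n%:R)).
  by rewrite truncn_lt_nat// natrD ltrD2r ltr_pdivrMr.
apply/andP; split.
  by rewrite /gridpt -ler_pdivlMr// lerBlDr.
by rewrite /gridpt -ltr_pdivrMr// ltrBrDr.
Qed.

(** Cells open on the left match the intervals on which the Stieltjes measure is known. A grid point
    belongs to the cell before it, and the strict bound on [|x|] excludes the leftmost one. *)
Lemma gridpt_locater n h x : 0 < h -> `|x| < n%:R * h ->
  exists2 k, (k < n + n)%N & gridpt n h k < x <= gridpt n h k.+1.
Proof.
move=> h0 xn; have [k kn /andP[k1 k2]] := gridpt_locate h0 xn.
move: k1; rewrite le_eqVlt => /predU1P[kx|kx]; last by exists k; rewrite // kx ltW.
case: k kn k2 kx => [|k] kn k2 kx.
  by move: xn; rewrite -kx /gridpt sub0r mulNr normrN ger0_norm ?mulr_ge0 ?(ltW h0)// ltxx.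
exists k; first exact: ltnW.
by rewrite -kx gridptS ltrDl h0 lexx.
Qed.

Lemma grid_cell_inj n h k l x : 0 < h ->
  gridpt n h k < x <= gridpt n h k.+1 -> gridpt n h l < x <= gridpt n h l.+1 ->
  k = l.
Proof.
move=> h0 /andP[k1 k2] /andP[l1 l2].
have [kl|lk|//] := ltngtP k l.
  by have := lt_le_trans l1 (le_trans k2 (gridpt_le n h0 kl)); rewrite ltxx.
by have := lt_le_trans k1 (le_trans l2 (gridpt_le n h0 lk)); rewrite ltxx.
Qed.

Lemma grid_cell_injl n h k l x : 0 < h ->
  gridpt n h k <= x < gridpt n h k.+1 -> gridpt n h l <= x < gridpt n h l.+1 ->
  k = l.
Proof.
move=> h0 /andP[k1 k2] /andP[l1 l2].
have [kl|lk|//] := ltngtP k l.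
  by have := lt_le_trans k2 (le_trans (gridpt_le n h0 kl) l1); rewrite ltxx.
by have := lt_le_trans l2 (le_trans (gridpt_le n h0 lk) k1); rewrite ltxx.
Qed.

Lemma grid_bound_term F A n h k : grid_bound F A -> 0 < h -> (k < n + n)%N ->
  (F (gridpt n h k.+1) - F (gridpt n h k)) ^+ 2 <= A * h.
Proof.
move=> gF h0 kn; apply: le_trans (gF n h h0).
rewrite (bigD1 (Ordinal kn))//= lerDl sumr_ge0// => i _.
exact: sqr_ge0.
Qed.

(** The interval from [x] to [x + h] meets at most two adjacent cells, of increments [a] and [b],
    and [(a + b) ^+ 2 <= 2 * a ^+ 2 + 2 * b ^+ 2]; hence the factor [4]. *)
Lemma grid_bound_shift F A h x : nondecreasing F -> grid_bound F A -> 0 < h ->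
  (F (x + h) - F x) ^+ 2 <= 4 * A * h.
Proof.
move=> ndF gF h0.
pose n := Num.bound ((`|x| + h) / h).
have hn : `|x| + h < n%:R * h.
  rewrite -ltr_pdivrMr//; apply: archi_boundP.
  by rewrite divr_ge0// ?addr_ge0// ltW.
have xn : `|x| < n%:R * h by lra.
have [k kn /andP[k1 k2]] := gridpt_locate h0 xn.
have kn' : (k.+1 < n + n)%N.
  rewrite ltnNge; apply/negP => nk.
  have := gridpt_le n h0 nk; rewrite gridptS {1}/gridpt natrD addrK.
  by have := ler_norm x; lra.
have h1 := grid_bound_term gF h0 kn; have h2 := grid_bound_term gF h0 kn'.
have d1 : F (gridpt n h k) <= F x by exact: ndF.
have d2 : F (x + h) <= F (gridpt n h k.+2).
  by apply: ndF; rewrite gridptS lerD2r ltW.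
have d0 : F x <= F (x + h) by apply: ndF; rewrite lerDl ltW.
set a := F (gridpt n h k.+1) - _ in h1; set b := F (gridpt n h k.+2) - _ in h2.
have : 0 <= F (x + h) - F x <= a + b by rewrite /a /b; apply/andP; split; lra.
move=> /andP[c0 cab].
apply: (@le_trans _ _ ((a + b) ^+ 2)); first by rewrite ler_sqr// nnegrE; lra.
apply: (@le_trans _ _ (2 * a ^+ 2 + 2 * b ^+ 2)); last by lra.
by rewrite -subr_ge0 (_ : _ - _ = (a - b) ^+ 2) ?sqr_ge0//; ring.
Qed.

Lemma grid_bound_continuous F A : nondecreasing F -> grid_bound F A -> 0 <= A ->
  continuous F.
Proof.
move=> ndF gF A0 x; apply/cvgrPdist_lt => e e0.
(* Chosen so that [4 * A * h < e ^+ 2]; the [+ 1] covers [A = 0]. *)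
pose h := e ^+ 2 / (4 * A + 1).
have D0 : 0 < 4 * A + 1 by lra.
have h0 : 0 < h by rewrite divr_gt0// exprn_gt0.
have small y : F (y + h) - F y < e.
  have := grid_bound_shift y ndF gF h0.
  have hh : 4 * A * h < e ^+ 2.
    rewrite /h mulrA ltr_pdivrMr// mulrC ltr_pM2l ?exprn_gt0//; lra.
  move=> /le_lt_trans/(_ hh); rewrite ltr_sqr ?nnegrE ?(ltW e0)//.
  by rewrite subr_ge0; apply: ndF; rewrite lerDl ltW.
near=> y.
have : `|x - y| < h by near: y; exact: (@cvgr_dist_lt _ _ _ (nbhs x) _ id x).
rewrite ltr_norml => /andP[xy1 xy2].
have [xy|yx] := leP x y.
  rewrite ler0_norm; last by rewrite subr_le0 ndF.
  by rewrite opprB; apply: le_lt_trans (small x); rewrite lerD2r ndF//; lra.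
rewrite ger0_norm; last by rewrite subr_ge0 ndF// ltW.
by apply: le_lt_trans (small y); rewrite lerD2r ndF//; lra.
Unshelve. all: by end_near. Qed.

End grid.

(** * Absolute continuity of the Stieltjes measure *)

Section stieltjes.
Variable R : realType.
Local Notation mu := (@lebesgue_measure R).
Variables (F : cumulative R R) (A : R).
Hypothesis gF : grid_bound F A.
Local Notation nu := (lebesgue_stieltjes_measure F).

Lemma stieltjes_oc (a b : R) : a <= b -> nu `]a, b]%classic = (F b - F a)%:E.
Proof.
move=> ab.
rewrite /lebesgue_stieltjes_measure/= /measure_extension measurable_mu_extE/=; last exact: is_ocitv.
exact: wlength_itv_bnd.
Qed.

(** With [(m + 1) ^ 2] cells of width [1 / (m + 1)] on each side, the grids become finer and at the
    same time exhaust the line. *)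
Let h m : R := m.+1%:R^-1.
Let N m := (m.+1 * m.+1)%N.
Let h_gt0 m : 0 < h m. Proof. by rewrite invr_gt0 ltr0n. Qed.
Let Nh m : (N m)%:R * h m = m.+1%:R.
Proof. by rewrite /N /h natrM mulfK// pnatr_eq0. Qed.
Let I m k := `]gridpt (N m) (h m) k, gridpt (N m) (h m) k.+1]%classic.

(* On a cell of length [h] with increment [D], [2 * t * D <= t ^+ 2 * h + D ^+ 2 / h]. *)
Lemma stieltjes_open (U : set R) (t : R) : open U -> 0 <= t ->
  ((2 * t)%:E * nu U <= (t ^+ 2)%:E * mu U + A%:E)%E.
Proof.
move=> oU t0.
pose J m k := if `[< I m k `<=` U >] then I m k else set0.
pose W m := \big[setU/set0]_(k < N m + N m) J m k.
have mJ m k : measurable (J m k) by rewrite /J; case: ifP => // _; exact: measurable_itv.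
have mW m : measurable (W m) by apply: bigsetU_measurable => k _; exact: mJ.
have tJ m : trivIset setT (J m).
  apply/trivIsetP => k l _ _ kl; apply/seteqP; split => // x [].
  rewrite /J; case: ifP => // _; case: ifP => // _.
  rewrite /I /= !in_itv/= => hk hl; move/eqP: kl; apply.
  exact: grid_cell_inj hk hl.
have WU m : W m `<=` U.
  rewrite /W => x; rewrite -bigcup_mkord => -[k _].
  by rewrite /J; case: asboolP => // IU; exact: IU.
have mU : measurable U by exact: open_measurable.
have key m : ((2 * t)%:E * nu (W m) <= (t ^+ 2)%:E * mu U + A%:E)%E.
  apply: (@le_trans _ _ ((t ^+ 2)%:E * mu (W m) + A%:E)%E); last first.
    rewrite leeD2r// lee_wpmul2l ?lee_fin ?sqr_ge0//.
    by apply: le_measure; rewrite ?inE; [exact: mW|exact: mU|exact: WU].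
  have nuW : (nu (W m) = \sum_(k < N m + N m) nu (J m k))%E.
    exact: (@measure_bigsetU _ _ _ nu (J m) (mJ m) (tJ m)).
  have muW : (mu (W m) = \sum_(k < N m + N m) mu (J m k))%E.
    exact: (@measure_bigsetU _ _ _ mu (J m) (mJ m) (tJ m)).
  rewrite nuW muW.
  pose D k := F (gridpt (N m) (h m) k.+1) - F (gridpt (N m) (h m) k).
  have hA : \sum_(k < N m + N m) (D k ^+ 2 / h m) <= A.
    by rewrite -mulr_suml ler_pdivrMr//; exact: gF.
  apply: (@le_trans _ _ (\sum_(k < N m + N m) ((t ^+ 2)%:E * mu (J m k) + (D k ^+ 2 / h m)%:E))%E).
    rewrite ge0_sume_distrr//; apply: lee_sum => k _.
    have g0 : gridpt (N m) (h m) k <= gridpt (N m) (h m) k.+1 by exact: gridpt_le.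
    rewrite /J; case: ifP => _; last first.
      by rewrite !measure0 !mule0 add0e lee_fin divr_ge0 ?sqr_ge0// ltW.
    rewrite /I stieltjes_oc//.
    rewrite [X in (_ * X + _)%E](_ : _ = (h m)%:E); last first.
      rewrite [LHS]lebesgue_measure_itv/= lte_fin gridptS ltrDl h_gt0.
      by rewrite -EFinB addrAC subrr add0r.
    rewrite -EFinM -EFinM -EFinD lee_fin -/(D k).
    rewrite -(ler_pM2r (h_gt0 m)) [leRHS]mulrDl mulfVK ?gt_eqF//.
    by have := sqr_ge0 (t * h m - D k); rewrite sqrrB; lra.
  rewrite big_split/= -ge0_sume_distrr//; apply: leeD => //.
  by rewrite sumEFin lee_fin.
(* The unions [W m] of cells inside [U] need not increase with [m]. The tail intersections do, and
   they fill [U] because every cell around a given point eventually lies in [U]. *)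
pose V m := \bigcap_(j in [set j | (m <= j)%N]) W j.
have mV m : measurable (V m) by apply: bigcap_measurableType => j _; exact: mW.
have ndV : {homo V : n m / (n <= m)%N >-> (n <= m)%O}.
  move=> m n mn; apply/subsetPset => x Vx j /= nj; apply: Vx => /=.
  exact: leq_trans nj.
have UV : \bigcup_m V m = U.
  apply/seteqP; split=> [x [m _ /(_ m)]|x Ux].
    by move=> /(_ (leqnn m)); exact: WU.
  have /nbhs_ballP[e /= e0 He] := oU x Ux.
  have [m Hm] : exists m, forall j, (m <= j)%N -> h j < e /\ `|x| < j.+1%:R.
    exists (Num.bound (e^-1 + `|x|)) => j mj.
    have jb : e^-1 + `|x| < j.+1%:R.
      apply: (@lt_le_trans _ _ (Num.bound (e^-1 + `|x|))%:R); last first.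
        by rewrite ler_nat ltnW.
      by apply: archi_boundP; rewrite addr_ge0// invr_ge0 ltW.
    have e'0 : 0 < e^-1 by rewrite invr_gt0.
    split; last by lra.
    rewrite /h -[ltRHS]invrK ltf_pV2 ?posrE ?ltr0n//.
    by have := normr_ge0 x; lra.
  exists m => // j /= mj; have [hj xj] := Hm j mj.
  have [|k kn kx] := @gridpt_locater _ (N j) (h j) x (h_gt0 j); first by rewrite Nh.
  rewrite /W -bigcup_mkord; exists k => //=.
  rewrite /J asboolT; first by rewrite /I /= in_itv.
  move=> y; rewrite /I /= in_itv/= => /andP[y1 y2]; apply: He.
  move: kx y1 y2; rewrite gridptS => /andP[x1 x2] y1 y2.
  by rewrite /ball/= ltr_norml; apply/andP; split; lra.
have cV := @nondecreasing_cvg_mu _ _ _ nu V mV _ ndV.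
rewrite UV in cV; have {}cV := cV mU.
have : (fun m => ((2 * t)%:E * nu (V m))%E) @ \oo --> ((2 * t)%:E * nu U)%E.
  by apply: cvgeZl.
move=> /cvg_lim <- //; apply: lime_le.
  by apply/cvg_ex; exists ((2 * t)%:E * nu U)%E; apply: cvgeZl.
apply: nearW => m; apply: (le_trans _ (key m)).
rewrite lee_wpmul2l ?lee_fin ?mulr_ge0//.
apply: le_measure; rewrite ?inE; [exact: mV|exact: mW|].
by move=> x /(_ m); apply => /=.
Qed.

(** A null set lies in open sets of arbitrarily small Lebesgue measure, so the bound on open sets
    gives [2 * t * nu X <= A] for each [t >= 0]; a large [t] forces [nu X = 0]. *)
Lemma stieltjes_dominates : nu `<< mu.
Proof.
apply/null_content_dominatesP => X mX X0.
have bound t : 0 <= t -> ((2 * t)%:E * nu X <= A%:E)%E.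
  move=> t0; apply/lee_addgt0Pr => e e0.
  pose d := e / (t ^+ 2 + 1).
  have D0 : 0 < t ^+ 2 + 1 by rewrite ltr_wpDl// sqr_ge0.
  have d0 : 0 < d by rewrite divr_gt0.
  have [|U [oU XU Ud]] := lebesgue_regularity_outer mX _ d0.
    by rewrite [X in (X < _)%E]X0.
  have mU : measurable U by exact: open_measurable.
  have muU : (mu U <= d%:E)%E.
    rewrite -(setDUK XU) measureU//; last 2 first.
    - exact: measurableD.
    - by rewrite setDE setICA setICr setI0.
    by rewrite [X in (X + _)%E]X0 add0e ltW.
  apply: (@le_trans _ _ ((2 * t)%:E * nu U)%E).
    rewrite lee_wpmul2l ?lee_fin ?mulr_ge0//.
    by apply: le_measure; rewrite ?inE.
  apply: (le_trans (stieltjes_open oU t0)).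
  rewrite addeC leeD2l//.
  apply: (@le_trans _ _ ((t ^+ 2)%:E * d%:E)%E).
    by rewrite lee_wpmul2l// lee_fin sqr_ge0.
  rewrite -EFinM lee_fin /d mulrA ler_pdivrMr// mulrC ler_wpM2l ?(ltW e0)//; lra.
apply/eqP; rewrite -measure_le0; apply/lee_addgt0Pr => e e0; rewrite add0e.
have A0 : 0 <= A by have := bound 0 (lexx _); rewrite mulr0 mul0e lee_fin.
(* With this [t] the bound reads [nu X <= A * e / (A + 1) <= e]. *)
have t0 : 0 < (A + 1) / (2 * e) by rewrite divr_gt0 ?mulr_gt0// ltr_wpDl.
have := bound _ (ltW t0).
rewrite -lee_pdivlMl; last by rewrite mulr_gt0.
move=> /le_trans; apply.
rewrite -EFinM lee_fin mulrC ler_pdivrMr; last by rewrite mulr_gt0.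
rewrite [leRHS](_ : _ = A + 1); first by lra.
by field; rewrite gt_eqF.
Qed.

Lemma stieltjes_finite B : (forall x, `|F x| <= B) -> (nu setT < +oo)%E.
Proof.
move=> FB.
have -> : [set: measurableTypeR R] = \bigcup_n `]- n%:R, n%:R]%classic.
  apply/seteqP; split=> // x _; exists (Num.bound x) => //=.
  rewrite in_itv/=; apply/andP; split; last by apply: ltW; exact: ltr_bound.
  by rewrite ltrNl; exact: ltrNbound.
apply: (@le_lt_trans _ _ (2 * B)%:E); last exact: ltry.
have cV : nu (`]- n%:R, n%:R]%classic : set R) @[n --> \oo] -->
    nu (\bigcup_n `]- n%:R, n%:R]%classic).
  apply: (@nondecreasing_cvg_mu _ _ _ nu (fun n => `]- n%:R, n%:R]%classic)).
  - by move=> i; exact: measurable_itv.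
  - by apply: bigcup_measurable => i _; exact: measurable_itv.
  - move=> m n mn; apply/subsetPset => x /=; rewrite !in_itv/= => /andP[x1 x2].
    have mn' : m%:R <= n%:R :> R by rewrite ler_nat.
    by apply/andP; split; lra.
rewrite -(cvg_lim _ cV)//; apply: lime_le; first by apply/cvg_ex; eexists; exact: cV.
apply: nearW => n; rewrite stieltjes_oc ?lee_fin; last first.
  by rewrite (@le_trans _ _ 0)// oppr_le0.
have := FB n%:R; have := FB (- n%:R); rewrite !ler_norml => /andP[? ?] /andP[? ?]; lra.
Qed.

End stieltjes.

(** * The square integrable density *)

Section density.
Variable R : realType.
Local Notation mu := (@lebesgue_measure R).
Implicit Types (F f : R -> R).

(** A grid cell contains [x] without having it as an end. Its difference quotient still converges,
    since the errors of the two pieces on either side of [x] are weighted by lengths that add up to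
    [b - a]. *)
Lemma is_derive_quotient F (x d e : R) : is_derive x 1 F d -> 0 < e ->
  exists2 r : R, 0 < r & forall a b, a <= x < b -> b - a < r ->
    `|d - (F b - F a) / (b - a)| <= e.
Proof.
move=> [dF Fd] e0.
have cd : h^-1 *: ((F \o shift x) (h *: 1) - F x) @[h --> 0^'] --> d.
  by rewrite -Fd; exact: dF.
move/cvgrPdist_le: cd => /(_ e e0) [r /= r0 Hr].
exists r => // a b /andP[ax xb] bar.
have K y : `|y - x| < r -> `|d * (y - x) - (F y - F x)| <= e * `|y - x|.
  move=> yx; have [->|yNx] := eqVneq y x.
    by rewrite !subrr mulr0 subrr normr0 mulr0.
  have yx0 : y - x != 0 by rewrite subr_eq0.
  have := Hr (y - x); rewrite /= sub0r normrN => /(_ yx yx0).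
  rewrite /GRing.scale/= mulr1 subrK => h.
  rewrite -ler_pdivrMr ?normr_gt0// -normf_div mulrBl mulfK//.
  by rewrite [(F y - F x) / _]mulrC.
have Ka := K a; have Kb := K b.
have ab0 : 0 < b - a by lra.
rewrite -(ler_pM2r ab0) -[X in `|_| * X]gtr0_norm// -normrM mulrBl mulfVK ?gt_eqF//.
rewrite [X in _ <= e * X](_ : _ = `|a - x| + `|b - x|); last first.
  by rewrite ler0_norm ?subr_le0// ger0_norm ?subr_ge0 ?(ltW xb)//; ring.
rewrite (_ : _ - _ = (d * (b - x) - (F b - F x)) - (d * (a - x) - (F a - F x))); last by ring.
have ha : `|a - x| < r by rewrite ler0_norm ?subr_le0//; lra.
have hb : `|b - x| < r by rewrite ger0_norm ?subr_ge0 ?(ltW xb)//; lra.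
apply: (le_trans (ler_normB _ _)).
by have := Ka ha; have := Kb hb; rewrite mulrDr; lra.
Qed.

(** The squared difference quotients on the cells form step functions of integral at most [A], and
    they converge to [f ^+ 2] almost everywhere; Fatou's lemma concludes. *)
Lemma grid_bound_L2 F f (A : R) : grid_bound F A ->
  (forall x, 0 <= f x) -> measurable_fun setT f ->
  {ae mu, forall x : R, is_derive x 1 F (f x)} ->
  (\int[mu]_x ((f x) ^+ 2)%:E <= A%:E)%E.
Proof.
move=> gF f0 mf dF.
pose h m : R := m.+1%:R^-1.
pose N m := (m.+1 * m.+1)%N.
have h0 m : 0 < h m by rewrite invr_gt0 ltr0n.
have Nh m : (N m)%:R * h m = m.+1%:R.
  by rewrite /N /h natrM mulfK// pnatr_eq0.
pose g m := gridpt (N m) (h m).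
pose D m k := F (g m k.+1) - F (g m k).
pose I m k := `[g m k, g m k.+1[%classic.
pose S m (x : R) : \bar R := \sum_(k < N m + N m) ((D m k / h m) ^+ 2 * \1_(I m k) x)%:E.
have mS m k : measurable_fun setT (fun x => ((D m k / h m) ^+ 2 * \1_(I m k) x)%:E).
  apply/measurable_EFinP; apply: measurable_funM => //.
  by apply: measurable_indic; exact: measurable_itv.
have S0 m k x : (0 <= ((D m k / h m) ^+ 2 * \1_(I m k) x)%:E)%E.
  by rewrite lee_fin mulr_ge0// ?sqr_ge0// indicE.
apply: (@fatou_bound _ S _ (fun=> A%:E)).
- by move=> m; apply: emeasurable_sum => k; exact: mS.
- by move=> m x; apply: sume_ge0 => k _; exact: S0.
- by apply/measurable_EFinP; exact: measurable_funX.
- by move=> x; rewrite lee_fin sqr_ge0.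
- apply: filterS dF; first exact: (ae_filter_ringOfSetsType mu).
  move=> x dx.
  suff cS : S m x @[m --> \oo] --> ((f x) ^+ 2)%:E.
    by rewrite (cvg_limn_einf_sup cS).1.
  pose q m := fine (S m x).
  have Sfin m k : (k < N m + N m)%N -> g m k <= x < g m k.+1 ->
      S m x = ((D m k / h m) ^+ 2)%:E.
    move=> kn kx; rewrite /S (bigD1 (Ordinal kn))//= big1; last first.
      move=> l lk; rewrite indicE memNset ?mulr0// /I/= in_itv/= => lx.
      move/eqP: lk; apply; apply: val_inj => /=.
      exact: grid_cell_injl lx kx.
    by rewrite adde0 indicE mem_set ?mulr1// /I/= in_itv.
  suff cq : (fun m => (S m x)) @ \oo --> ((f x) ^+ 2)%:E by [].
  have near_q e : 0 < e -> \forall m \near \oo, exists2 y : R,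
      `|f x - y| <= e & S m x = (y ^+ 2)%:E.
    move=> e0; have [r r0 Hr] := is_derive_quotient dx e0.
    near=> m.
    have hm : h m < r.
      have : `|0 - harmonic m| < r by near: m; apply: cvgr_dist_lt => //; exact: cvg_harmonic.
      by rewrite sub0r normrN /harmonic gtr0_norm// invr_gt0 ltr0n.
    have xm : `|x| < m.+1%:R.
      have : `|x| < m%:R by near: m; exact: nbhs_infty_gtr.
      by rewrite -natr1; lra.
    have [|k kn kx] := @gridpt_locate _ (N m) (h m) x (h0 m); first by rewrite Nh.
    exists (D m k / h m); last exact: Sfin.
    have gh : g m k.+1 - g m k = h m by rewrite /g gridptS addrAC subrr add0r.
    by have := Hr _ _ kx; rewrite gh => /(_ hm).
  have near_fin : \forall m \near \oo, S m x \is a fin_num.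
    by have := near_q 1 ltr01; apply: filterS => m [y _ ->].
  apply/fine_cvgP; split => //.
  apply/cvgrPdist_le => e e0.
  (* [|f x ^+ 2 - y ^+ 2|] is [|f x - y|] times [|f x + y|], and the last factor is at most
     [2 * f x + 1] once [|f x - y| <= 1]. *)
  pose e' := Num.min 1 (e / (2 * f x + 1)).
  have D0 : 0 < 2 * f x + 1 by have := f0 x; lra.
  have e'0 : 0 < e' by rewrite lt_min ltr01 divr_gt0.
  have := near_q e' e'0; apply: filterS => m [y yf Sy] /=; rewrite Sy /=.
  have e'1 : e' <= 1 by rewrite ge_min lexx.
  have e'2 : e' * (2 * f x + 1) <= e by rewrite -ler_pdivlMr// ge_min lexx orbT.
  rewrite subr_sqr normrM; apply: le_trans e'2; apply: ler_pM => //.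
  have -> : f x + y = 2 * f x - (f x - y) by ring.
  rewrite (le_trans (ler_normB _ _))// lerD//; last exact: le_trans yf e'1.
  by rewrite ger0_norm// mulr_ge0.
- move=> m; rewrite /S ge0_integral_sum//; last by move=> k; exact: mS.
  rewrite (eq_bigr (fun k : 'I__ => (D m k ^+ 2 / h m)%:E)); last first.
    move=> k _; rewrite (_ : (fun x => _) = (fun x => ((D m k / h m) ^+ 2)%:E * (\1_(I m k) x)%:E)%E)//.
    rewrite ge0_integralZl//; last 2 first.
      by apply/measurable_EFinP; apply: measurable_indic; exact: measurable_itv.
      by rewrite lee_fin sqr_ge0.
    rewrite integral_indic//; last exact: measurable_itv.
    rewrite setIT [X in (_ * X)%E](_ : _ = (h m)%:E); last first.
      rewrite [LHS]lebesgue_measure_itv/= lte_fin /g gridptS ltrDl h0.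
      by rewrite -EFinB addrAC subrr add0r.
    rewrite -EFinM; congr EFin; field.
    by rewrite gt_eqF.
  rewrite sumEFin lee_fin -mulr_suml ler_pdivrMr//.
  exact: gF.
- exact: cvg_cst.
Unshelve. all: by end_near. Qed.

(** Radon-Nikodym gives a density [f] of the Stieltjes measure, so [F] is a primitive of [f].
    Lebesgue differentiation then identifies [f] with the derivative of [F] almost everywhere, which
    is what the square bound requires. *)
Lemma grid_bound_primitive F (A B : R) : nondecreasing F -> grid_bound F A ->
  0 <= A -> (forall x, `|F x| <= B) ->
  exists f, [/\ forall x, 0 <= f x, primitive F f &
    (\int[mu]_x ((f x) ^+ 2)%:E <= A%:E)%E].
Proof.
move=> ndF gF A0 FB.
have cF := grid_bound_continuous ndF gF A0.
pose Fm := isCumulative.Build R _ R F ndF (right_continuousW cF).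
pose Fc : cumulative R R := HB.pack F Fm.
have gFc : grid_bound Fc A by [].
pose nu0 := lebesgue_stieltjes_measure Fc.
have fin : fin_num_fun nu0.
  by apply: lty_fin_num_fun; exact: (@stieltjes_finite _ Fc B).
pose nm := @Measure_isFinite.Build _ (measurableTypeR R) R nu0 fin.
pose nu : {finite_measure set (measurableTypeR R) -> \bar R} := HB.pack nu0 nm.
have dom : nu `<< mu by exact: (@stieltjes_dominates _ Fc A).
have [f0 [f0_ge0 f0_fin f0_int f0E]] := radon_nikodym_sigma_finite dom.
pose f x := fine (f0 x).
have fE : f0 = EFin \o f by apply/funext => x /=; rewrite fineK.
have f_ge0 x : 0 <= f x by rewrite fine_ge0.
have fint : mu.-integrable setT (EFin \o f) by rewrite -fE.
have iloc : loc_integrable f.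
  by move=> a b; apply: (integrableS _ _ _ fint) => //; exact: measurable_itv.
have pF : primitive F f.
  split => // a b ab.
  have := f0E _ (measurable_itv `]a, b]); rewrite fE => h.
  have := @stieltjes_oc _ Fc a b ab => h'.
  rewrite -Rintegral_itv_obnd_cbnd; last first.
    by apply: (integrableS _ _ _ fint) => //; exact: measurable_itv.
  by rewrite /Rintegral -[X in fine X]h [X in fine X]h'.
exists f; split => //.
apply: grid_bound_L2 gF f_ge0 _ _; first exact: loc_integrable_measurable.
have iNy y : mu.-integrable `]-oo, y] (EFin \o f).
  by apply: (integrableS _ _ _ fint) => //; exact: measurable_itv.
have := FTC1Ny iNy (loc_integrable_locally iloc).
set F0 := fun x => _.
have FE : F = (fun x => F0 x + (F 0 - F0 0)).
  apply/funext => x.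
  have E a b : a <= b -> F b - F a = F0 b - F0 a.
    move=> ab; rewrite (pF.2 _ _ ab) /F0.
    rewrite (@Rintegral_itvB _ f -oo%O (BRight b) a)//.
    rewrite Rintegral_itv_obnd_cbnd//.
    by apply: (integrableS _ _ _ fint) => //; exact: measurable_itv.
  by have [x0|/ltW x0] := leP 0 x; have := E _ _ x0; lra.
apply: filterS; first exact: (ae_filter_ringOfSetsType mu).
move=> x [dF0 F0x].
have dF0' : is_derive x 1 F0 (f x).
  by apply: DeriveDef; [exact: dF0|rewrite -derive1E; exact: F0x].
rewrite FE -[f x]addr0.
exact: is_deriveD.
Qed.

End density.

(** * Symmetric decreasing rearrangement *)

Section equimeasurable.
Variable R : realType.
Local Notation mu := (@lebesgue_measure R).
Implicit Types (u v : R -> R).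

(** The image measures agree on rays, and by uniqueness on Borel sets inside [D n], where they are
    finite; then [n] tends to infinity. The zero level, possibly of infinite measure, is harmless
    because [G] vanishes there. The factor [l] is [1] for the rearrangement and the dilation factor
    for stretching. *)
Lemma equimeasurable_integral u v (l : R) (G : R -> R) : 0 <= l ->
  measurable_fun setT u -> measurable_fun setT v ->
  (forall s, 0 < s -> (mu [set x | (s < v x)%R] < +oo)%E) ->
  (forall s, 0 < s ->
    (mu [set x | (s < u x)%R] = l%:E * mu [set x | (s < v x)%R])%E) ->
  measurable_fun setT G -> (forall p, 0 <= G p) -> (forall p, p <= 0 -> G p = 0) ->
  (\int[mu]_x (G (u x))%:E = l%:E * \int[mu]_x (G (v x))%:E)%E.
Proof.
move=> l0 mu_ mv vfin uv mG G0 Gneg.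
pose Pu0 : {measure set R -> \bar R} := pushforward mu u.
pose Pv0 : {measure set R -> \bar R} := pushforward mu v.
pose Pu := Pu0 mu_; pose Pv : {measure set R -> \bar R} := mscale (NngNum l0) (Pv0 mv).
pose a n : R := n.+1%:R^-1.
have a0 n : 0 < a n by rewrite invr_gt0 ltr0n.
pose D n : set R := `]a n, +oo[%classic.
have mD n : measurable (D n) by exact: measurable_itv.
have preimD (f : R -> R) s : f @^-1` `]s, +oo[ = [set x | s < f x].
  by apply/seteqP; split => x /=; rewrite in_itv/= andbT.
have PuE (A : set R) : Pu A = mu (u @^-1` A) by [].
have PvE (A : set R) : Pv A = (l%:E * mu (v @^-1` A))%E by [].
have rays s : 0 < s -> Pu `]s, +oo[%classic = Pv `]s, +oo[%classic.
  by move=> s0; rewrite PuE PvE !preimD uv.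
have eqn n A : measurable A -> A `<=` D n -> Pu A = Pv A.
  move=> mA AD; rewrite -(setIidl AD).
  suff : mrestr Pu (mD n) A = mrestr Pv (mD n) A by [].
  apply: (measure_unique (@RGenOInfty.G R) (fun k => `]- k%:R, +oo[%classic)) => //.
  - exact: RGenOInfty.measurableE.
  - move=> _ _ [x ->] [y ->]; exists (Num.max x y).
    apply/seteqP; split => r /=; rewrite !in_itv/= !andbT gt_max.
      by move=> [-> ->].
    by move=> /andP[-> ->].
  - by move=> k; exists (- k%:R).
  - apply/seteqP; split => // x _; exists (Num.bound x) => //=.
    by rewrite in_itv/= andbT ltrNl; exact: ltrNbound.
  - move=> _ [x ->].
    change (Pu (`]x, +oo[%classic `&` D n) = Pv (`]x, +oo[%classic `&` D n)).
    have -> : `]x, +oo[%classic `&` D n = `]Num.max x (a n), +oo[%classic.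
      apply/seteqP; split => r /=; rewrite /D/= !in_itv/= !andbT gt_max.
        by move=> [-> ->].
      by move=> /andP[-> ->].
    by apply: rays; rewrite lt_max a0 orbT.
  - move=> k; change (Pu (`](- k%:R)%R, +oo[%classic `&` D n) < +oo)%E.
    apply: (@le_lt_trans _ _ (Pu (D n))).
      apply: le_measure; rewrite ?inE//.
      by apply: measurableI => //; exact: measurable_itv.
    rewrite /D rays// PvE preimD.
    by apply: lte_mul_pinfty => //; exact: vfin.
have step n : (\int[mu]_(x in u @^-1` D n) (G (u x))%:E =
    l%:E * \int[mu]_(x in v @^-1` D n) (G (v x))%:E)%E.
  have mGD : measurable_fun (D n) (EFin \o G) by apply/measurable_EFinP; exact: measurable_funTS.
  have h1 := @ge0_integral_pushforward _ _ (measurableTypeR R) R R u mu_ mu (D n) (EFin \o G) (mD n) mGD.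
  have h2 := @ge0_integral_pushforward _ _ (measurableTypeR R) R R v mv mu (D n) (EFin \o G) (mD n) mGD.
  have G0' : {in D n, forall y, (0 <= (EFin \o G) y)%E} by move=> y _; rewrite lee_fin.
  have /= <- := h1 G0'; have /= <- := h2 G0'.
  have -> := @eq_measure_integral _ _ _ (D n) Pv Pu (EFin \o G) (eqn n).
  by rewrite /Pv ge0_integral_mscale// => y _; rewrite lee_fin.
have lim (f : R -> R) : measurable_fun setT f ->
    (\int[mu]_(x in f @^-1` D n) (G (f x))%:E)%E @[n --> \oo] -->
    (\int[mu]_x (G (f x))%:E)%E.
  move=> mf.
  have -> : (\int[mu]_x (G (f x))%:E = \int[mu]_(x in \bigcup_n (f @^-1` D n)) (G (f x))%:E)%E.
    rewrite [RHS]integral_mkcond; apply: eq_integral => x _; rewrite patchE.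
    case: ifPn => // /negP; rewrite inE => nD.
    rewrite Gneg// leNgt; apply/negP => fx0; apply: nD.
    exists (Num.bound (f x)^-1) => //=; rewrite /D /= in_itv/= andbT /a.
    rewrite -[ltRHS]invrK ltf_pV2 ?posrE ?invr_gt0// ?ltr0n//.
    apply: (@lt_trans _ _ (Num.bound (f x)^-1)%:R); last by rewrite ltr_nat.
    by apply: archi_boundP; rewrite invr_ge0 ltW.
  have mfD n : measurable (f @^-1` D n) by rewrite -[X in measurable X]setTI; exact: mf.
  apply: ge0_nondecreasing_set_cvg_integral.
  - move=> m n mn; apply/subsetPset => x /=; rewrite /D /= !in_itv/= !andbT.
    by apply: le_lt_trans; rewrite /a lef_pV2 ?posrE ?ltr0n// ler_nat.
  - by move=> n; exact: mfD.
  - move=> n; apply: measurable_funTS; apply/measurable_EFinP.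
    exact: measurableT_comp.
  - by move=> n x _; rewrite lee_fin.
have := lim _ mu_; under eq_cvg do rewrite step.
move=> cu; have cv := cvgeZl (isT : l%:E \is a fin_num) (lim _ mv).
exact: cvg_unique cu cv.
Qed.

End equimeasurable.

(** * Level crossings of continuous functions *)

Section crossing.
Variable R : realType.
Implicit Types f : R -> R.

(** [al] is the last point before [p] where [f <= s], and [be] the first point after [al] where
    [f >= t]; in between the values stay strictly inside. *)
Lemma upcrossing f (a p s t : R) : continuous f -> a <= p ->
  s < t -> f a <= s -> t <= f p ->
  exists al be, [/\ a <= al, al < be, be <= p & [/\ f al <= s, t <= f be &
    forall x, al < x < be -> s < f x < t]].
Proof.
move=> cf ap st fa fp.
have compactK (c d : R) (C : set R) : closed C -> compact (`[c, d] `&` f @^-1` C).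
  move=> clC; apply: (@subclosed_compact _ _ `[c, d]).
  - by apply: closedI; [exact: interval_closed|exact: preimage_closed].
  - exact: segment_compact.
  - by move=> x [].
have [al [[al1 al2] Hal]] : exists al, (`[a, p] `&` f @^-1` [set y | y <= s]) al /\
    forall x, (`[a, p] `&` f @^-1` [set y | y <= s]) x -> x <= al.
  have [|||al h H] := @compact_EVT_max _ _ id (`[a, p] `&` f @^-1` [set y | y <= s]).
  - by exists a; split => //=; rewrite in_itv/= lexx.
  - by apply: compactK; exact: closed_le.
  - by apply: continuous_subspaceT => x; exact: cvg_id.
  by exists al; split => //; [exact: set_mem|move=> x hx; exact: H (mem_set hx)].
move: al1; rewrite /= in_itv/= => /andP[a_al al_p].
have [be [[be1 be2] Hbe]] : exists be, (`[al, p] `&` f @^-1` [set y | t <= y]) be /\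
    forall x, (`[al, p] `&` f @^-1` [set y | t <= y]) x -> be <= x.
  have [|||be h H] := @compact_EVT_min _ _ id (`[al, p] `&` f @^-1` [set y | t <= y]).
  - by exists p; split => //=; rewrite in_itv/= lexx andbT.
  - by apply: compactK; exact: closed_ge.
  - by apply: continuous_subspaceT => x; exact: cvg_id.
  by exists be; split => //; [exact: set_mem|move=> x hx; exact: H (mem_set hx)].
move: be1; rewrite /= in_itv/= => /andP[al_be be_p].
exists al, be; split => //.
  rewrite lt_neqAle al_be andbT; apply/eqP => E; move: al2 be2 => /=; rewrite E.
  by move=> h1 h2; have := lt_le_trans st (le_trans h2 h1); rewrite ltxx.
split => // x /andP[ax xb]; apply/andP; split.
  rewrite ltNge; apply/negP => fx; have := Hal x.
  rewrite leNgt ax => /(_ _)/negP; case; last by [].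
  by split => //=; rewrite in_itv/= (le_trans a_al (ltW ax)) (le_trans (ltW xb) be_p).
rewrite ltNge; apply/negP => fx; have := Hbe x.
rewrite leNgt xb => /(_ _)/negP; case; last by [].
by split => //=; rewrite in_itv/= (ltW ax) (le_trans (ltW xb) be_p).
Qed.

Lemma downcrossing f (p b s t : R) : continuous f -> p <= b ->
  s < t -> t <= f p -> f b <= s ->
  exists al be, [/\ p <= al, al < be, be <= b & [/\ t <= f al, f be <= s &
    forall x, al < x < be -> s < f x < t]].
Proof.
move=> cf pb st fp fb.
have cfN : continuous (fun x => f (- x)).
  move=> x; apply: (@continuous_comp _ _ _ -%R f); last exact: cf.
  exact: oppr_continuous.
have [|||al [be [h1 h2 h3 [h4 h5 h6]]]] := @upcrossing _ (- b) (- p) s t cfN _ st.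
- by rewrite lerN2.
- by rewrite opprK.
- by rewrite opprK.
exists (- be), (- al); split; [lra|lra|lra|split => //].
by move=> x /andP[x1 x2]; have := h6 (- x); rewrite opprK; apply; apply/andP; split; lra.
Qed.

End crossing.

(** * Profiles and their derivatives *)

Section profile.
Variable R : realType.
Local Notation mu := (@lebesgue_measure R).
Implicit Types (u : R -> R) (B : R).

Definition profile u := [/\ forall y, 0 <= u y, forall y, u (- y) = u y &
  forall x y, 0 <= x -> x <= y -> u y <= u x].

(* [half_grid u B] expresses that the Dirichlet integral of [u'] ^+ 2 over the
   half-line is at most [B], in a form that passes to pointwise limits. *)
Definition half_grid u B := forall n (h : R), 0 < h ->
  \sum_(k < n) (u (k%:R * h) - u (k.+1%:R * h)) ^+ 2 <= B * h.

Lemma profile_le0 u x : profile u -> u x <= u 0.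
Proof.
move=> [_ uN ud]; have [x0|/ltW x0] := leP 0 x; first exact: ud.
by rewrite -uN; apply: ud => //; rewrite oppr_ge0.
Qed.

(** The grid and Stieltjes results concern nondecreasing functions. Flipping a profile on the right
    half-line gives an odd nondecreasing function, from which [u] is recovered as
    [u 0 - |odd_part u|]. *)
Definition odd_part u (x : R) : R := if 0 <= x then u 0 - u x else u x - u 0.

Lemma odd_part_nondecreasing u : profile u -> nondecreasing (odd_part u).
Proof.
move=> pu x y xy; have [_ uN ud] := pu; rewrite /odd_part.
have [x0|x0] := leP 0 x; have [y0|y0] := leP 0 y.
- by have := ud _ _ x0 xy; lra.
- by have := lt_le_trans y0 (le_trans x0 xy); rewrite ltxx.
- by have := profile_le0 x pu; have := profile_le0 y pu; lra.
- have : u x <= u y by rewrite -(uN x) -(uN y); apply: ud; lra.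
  by lra.
Qed.

Lemma odd_part_bounded u x : profile u -> `|odd_part u x| <= u 0.
Proof.
move=> pu; have [u0 _ _] := pu; have := profile_le0 x pu; have := u0 x.
by move=> h1 h2; rewrite /odd_part ler_norml; case: ifP => _; apply/andP; split; lra.
Qed.

Lemma odd_part_grid u B : profile u -> half_grid u B ->
  grid_bound (odd_part u) (2 * B).
Proof.
move=> [u0 uN ud] gu n h h0.
rewrite big_split_ord/= -mulrA mulr_natl mulr2n [leLHS]addrC.
have pos k : gridpt n h (n + k) = k%:R * h.
  by rewrite /gridpt natrD addrAC subrr add0r.
have posn k : 0 <= k%:R * h by rewrite mulr_ge0// ltW.
apply: lerD.
  rewrite (eq_bigr (fun k : 'I_n => (u (k%:R * h) - u (k.+1%:R * h)) ^+ 2)).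
    exact: gu.
  move=> k _; rewrite -addnS !pos /odd_part !posn; congr (_ ^+ 2).
  by ring.
(* Read backwards from the origin, the left cells repeat the increments of the right ones. *)
rewrite (reindex_inj rev_ord_inj)/=.
rewrite (eq_bigr (fun k : 'I_n => (u (k%:R * h) - u (k.+1%:R * h)) ^+ 2)).
  exact: gu.
have neg k : (k <= n)%N -> odd_part u (gridpt n h (n - k)) = u (k%:R * h) - u 0.
  move=> kn; have -> : gridpt n h (n - k) = - (k%:R * h).
    by rewrite /gridpt natrB//; ring.
  rewrite /odd_part oppr_ge0; case: ifPn => [k0|_]; last by rewrite uN.
  have -> : k%:R * h = 0 by apply/eqP; rewrite eq_le k0 posn.
  by rewrite oppr0 subrr.
move=> k _; rewrite -subSn// subSS !neg//; last exact: ltnW.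
by congr (_ ^+ 2); ring.
Qed.

Lemma profile_odd_part u x : profile u -> u x = u 0 - `|odd_part u x|.
Proof.
move=> pu; have := profile_le0 x pu; rewrite /odd_part; case: ifP => _ h.
  by rewrite ger0_norm ?subr_ge0//; lra.
by rewrite ler0_norm ?subr_le0//; lra.
Qed.

Lemma profile_continuous u B : profile u -> half_grid u B -> 0 <= B ->
  continuous u.
Proof.
move=> pu gu B0.
have cF : continuous (odd_part u).
  apply: grid_bound_continuous (odd_part_nondecreasing pu) (odd_part_grid pu gu) _.
  by rewrite mulr_ge0.
have -> : u = fun x => u 0 - `|odd_part u x|.
  by apply/funext => x; exact: profile_odd_part.
move=> x; apply: cvgB; first exact: cvg_cst.
exact: (cvg_norm (cF x)).
Qed.

Lemma profile_primitive u B : profile u -> half_grid u B -> 0 <= B ->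
  exists g, primitive u g /\ (\int[mu]_x ((g x) ^+ 2)%:E <= (2 * B)%:E)%E.
Proof.
move=> pu gu B0.
have B20 : 0 <= 2 * B by rewrite mulr_ge0.
have [f [f0 [fl Ff] f2]] := grid_bound_primitive (odd_part_nondecreasing pu)
  (odd_part_grid pu gu) B20 (fun x => odd_part_bounded x pu).
exists (fun x => if 0 <= x then - f x else f x); split; last first.
  apply: le_trans f2; rewrite le_eqVlt; apply/orP; left; apply/eqP.
  by apply: eq_integral => x _; case: ifP; rewrite ?sqrrN.
set g := fun x => _.
have mf := loc_integrable_measurable fl.
have mg : measurable_fun setT g.
  apply: (measurable_fun_ifT (f := fun x : R => 0 <= x)) => //.
    by apply: measurable_fun_ler => //; exact: measurable_cst.
  exact: measurable_funN.
have gl : loc_integrable g.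
  move=> a b; apply: (le_integrable _ _ _ (fl a b)) => //.
    by apply/measurable_EFinP; exact: measurable_funTS.
  by move=> x _; rewrite /= /g; case: ifP; rewrite ?normrN.
have pos a b : 0 <= a -> a <= b -> u b - u a = \int[mu]_(t in `[a, b]) g t.
  move=> a0 ab; transitivity (- (odd_part u b - odd_part u a)).
    by rewrite /odd_part a0 (le_trans a0 ab); ring.
  rewrite Ff// -mulN1r -RintegralZl//.
  apply: eq_Rintegral => x; rewrite inE/= in_itv/= => /andP[ax _].
  by rewrite /g (le_trans a0 ax) mulN1r.
have neg a b : a <= b -> b <= 0 -> u b - u a = \int[mu]_(t in `[a, b]) g t.
  move=> ab b0; transitivity (odd_part u b - odd_part u a).
    rewrite /odd_part; have [b0'|b0'] := leP 0 b; have [a0'|a0'] := leP 0 a.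
    - by have -> : b = a; lra.
    - by have -> : b = 0; lra.
    - by have := lt_le_trans b0' (le_trans a0' ab); rewrite ltxx.
    - by lra.
  (* At [b = 0] the sign of [g] already follows the right half-line, so the right end is dropped
     from both integrals. *)
  rewrite Ff// -!Rintegral_itv_bndo_bndc//; last 2 first.
  - by apply: (integrableS _ _ _ (gl a b)) => //; exact: subset_itv_co_cc.
  - by apply: (integrableS _ _ _ (fl a b)) => //; exact: subset_itv_co_cc.
  apply: eq_Rintegral => x; rewrite inE/= in_itv/= => /andP[_ xb].
  by rewrite /g ifF//; apply/negbTE; rewrite -ltNge; exact: lt_le_trans xb b0.
split => // a b ab.
have [a0|/ltW a0] := leP 0 a; first exact: pos.
have [b0|/ltW b0] := leP 0 b; last exact: neg.
by rewrite (Rintegral_chasles gl a0 b0) -neg// -pos//; ring.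
Qed.

End profile.

(** * Young's inequality and a height bound *)

Section integral_inequalities.
Variable R : realType.
Local Notation mu := (@lebesgue_measure R).
Implicit Types (u g : R -> R).

(** The pointwise inequality [2 * t * |g| <= t ^+ 2 + g ^+ 2], integrated. It takes the place of
    Cauchy-Schwarz, with the choice of [t] left to each use. *)
Lemma young_integral g (S : set R) (t : R) : measurable S ->
  measurable_fun setT g -> 0 <= t ->
  ((2 * t)%:E * \int[mu]_(x in S) `|g x|%:E <=
   (t ^+ 2)%:E * mu S + \int[mu]_(x in S) ((g x) ^+ 2)%:E)%E.
Proof.
move=> mS mg t0.
have mgS : measurable_fun S (fun x => `|g x|%:E).
  by apply: measurable_funTS; apply/measurable_EFinP; exact: measurableT_comp.
have mg2 : measurable_fun S (fun x => ((g x) ^+ 2)%:E).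
  by apply: measurable_funTS; apply/measurable_EFinP; exact: measurable_funX.
rewrite -ge0_integralZl//; last by rewrite lee_fin mulr_ge0.
rewrite -integral_cst// -ge0_integralD//; last 2 first.
- by move=> x _; rewrite lee_fin sqr_ge0.
- by move=> x _; rewrite lee_fin sqr_ge0.
apply: ge0_le_integral => //.
- by move=> x _; rewrite -EFinM lee_fin !mulr_ge0.
- exact: measurable_funeM.
- by apply: emeasurable_funD => //; exact: measurable_cst.
- move=> x _; rewrite -EFinM -EFinD lee_fin.
  have := sqr_ge0 (t - `|g x|); rewrite sqrrB real_normK ?num_real//.
  lra.
Qed.

Lemma primitive_dist_le u g (a b : R) : primitive u g -> a <= b ->
  (`|u b - u a|%:E <= \int[mu]_(x in `]a, b[) `|g x|%:E)%E.
Proof.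
move=> [gl ug] ab; rewrite ug//.
have mg := loc_integrable_measurable gl.
rewrite EFin_normr_Rintegral//.
have mab : measurable_fun `[a, b] (EFin \o g).
  by apply: measurable_funTS; exact/measurable_EFinP.
apply: (le_trans (le_abse_integral mu (measurable_itv _) mab)).
rewrite [leLHS]integral_itv_bndoo//.
by apply: measurable_funTS; apply: measurableT_comp => //; exact/measurable_EFinP.
Qed.

(** On [[x, x + 1]] Young's inequality with [t = 1] bounds the drop of [psi] below [psi x] by
    [(1 + A) / 2]; averaging over this unit interval brings in the mass [w]. *)
Lemma primitive_bounded psi g (w A : R) : primitive psi g ->
  (forall y, 0 <= psi y) -> (\int[mu]_y (psi y)%:E = w%:E)%E ->
  (\int[mu]_x ((g x) ^+ 2)%:E <= A%:E)%E ->
  forall x, psi x <= w + (1 + A) / 2.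
Proof.
move=> pg psi0 psiw gA x.
have cpsi := primitive_continuous pg.
have mpsi : measurable_fun setT psi by exact: continuous_measurable_fun.
have mg : measurable_fun setT g by case: pg => /loc_integrable_measurable.
pose J := `[x, x + 1]%classic : set R.
have mJ : measurable J by exact: measurable_itv.
have muJ : mu J = 1%E.
  by rewrite [LHS]lebesgue_measure_itv/= lte_fin ltrDl ltr01 -EFinB addrAC subrr add0r.
have near_x y : J y -> psi x <= psi y + (1 + A) / 2.
  rewrite /J /= in_itv/= => /andP[xy y1].
  suff : (`|psi y - psi x|%:E <= ((1 + A) / 2)%:E)%E.
    by rewrite lee_fin ler_norml => /andP[+ _]; lra.
  apply: (le_trans (primitive_dist_le pg xy)).
  have := @young_integral g `]x, y[ 1 (measurable_itv _) mg ler01.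
  rewrite mulr1 expr1n mul1e => h.
  have h2 : (2%:E * \int[mu]_(z in `]x, y[) `|g z|%:E <= (1 + A)%:E)%E.
    apply: (le_trans h); rewrite EFinD; apply: leeD.
      rewrite [leLHS]lebesgue_measure_itv/=; case: ifP => // _; rewrite -EFinB lee_fin; lra.
    apply: le_trans gA; apply: ge0_subset_integral => //.
      by apply/measurable_EFinP; exact: measurable_funX.
    by move=> z _; rewrite lee_fin sqr_ge0.
  by move: h2; rewrite -lee_pdivlMl// -EFinM mulrC.
suff : ((psi x)%:E <= (w + (1 + A) / 2)%:E)%E by rewrite lee_fin.
have A0 : 0 <= A.
  by rewrite -lee_fin; apply: le_trans gA; apply: integral_ge0 => z _; rewrite lee_fin sqr_ge0.
rewrite -[leLHS]mule1 -muJ -integral_cst//.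
apply: (@le_trans _ _ (\int[mu]_(y in J) ((psi y)%:E + ((1 + A) / 2)%:E))%E).
  apply: ge0_le_integral => //.
  - by move=> y _; rewrite lee_fin.
  - by apply: emeasurable_funD => //; apply/measurable_EFinP; exact: measurable_funTS.
rewrite ge0_integralD//; last 3 first.
- by move=> y _; rewrite lee_fin.
- by apply/measurable_EFinP; exact: measurable_funTS.
- by move=> y _; rewrite lee_fin; lra.
rewrite integral_cst// [X in (_ * X)%E]muJ mule1 EFinD leeD2r// -psiw.
apply: ge0_subset_integral => //.
- exact/measurable_EFinP.
- by move=> y _; rewrite lee_fin.
Qed.

End integral_inequalities.

(** * The rearrangement of a nonnegative primitive *)

Section rearrangement.
Variable R : realType.
Local Notation mu := (@lebesgue_measure R).
Variables (psi g : R -> R) (w A : R).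
Hypothesis psi_ge0 : forall y, 0 <= psi y.
Hypothesis psi_g : primitive psi g.
Hypothesis psi_w : (\int[mu]_y (psi y)%:E = w%:E)%E.
Hypothesis g_A : (\int[mu]_x ((g x) ^+ 2)%:E <= A%:E)%E.

Let D s := mu [set x | s < psi x].

Let cpsi : continuous psi. Proof. exact: primitive_continuous psi_g. Qed.
Let mpsi : measurable_fun setT psi. Proof. exact: continuous_measurable_fun. Qed.
Let mg : measurable_fun setT g.
Proof. by case: psi_g => /loc_integrable_measurable. Qed.

Let mlevel s : measurable [set x | s < psi x].
Proof.
have -> : [set x | s < psi x] = setT `&` psi @^-1` `]s, +oo[.
  by apply/seteqP; split => x /=; rewrite in_itv/= andbT => // -[].
exact: mpsi.
Qed.

Let D_le s t : s <= t -> (D t <= D s)%E.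
Proof.
move=> st; apply: le_measure; rewrite ?inE; [exact: mlevel|exact: mlevel|].
by move=> x /=; exact: le_lt_trans.
Qed.

Let D_fin s : 0 < s -> (D s < +oo)%E.
Proof.
move=> s0; have mE : measurable_fun setT (EFin \o psi) by exact/measurable_EFinP.
have h := @le_integral_abse _ _ _ mu setT measurableT (EFin \o psi) s mE s0.
have hw : (s%:E * D s <= w%:E)%E.
  apply: (@le_trans _ _ (\int[mu]_x `|(EFin \o psi) x|)%E); last first.
    rewrite -psi_w; apply: ge0_le_integral => //.
      exact: measurableT_comp.
    by move=> x _ /=; rewrite ger0_norm.
  apply: le_trans h; rewrite lee_wpmul2l ?lee_fin ?(ltW s0)//.
  apply: le_measure; rewrite ?inE; first exact: mlevel.
    rewrite setTI.
    have -> : [set x | (s%:E <= `|(EFin \o psi) x|)%E] = setT `&` psi @^-1` `[s, +oo[.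
      apply/seteqP; split => x /=; rewrite lee_fin in_itv/= andbT ger0_norm//.
      by case.
    exact: mpsi.
  by move=> x /= sx; split => //; rewrite lee_fin ger0_norm// ltW.
apply: (@le_lt_trans _ _ (s^-1%:E * w%:E)%E); last by rewrite -EFinM ltry.
by rewrite lee_pdivlMl.
Qed.

Let M := w + (1 + A) / 2.
Let psiM x : psi x <= M. Proof. exact: primitive_bounded psi_g psi_ge0 psi_w g_A x. Qed.
Let M_ge0 : 0 <= M. Proof. exact: le_trans (psi_ge0 0) (psiM 0). Qed.

(* [s = 0] is included so that the supremum is never taken over the empty set. *)
Let S (x : R) := [set s | s = 0 \/ 0 <= s /\ ((2 * `|x|)%:E < D s)%E].

(** The generalized inverse of the distribution function [D]: [2 * |x|] is the length of the centred
    interval ending at [x]. *)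
Definition rearr (x : R) : R := sup (S x).

Let S0 x : S x 0. Proof. by left. Qed.

Let S_ub x : ubound (S x) M.
Proof.
move=> s [->//|[s0 Ds]]; apply: contrapT => /negP; rewrite -ltNge => Ms.
have E : [set x | s < psi x] = set0.
  by apply/seteqP; split => y //= sy; have := lt_le_trans (lt_trans Ms sy) (psiM y); rewrite ltxx.
by move: Ds; rewrite /D E measure0 lte_fin ltNge mulr_ge0.
Qed.

(** The converse rests on right-continuity of [D]: the sets where [psi > s + 1 / (n + 1)] increase
    to the set where [psi > s], so some level strictly above [s] already belongs to [S x]. *)
Lemma rearr_gt (s x : R) : 0 <= s -> (s < rearr x) <-> ((2 * `|x|)%:E < D s)%E.
Proof.
move=> s0; split.
  move=> /sup_gt[]; first by exists 0; exact: S0.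
  move=> t [->|[t0 Dt]] st; first by have := le_lt_trans s0 st; rewrite ltxx.
  by apply: (lt_le_trans Dt); apply: D_le; exact: ltW.
move=> Ds.
pose a n : R := s + n.+1%:R^-1.
have sa n : s < a n by rewrite ltrDl invr_gt0 ltr0n.
have [n Dn] : exists n, ((2 * `|x|)%:E < D (a n))%E.
  apply: contrapT => /forallNP H.
  have U : \bigcup_n [set y | a n < psi y] = [set y | s < psi y].
    apply/seteqP; split => [y [n _ /=]|y /= sy]; first exact: lt_trans.
    exists (Num.bound (psi y - s)^-1) => //=; rewrite /a -ltrBrDl.
    have d0 : 0 < psi y - s by rewrite subr_gt0.
    rewrite -[ltRHS]invrK ltf_pV2 ?posrE ?invr_gt0// ?ltr0n//.
    apply: (@lt_trans _ _ (Num.bound (psi y - s)^-1)%:R); last by rewrite ltr_nat.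
    by apply: archi_boundP; rewrite invr_ge0 ltW.
  have c : D (a n) @[n --> \oo] --> D s.
    rewrite /D -U; apply: (@nondecreasing_cvg_mu _ _ _ mu (fun n => [set y | a n < psi y])).
    - by move=> n; exact: mlevel.
    - by rewrite U; exact: mlevel.
    - move=> m n mn; apply/subsetPset => y /=; apply: le_lt_trans.
      by rewrite lerD2l lef_pV2 ?posrE ?ltr0n// ler_nat.
  move: Ds; rewrite ltNge => /negP; apply.
  rewrite -(cvg_lim _ c)//; apply: lime_le; first by apply/cvg_ex; eexists; exact: c.
  by apply: nearW => n; rewrite leNgt; apply/negP; exact: H.
apply: (lt_le_trans (sa n)); apply: ub_le_sup; first by exists M; exact: S_ub.
by right; split => //; exact: le_trans s0 (ltW (sa n)).
Qed.

Lemma rearr_profile : profile rearr.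
Proof.
have r0 x : 0 <= rearr x by apply: ub_le_sup; [exists M; exact: S_ub|exact: S0].
split => //.
- by move=> y; rewrite /rearr /S normrN.
- move=> x y x0 xy; rewrite leNgt; apply/negP => h.
  have /(rearr_gt y (r0 x)) Dy := h.
  suff : rearr x < rearr x by rewrite ltxx.
  apply/(rearr_gt x (r0 x)); apply: le_lt_trans Dy.
  by rewrite lee_fin ler_pM2l// !ger0_norm// (le_trans x0).
Qed.

Let g2 (X : set R) := (\int[mu]_(x in X) ((g x) ^+ 2)%:E)%E.

(* The layer has measure at most [2 * h], and [psi] ascends and descends by
   [t - s] within it; Young's inequality with parameter [(t - s) / h] then gives
   the bound. *)
Lemma layer_dirichlet (x h s t : R) : 0 <= x -> 0 < h ->
  rearr (x + h) < s -> s < t -> t < rearr x ->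
  ((2 * (t - s) ^+ 2 / h)%:E <= g2 [set y | (rearr (x + h) < psi y < rearr x)%R])%E.
Proof.
move=> x0 h0 us st tu.
have [r0 _ _] := rearr_profile.
have s0 : 0 < s by exact: le_lt_trans (r0 (x + h)) us.
have t0 : 0 < t by exact: lt_trans s0 st.
set b := rearr (x + h) in us *.
have b0 : 0 <= b by exact: r0.
pose L := [set y | b < psi y] `\` [set y | t < psi y].
have mL : measurable L by apply: measurableD; exact: mlevel.
have Db : (D b <= (2 * (x + h))%:E)%E.
  rewrite leNgt; apply/negP => h1.
  have : b < rearr (x + h) by apply/(rearr_gt _ b0); rewrite ger0_norm// addr_ge0// ltW.
  by rewrite ltxx.
have Dt : ((2 * x)%:E < D t)%E.
  by have /(rearr_gt x (ltW t0)) := tu; rewrite ger0_norm.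
have muL : (mu L <= (2 * h)%:E)%E.
  rewrite /L measureD; [|exact: mlevel|exact: mlevel|exact: le_lt_trans Db (ltry _)].
  rewrite (_ : _ `&` _ = [set y | t < psi y]); last first.
    by apply/seteqP; split => y /=; [case|move=> ty; split => //; exact: lt_trans (lt_trans us st) ty].
  apply: (@le_trans _ _ ((2 * (x + h))%:E - (2 * x)%:E)%E).
    by apply: leeB => //; exact: ltW.
  by rewrite -EFinB lee_fin; lra.
(* The set where [psi > s] has finite measure, so it cannot contain a half-line: low values occur on
   both sides of any point. *)
have far (p : R) : (exists2 a, a <= p & psi a <= s) /\ (exists2 a, p <= a & psi a <= s).
  have aux (X : set R) : measurable X -> mu X = +oo%E -> exists2 a, X a & psi a <= s.
    move=> mX Xoo; apply: contrapT => /forall2NP H.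
    have : (mu X <= D s)%E.
      apply: le_measure; rewrite ?inE//; first exact: mlevel.
      by move=> y Xy /=; rewrite ltNge; apply/negP => hy; case: (H y).
    by rewrite Xoo leye_eq => /eqP E; have := D_fin s0; rewrite E.
  split.
    have [|a] := aux `]-oo, p]%classic (measurable_itv _).
      by rewrite [LHS]lebesgue_measure_itv/= ltNyr.
    by rewrite /= in_itv/=; exists a.
  have [|a] := aux `[p, +oo[%classic (measurable_itv _).
    by rewrite [LHS]lebesgue_measure_itv/= ltry.
  by rewrite /= in_itv/= andbT; exists a.
have [p tp] : exists p, t < psi p.
  apply: contrapT => /forallNP H; have : D t = 0%E.
    by rewrite /D (_ : [set y | t < psi y] = set0) ?measure0// -subset0 => y /=; exact: H.
  by move=> E; move: Dt; rewrite E lte_fin ltNge mulr_ge0.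
have [[a ap sa] [c pc sc]] := far p.
have [al [be [h1 h2 h3 [h4 h5 h6]]]] := upcrossing cpsi ap st sa (ltW tp).
have [al' [be' [k1 k2 k3 [k4 k5 k6]]]] := downcrossing cpsi pc st (ltW tp) sc.
have inL y : s < psi y < t -> L y.
  move=> /andP[sy yt]; split => /=; first exact: lt_trans us sy.
  by apply/negP; rewrite -leNgt ltW.
have osc (c1 c2 : R) : c1 < c2 -> t - s <= `|psi c2 - psi c1| ->
    ((t - s)%:E <= \int[mu]_(y in `]c1, c2[) `|g y|%:E)%E.
  move=> c12 H; apply: (le_trans _ (primitive_dist_le psi_g (ltW c12))).
  by rewrite lee_fin.
have osc1 := osc _ _ h2 ltac:(rewrite ger0_norm; lra).
have osc2 := osc _ _ k2 ltac:(rewrite ler0_norm; lra).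
have mabs (X : set R) : measurable_fun X (fun y => `|g y|%:E).
  by apply: measurable_funTS; apply/measurable_EFinP; exact: measurableT_comp.
have two : ((2 * (t - s))%:E <= \int[mu]_(y in L) `|g y|%:E)%E.
  rewrite mulr_natl mulr2n EFinD.
  apply: (@le_trans _ _ (\int[mu]_(y in `]al, be[ `|` `]al', be'[) `|g y|%:E)%E).
    rewrite ge0_integral_setU//=.
    - exact: leeD.
    - exact: mabs.
    - apply/disj_setPS => y /= []; rewrite !in_itv/= => /andP[_ y1] /andP[y2 _].
      by lra.
  apply: ge0_subset_integral => //.
  - by apply: measurableU; exact: measurable_itv.
  - exact: mabs.
  - move=> y /= []; rewrite in_itv/= => hy; apply: inL.
      exact: h6.
    exact: k6.
pose q := (t - s) / h.
have q0 : 0 < q by rewrite divr_gt0// subr_gt0.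
have Y := young_integral mL mg (ltW q0).
have mT : measurable [set y | b < psi y < rearr x].
  rewrite (_ : [set y | _] = setT `&` psi @^-1` `]b, rearr x[).
    by apply: mpsi => //; exact: measurable_itv.
  by apply/seteqP; split => y /=; rewrite in_itv/= => // -[].
have gL : (g2 L <= g2 [set y | (b < psi y < rearr x)%R])%E.
  apply: ge0_subset_integral => //.
  - by apply: measurable_funTS; apply/measurable_EFinP; exact: measurable_funX.
  - by move=> y _; rewrite lee_fin sqr_ge0.
  - move=> y [/= y1 y2]; rewrite y1/=; apply: le_lt_trans tu.
    by rewrite leNgt; apply/negP.
apply: (le_trans _ gL).
(* With [q = (t - s) / h], the measure term of Young's inequality costs at most
   [q ^+ 2 * (2 * h) = 2 * (t - s) ^+ 2 / h], half of the left side. *)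
have step : ((4 * (t - s) ^+ 2 / h)%:E <= (2 * (t - s) ^+ 2 / h)%:E + g2 L)%E.
  apply: (@le_trans _ _ ((2 * q)%:E * \int[mu]_(x in L) `|g x|%:E)%E).
    rewrite [X in X%:E](_ : _ = 2 * q * (2 * (t - s))).
      by rewrite EFinM lee_wpmul2l// lee_fin mulr_ge0// ltW.
    by rewrite /q; field; rewrite gt_eqF.
  apply: (le_trans Y); rewrite leeD2r//.
  apply: (@le_trans _ _ ((q ^+ 2)%:E * (2 * h)%:E)%E).
    by rewrite lee_wpmul2l// lee_fin sqr_ge0.
  rewrite -EFinM lee_fin le_eqVlt; apply/orP; left; apply/eqP.
  by rewrite /q; field; rewrite gt_eqF.
rewrite -(@leeD2lE _ (2 * (t - s) ^+ 2 / h)%:E)//.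
apply: le_trans step; rewrite -EFinD lee_fin.
lra.
Qed.

(** The slices of [psi] between consecutive grid values of [rearr] are disjoint, so their Dirichlet
    integrals add up to at most [A]. The factor [2] in each layer bound, from ascent and descent,
    turns [A] into [A / 2]. *)
Lemma rearr_half_grid : half_grid rearr (A / 2).
Proof.
move=> n h h0.
have [r0 _ rd] := rearr_profile.
pose T k := [set y | rearr (k.+1%:R * h) < psi y < rearr (k%:R * h)].
have xk k : 0 <= k%:R * h by rewrite mulr_ge0// ltW.
have xkS k : k.+1%:R * h = k%:R * h + h by rewrite -natr1 mulrDl mul1r.
pose d k := rearr (k%:R * h) - rearr (k.+1%:R * h).
have d0 k : 0 <= d k by rewrite subr_ge0; apply: rd => //; rewrite xkS lerDl ltW.
have mT k : measurable (T k).
  rewrite (_ : T k = setT `&` psi @^-1` `]rearr (k.+1%:R * h), rearr (k%:R * h)[).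
    by apply: mpsi => //; exact: measurable_itv.
  by apply/seteqP; split => y /=; rewrite in_itv/= => // -[].
have layer k : ((2 * d k ^+ 2 / h)%:E <= g2 (T k))%E.
  have g20 : (0 <= g2 (T k))%E by apply: integral_ge0 => y _; rewrite lee_fin sqr_ge0.
  have := d0 k; rewrite le_eqVlt => /predU1P[<-|dk].
    by rewrite expr0n/= mulr0 mul0r.
  (* The layer bound needs strict inequalities between levels, so both levels are moved inwards by
     [e / 2]. *)
  have small e : 0 < e -> e < d k -> ((2 * (d k - e) ^+ 2 / h)%:E <= g2 (T k))%E.
    move=> e0 ed; rewrite /T xkS.
    have := @layer_dirichlet (k%:R * h) h (rearr (k.+1%:R * h) + e / 2)
      (rearr (k%:R * h) - e / 2) (xk k) h0.
    rewrite xkS; rewrite /d xkS in ed *.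
    move=> H; have {}H := H ltac:(lra) ltac:(lra) ltac:(lra); apply: le_trans H.
    rewrite lee_fin le_eqVlt; apply/orP; left; apply/eqP.
    by congr (2 * _ ^+ 2 / h); field.
  have [gf|gf] := boolP (g2 (T k) \is a fin_num); last first.
    by move: gf; rewrite ge0_fin_numE// -leNgt leye_eq => /eqP ->; exact: leey.
  rewrite -(fineK gf) lee_fin.
  set G := fine _.
  have G0 : 0 <= G by exact: fine_ge0.
  rewrite ler_pdivrMr//.
  have small' e : 0 < e -> e < d k -> 2 * (d k - e) ^+ 2 <= G * h.
    by move=> e0 ed; have := small e e0 ed; rewrite -(fineK gf) lee_fin ler_pdivrMr.
  rewrite leNgt; apply/negP => Gd.
  (* Replacing [d k] by [d k - e] lowers [2 * d k ^+ 2] by at most [4 * e * d k], which is at most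
     half of the supposed gap. *)
  pose e := Num.min (d k / 2) ((2 * d k ^+ 2 - G * h) / (8 * d k)).
  have e0 : 0 < e by rewrite lt_min !divr_gt0// ?subr_gt0// mulr_gt0.
  have ed : e <= d k / 2 by rewrite ge_min lexx.
  have ed2 : e * (8 * d k) <= 2 * d k ^+ 2 - G * h.
    by rewrite -ler_pdivlMr ?mulr_gt0// ge_min lexx orbT.
  have := small' e e0 ltac:(lra).
  by have := mulr_gt0 e0 dk; have := sqr_ge0 e; rewrite sqrrB; nra.
have tT : trivIset setT T.
  apply/trivIsetP => i j _ _.
  wlog ij : i j / (i < j)%N.
    move=> H; rewrite neq_ltn => /orP[] ij; first by apply: H => //; rewrite neq_ltn ij.
    by rewrite setIC; apply: H => //; rewrite neq_ltn ij.
  move=> _; rewrite -subset0 => y [/= /andP[y1 _] /andP[_ y2]].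
  have : rearr (j%:R * h) <= rearr (i.+1%:R * h).
    by apply: rd => //; rewrite ler_pM2r// ler_nat.
  by move=> H; have := lt_le_trans (lt_trans y1 y2) H; rewrite ltxx.
have tot : ((\sum_(k < n) 2 * d k ^+ 2 / h)%:E <= A%:E)%E.
  rewrite -sumEFin; apply: (@le_trans _ _ (\sum_(k < n) g2 (T k))%E).
    by apply: lee_sum => k _; exact: layer.
  apply: le_trans g_A.
  have mg2 : measurable_fun setT (fun x => ((g x) ^+ 2)%:E).
    by apply/measurable_EFinP; exact: measurable_funX.
  have := @ge0_integral_bigsetU _ _ _ mu nat T (fun x => ((g x) ^+ 2)%:E) (index_iota 0 n) mT (iota_uniq _ _).
  rewrite big_mkord => /= H.
  rewrite /g2 -(big_mkord xpredT (fun k => \int[mu]_(x in T k) (g x ^+ 2)%:E)%E) -H//.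
  - apply: ge0_subset_integral => //.
      by apply: bigsetU_measurable => k _; exact: mT.
    by move=> y _; rewrite lee_fin sqr_ge0.
  - by apply: sub_trivIset tT.
  - exact: measurable_funTS.
  - by move=> y _; rewrite lee_fin sqr_ge0.
move: tot; rewrite lee_fin -mulr_suml -mulr_sumr ler_pdivrMr// => tot.
by rewrite -(ler_pM2l (ltr0n R 2)) mulrA [2 * (A / 2)]mulrC mulfVK.
Qed.

(** By [rearr_gt] the set where [rearr > s] is the centred ball of radius [D s / 2], so [rearr] and
    [psi] are equimeasurable. The grid bound supplies continuity, hence measurability. *)
Lemma rearr_integral (G : R -> R) : measurable_fun setT G ->
  (forall p, 0 <= G p) -> (forall p, p <= 0 -> G p = 0) ->
  (\int[mu]_x (G (rearr x))%:E = \int[mu]_x (G (psi x))%:E)%E.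
Proof.
move=> mG G0 Gneg.
have A0 : 0 <= A.
  by rewrite -lee_fin; apply: le_trans g_A; apply: integral_ge0 => z _; rewrite lee_fin sqr_ge0.
have cr : continuous rearr.
  by apply: profile_continuous rearr_profile rearr_half_grid _; rewrite divr_ge0.
rewrite (@equimeasurable_integral _ rearr psi 1 G) ?mul1e//.
- exact: continuous_measurable_fun.
- move=> s s0; rewrite mul1e.
  have Ds := D_fin s0.
  have Df : D s \is a fin_num by rewrite ge0_fin_numE.
  pose r := fine (D s) / 2.
  have r0 : 0 <= r by rewrite divr_ge0// fine_ge0.
  have -> : [set x | s < rearr x] = ball 0 r.
    apply/seteqP; split => x /=.
      move=> /(rearr_gt x (ltW s0)); rewrite -(fineK Df) lte_fin => H.
      by rewrite /ball/= sub0r normrN /r ltr_pdivlMr// mulrC.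
    rewrite /ball/= sub0r normrN /r ltr_pdivlMr// mulrC => H.
    by apply/(rearr_gt x (ltW s0)); rewrite -(fineK Df) lte_fin.
  rewrite lebesgue_measure_ball// -[RHS](fineK Df); congr EFin.
  by rewrite /r -[_ *+ 2]mulr_natr mulfVK.
Qed.

End rearrangement.

(** * Compactness of profiles *)

Section selection.
Variable R : realType.
Implicit Types (u v : R -> R).

Lemma ultra_bounded_cvg (U : set_system nat) (s : nat -> R) (C : R) :
  UltraFilter U -> (forall n, `|s n| <= C) -> exists l : R, s @ U --> l.
Proof.
move=> UU sC.
have cK : compact (`[- C, C]%classic : set R) by exact: segment_compact.
have UK : (s @ U) `[- C, C]%classic.
  apply: (@filterS _ U _ setT); last exact: filterT.
  by move=> n _ /=; rewrite in_itv/= -ler_norml.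
have [l [_ cl]] := cK (s @ U) _ UK.
exists l => V nV.
have [//|UnV] := in_ultra_setVsetC (s @^-1` V) UU.
have [] := cl (~` V) V UnV nV.
by move=> x [nVx Vx]; case: nVx.
Qed.

Lemma half_grid_cvg (F : set_system nat) (u : nat -> R -> R) v
    (B : nat -> R) (b : R) : ProperFilter F ->
  (forall x, u n x @[n --> F] --> v x) -> B @ F --> b ->
  (forall n, half_grid (u n) (B n)) -> half_grid v b.
Proof.
move=> PF uv Bb gu n h h0.
have c1 : \sum_(k < n) (u m (k%:R * h) - u m (k.+1%:R * h)) ^+ 2 @[m --> F] -->
    \sum_(k < n) (v (k%:R * h) - v (k.+1%:R * h)) ^+ 2.
  apply: cvg_big; first exact: add_continuous.
  by move=> k _; apply: cvgM; apply: cvgB; exact: uv.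
have c2 : B m * h @[m --> F] --> b * h by apply: cvgM => //; exact: cvg_cst.
apply: (ler_cvg_to c1 c2); apply: nearW => m; exact: gu.
Qed.

Lemma profile_cvg (F : set_system nat) (u : nat -> R -> R) v : ProperFilter F ->
  (forall x, u n x @[n --> F] --> v x) ->
  (forall n, profile (u n)) -> profile v.
Proof.
move=> PF uv pu; split.
- move=> y; apply: (@ler_cvg_to _ F _ _ (fun=> 0) (u ^~ y)) => //.
    exact: cvg_cst.
  by apply: nearW => n; have [] := pu n.
- move=> y; apply/eqP; rewrite eq_le; apply/andP; split.
    apply: (ler_cvg_to (uv (- y)) (uv y)).
    by apply: nearW => n; have [_ -> _] := pu n.
  apply: (ler_cvg_to (uv y) (uv (- y))).
  by apply: nearW => n; have [_ -> _] := pu n.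
- move=> x y x0 xy; apply: (ler_cvg_to (uv y) (uv x)).
  by apply: nearW => n; have [_ _] := pu n; exact.
Qed.

(* Limits along an ultrafilter give [v]; a subsequence that is close to [v] on
   finer and finer grids then converges everywhere by monotonicity. *)
Lemma profile_selection (u : nat -> R -> R) (B K : nat -> R) (C : R) :
  (forall n, profile (u n)) -> (forall n, half_grid (u n) (B n)) ->
  (forall n, 0 <= B n <= C) -> (forall n, `|K n| <= C) ->
  (forall n, u n 0 <= C) ->
  exists (phi : nat -> nat) v (b k : R),
    [/\ forall i, (i <= phi i)%N, profile v, half_grid v b,
        forall x, u (phi i) x @[i --> \oo] --> v x &
        B (phi i) @[i --> \oo] --> b /\ K (phi i) @[i --> \oo] --> k].
Proof.
move=> pu gu BC KC uC.
have [U [UU sU]] := ultraFilterLemma (eventually_filter : ProperFilter \oo).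
have PU : ProperFilter U by exact: ultra_proper.
have [b Bb] : exists b : R, B @ U --> b.
  by apply: (@ultra_bounded_cvg _ _ C) => n; have /andP[B0 ?] := BC n; rewrite ger0_norm.
have [k Kk] : exists k : R, K @ U --> k by exact: (@ultra_bounded_cvg _ _ C).
have /choice[v uv] : forall x, exists l : R, u n x @[n --> U] --> l.
  move=> x; apply: (@ultra_bounded_cvg _ _ C) => n.
  have [u0 _ _] := pu n; rewrite ger0_norm//.
  exact: le_trans (profile_le0 x (pu n)) (uC n).
have pv : profile v by exact: profile_cvg uv pu.
have gv : half_grid v b by exact: half_grid_cvg uv Bb gu.
have b0 : 0 <= b.
  apply: (@ler_cvg_to _ U _ _ (fun=> 0) B) => //; first exact: cvg_cst.
  by apply: nearW => n; have /andP[] := BC n.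
have cv := profile_continuous pv gv b0.
pose e i : R := i.+1%:R^-1.
have e0 i : 0 < e i by rewrite invr_gt0 ltr0n.
(* Fatou's lemma needs a sequence, so the ultrafilter is traded for indices [phi i]. The grid of
   mesh [e i] reaches [i + 1]; the extra index is the right end of the last cell. *)
have /choice[phi Hphi] : forall i, exists n, [/\ (i <= n)%N, `|b - B n| < e i,
    `|k - K n| < e i & forall j : 'I_((i.+1 * i.+1).+1),
      `|v (j%:R * e i) - u n (j%:R * e i)| < e i].
  move=> i.
  have : \forall n \near U, [/\ (i <= n)%N, `|b - B n| < e i,
    `|k - K n| < e i & forall j : 'I_((i.+1 * i.+1).+1),
      `|v (j%:R * e i) - u n (j%:R * e i)| < e i].
    near=> n; split.
    - by near: n; apply: sU; exact: nbhs_infty_ge.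
    - by near: n; exact: (@cvgr_dist_lt _ _ _ U _ B b).
    - by near: n; exact: (@cvgr_dist_lt _ _ _ U _ K k).
    - near: n; apply: filter_forall => j.
      exact: (@cvgr_dist_lt _ _ _ U _ (u ^~ (j%:R * e i)) (v (j%:R * e i))).
  by move=> /filter_ex[n Hn]; exists n.
have e_cvg : e @ \oo --> 0 by exact: cvg_harmonic.
have e_lt r : 0 < r -> \forall i \near \oo, e i < r.
  move=> r0; near=> i.
  have : `|0 - e i| < r by near: i; exact: (@cvgr_dist_lt _ _ _ \oo _ e 0).
  by rewrite sub0r normrN gtr0_norm.
have cvgB (s : nat -> R) l : (forall i, `|l - s (phi i)| < e i) ->
    s (phi i) @[i --> \oo] --> l.
  move=> H; apply/cvgrPdist_lt => r r0; near=> i.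
  by apply: lt_trans (H i) _; near: i; exact: e_lt.
(* [u (phi i) x] lies between the values at the two neighbouring grid points, where it is close to
   [v]; continuity of [v] brings both close to [v x]. *)
have cpos x : 0 <= x -> u (phi i) x @[i --> \oo] --> v x.
  move=> x0; apply/cvgrPdist_lt => r r0.
  have r20 : 0 < r / 2 by rewrite divr_gt0.
  have [d /= d0 Hd] := (@cvgr_dist_lt _ _ _ (nbhs x) _ v (v x) (cv x) _ r20).
  near=> i.
  have [_ _ _ Hg] := Hphi i.
  have [_ _ ud] := pu (phi i).
  have ei : e i < r / 2 by near: i; exact: e_lt.
  have ed : e i < d by near: i; exact: e_lt.
  have xi : x < i%:R by near: i; exact: nbhs_infty_gtr.
  have ie : i.+1%:R * e i = 1 by rewrite mulfV// pnatr_eq0.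
  pose j := Num.truncn (x * i.+1%:R).
  have /andP[j1 j2] : j%:R <= x * i.+1%:R < j.+1%:R.
    by apply: truncn_itv; rewrite mulr_ge0.
  have xe : x = x * i.+1%:R * e i by rewrite -mulrA ie mulr1.
  have jx : j%:R * e i <= x by rewrite [leRHS]xe ler_pM2r.
  have xj : x < j.+1%:R * e i by rewrite [ltLHS]xe ltr_pM2r.
  have jS : j.+1%:R * e i = j%:R * e i + e i by rewrite -natr1 mulrDl mul1r.
  have jn : (j < i.+1 * i.+1)%N.
    rewrite -(ltr_nat R); apply: le_lt_trans j1 _.
    rewrite natrM ltr_pM2r ?ltr0n//; apply: lt_trans xi _.
    by rewrite ltr_nat.
  have g1 := Hg (Ordinal (ltnW (jn : (j.+1 < (i.+1 * i.+1).+1)%N))).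
  have g2 := Hg (Ordinal (jn : (j.+1 < (i.+1 * i.+1).+1)%N)).
  rewrite /= in g1 g2.
  have v1 : `|v x - v (j%:R * e i)| < r / 2.
    by apply: Hd; rewrite /ball_/= ger0_norm ?subr_ge0//; lra.
  have v2 : `|v x - v (j.+1%:R * e i)| < r / 2.
    by apply: Hd; rewrite /ball_/= ler0_norm ?subr_le0 ?(ltW xj)//; lra.
  have u1 : u (phi i) x <= u (phi i) (j%:R * e i).
    by apply: ud => //; rewrite mulr_ge0// ltW.
  have u2 : u (phi i) (j.+1%:R * e i) <= u (phi i) x.
    by apply: ud => //; exact: ltW.
  move: g1 g2 v1 v2; rewrite !ltr_norml => /andP[? ?] /andP[? ?] /andP[? ?] /andP[? ?].
  by apply/andP; split; lra.
exists phi, v, b, k; split => //.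
- by move=> i; have [] := Hphi i.
- move=> x; have [x0|/ltW x0] := leP 0 x; first exact: cpos.
  have [_ vN _] := pv; rewrite -vN.
  rewrite (_ : (fun i => u (phi i) x) = (fun i => u (phi i) (- x))).
    by apply: cpos; rewrite oppr_ge0.
  by apply/funext => i; have [_ -> _] := pu (phi i).
- by split; apply: cvgB => i; have [] := Hphi i.
Unshelve. all: by end_near. Qed.

End selection.

(** * The potential energy and the cost of escaping mass *)

Section potential.
Variable R : realType.
Local Notation mu := (@lebesgue_measure R).
Variable z : R -> R.
Hypothesis z_ge0 : forall p : R, 0 < p -> 0 <= z p.
Hypothesis z_noninc : forall p q : R, 0 < p -> p <= q -> z q <= z p.
Hypothesis z_lsc : forall p : R, 0 < p -> forall a : R, a < z p ->
  \forall q \near p, a < z q.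
Local Notation c := (c_of z).

Lemma c_of_ge0 p : 0 <= c p.
Proof. by rewrite /c_of; case: ifPn => // p0; rewrite mulr_ge0 ?z_ge0// ltW. Qed.

Lemma c_of_le0 p : p <= 0 -> c p = 0.
Proof. by move=> p0; rewrite /c_of ltNge p0. Qed.

Lemma c_of_lsc (p a : R) : a < c p -> \forall q \near p, a < c q.
Proof.
have [a0|a0] := ltP a 0.
  by move=> _; near=> q; exact: lt_le_trans a0 (c_of_ge0 q).
rewrite {1}/c_of; case: ifPn => [p0 ap|_ /(le_lt_trans a0)]; last by rewrite ltxx.
(* An intermediate slope: near [p] both [z q > m], by lower semi-continuity, and [m * q > a], by
   continuity. *)
pose m := (a / p + z p) / 2.
have apz : a / p < z p by rewrite ltr_pdivrMr.
have ap0 : 0 <= a / p by rewrite divr_ge0// ltW.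
have m0 : 0 < m by rewrite /m; lra.
have mz : m < z p by rewrite /m; lra.
have am : a / m < p by rewrite ltr_pdivrMr// mulrC -ltr_pdivrMr// /m; lra.
near=> q.
have q0 : 0 < q by near: q; exact: lt_nbhsr.
have zq : m < z q by near: q; exact: z_lsc.
have aq : a / m < q by near: q; exact: lt_nbhsr.
rewrite /c_of q0; apply: (@lt_trans _ _ (m * q)); last by rewrite ltr_pM2r.
by rewrite mulrC -ltr_pdivrMr.
Unshelve. all: by end_near. Qed.

Lemma measurable_c_of : measurable_fun setT c.
Proof.
move=> mT; apply: (measurability _ (RGenOInfty.measurableE R)) => //.
move=> _ [_ [a ->] <-]; rewrite setTI; apply: open_measurable.
rewrite openE => p /=; rewrite in_itv/= andbT => /c_of_lsc.
by apply: filterS => q /= aq; rewrite in_itv/= aq.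
Qed.

(** This is where monotonicity of [z] enters: mass at heights below [d] costs at least [z d] per
    unit. *)
Lemma c_of_lower (p d : R) : 0 < d -> 0 <= p -> p <= d -> z d * p <= c p.
Proof.
move=> d0; rewrite le_eqVlt => /predU1P[<- _|p0 pd].
  by rewrite mulr0 c_of_ge0.
by rewrite /c_of p0 ler_wpM2r ?(ltW p0)// z_noninc.
Qed.

(** On the centred interval ending at [x] the profile is at least [u x]. The resulting decay, of
    order [1 / |x|], is uniform over profiles of the same mass. *)
Lemma profile_mass (u : R -> R) (w x : R) : profile u -> measurable_fun setT u ->
  (\int[mu]_y (u y)%:E = w%:E)%E -> 2 * `|x| * u x <= w.
Proof.
move=> [u0 uN ud] mu_ uw.
have ux : u x = u `|x|.
  by have [x0|x0] := leP 0 x; rewrite ?(ger0_norm x0)// ltr0_norm// uN.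
pose J := `[- `|x|, `|x|]%classic : set R.
have mJ : measurable J by exact: measurable_itv.
rewrite -lee_fin -uw; apply: (@le_trans _ _ (\int[mu]_(y in J) (u y)%:E)%E).
  rewrite mulrC EFinM.
  have <- : mu J = (2 * `|x|)%:E.
    rewrite [LHS]lebesgue_measure_itv/= lte_fin -EFinB opprK -[_ + _]mulr2n.
    rewrite -[_ *+ 2]mulr_natl; case: ifPn => //; rewrite -leNgt => h; have := normr_ge0 x => h'.
    by have -> : `|x| = 0; [lra|rewrite mulr0].
  rewrite -integral_cst//; apply: ge0_le_integral => //.
  - by move=> y _; rewrite lee_fin.
  - by apply/measurable_EFinP; exact: measurable_funTS.
  - move=> y; rewrite /J /= in_itv/= => yx; rewrite lee_fin ux.
    have yx' : `|y| <= `|x| by rewrite ler_norml.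
    have -> : u y = u `|y|.
      by have [y0|y0] := leP 0 y; rewrite ?(ger0_norm y0)// ltr0_norm// uN.
    exact: ud.
apply: ge0_subset_integral => //.
- exact/measurable_EFinP.
- by move=> y _; rewrite lee_fin.
Qed.

Lemma limn_einf_ge (f : nat -> \bar R) (g : R) :
  (forall e, 0 < e -> \forall n \near \oo, ((g - e)%:E <= f n)%E) ->
  (g%:E <= limn_einf f)%E.
Proof.
move=> H; apply/lee_addgt0Pr => e e0.
rewrite -leeBlDr// -EFinB limn_einf_lim; apply: lime_ge; first exact: is_cvg_einfs.
have [m _ Hm] := H e e0.
exists m => // n /= mn; apply: le_ereal_inf_tmp => _ [k /= nk <-].
by apply: Hm => /=; exact: leq_trans nk.
Qed.

(* Fatou's lemma for [c (v n) - z d * v n], which is nonnegative outside a fixed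
   bounded interval since there [v n <= d]. *)
Lemma mass_loss (v : nat -> R -> R) (u : R -> R) (K : nat -> R)
    (k w m M d : R) : 0 < d -> 0 < w ->
  (forall n, profile (v n)) -> (forall n, measurable_fun setT (v n)) ->
  measurable_fun setT u ->
  (forall x, v n x @[n --> \oo] --> u x) -> (forall n, v n 0 <= M) ->
  (forall n, \int[mu]_y (v n y)%:E = w%:E)%E ->
  (\int[mu]_y (u y)%:E = m%:E)%E ->
  (forall n, \int[mu]_y (c (v n y))%:E <= (K n)%:E)%E -> K @ \oo --> k ->
  (\int[mu]_y (c (u y))%:E <= (k - z d * (w - m))%:E)%E.
Proof.
move=> d0 w0 pv mv mu_ vu vM vw um cK Kk.
have pu := profile_cvg _ vu pv.
(* By [profile_mass], a profile of mass [w] is at most [w / (2 * X) = d] outside [J]. *)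
pose X := w / (2 * d); have X0 : 0 < X by rewrite divr_gt0// mulr_gt0.
pose J := `[- X, X]%classic : set R.
have mJ : measurable J by exact: measurable_itv.
have muJ : mu J = (2 * X)%:E.
  rewrite [LHS]lebesgue_measure_itv/= lte_fin -EFinB opprK -[_ + _]mulr2n.
  by rewrite -[_ *+ 2]mulr_natl ifT// (lt_trans _ X0)// oppr_lt0.
have zd : 0 <= z d by exact: z_ge0.
have M0 : 0 <= M by apply: le_trans (vM 0%N); have [] := pv 0%N.
(* On [J] the values may exceed [d]; adding the fixed amount [z d * M] there restores
   nonnegativity. *)
pose h (f : R -> R) x := c (f x) - z d * f x + z d * M * \1_J x.
have wX : 2 * X * d = w by rewrite /X; field; rewrite gt_eqF.
have outside n x : ~ J x -> v n x <= d.
  rewrite /J /= in_itv/= -ler_norml => /negP; rewrite -ltNge => xX.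
  have := profile_mass x (pv n) (mv n) (vw n).
  rewrite -wX => H; rewrite leNgt; apply/negP => dv.
  suff : 2 * X * d < 2 * `|x| * v n x by rewrite ltNge H.
  apply: (@lt_trans _ _ (2 * X * v n x)).
    by rewrite ltr_pM2l// mulr_gt0.
  by rewrite ltr_pM2r ?ltr_pM2l// (lt_trans d0).
have outside_u x : ~ J x -> u x <= d.
  move=> Jx; apply: (@ler_cvg_to _ \oo _ _ (v ^~ x) (fun=> d)) => //.
    exact: cvg_cst.
  by apply: nearW => n; exact: outside.
have vMx n x : v n x <= M by exact: le_trans (profile_le0 x (pv n)) (vM n).
have uMx x : u x <= M.
  apply: (@ler_cvg_to _ \oo _ _ (v ^~ x) (fun=> M)) => //; first exact: cvg_cst.
  by apply: nearW => n; exact: vMx.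
have h_ge0 (f : R -> R) x : 0 <= f x -> f x <= M -> (~ J x -> f x <= d) -> 0 <= h f x.
  move=> f0 fM fd; rewrite /h indicE; have [Jx|Jx] := pselect (J x).
    rewrite mem_set// mulr1.
    by have := c_of_ge0 (f x); have := ler_wpM2l zd fM; lra.
  rewrite memNset// mulr0 addr0.
  by have := c_of_lower d0 f0 (fd Jx); lra.
have m_h (f : R -> R) : measurable_fun setT f -> measurable_fun setT (h f).
  move=> mf; apply: measurable_funD.
    apply: measurable_funB; first exact: measurableT_comp measurable_c_of mf.
    exact: measurable_funM.
  by apply: measurable_funM => //; exact: measurable_indic.
(* Both sides are kept as sums because the potential integral may be infinite at this stage. *)
have int_h (f : R -> R) (s : R) : measurable_fun setT f -> (forall x, 0 <= f x) ->
    (forall x, 0 <= h f x) -> (\int[mu]_y (f y)%:E = s%:E)%E ->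
    (\int[mu]_y (h f y)%:E + (z d * s)%:E =
     \int[mu]_y (c (f y))%:E + (z d * M * (2 * X))%:E)%E.
  move=> mf f0 hf0 fs.
  have <- : (\int[mu]_y ((z d)%:E * (f y)%:E) = (z d * s)%:E)%E.
    by rewrite ge0_integralZl ?fs//; [exact/measurable_EFinP|move=> ? _; rewrite lee_fin].
  have <- : (\int[mu]_y ((z d * M)%:E * (\1_J y)%:E) = (z d * M * (2 * X))%:E)%E.
    rewrite ge0_integralZl//.
    - by rewrite integral_indic// setIT [X in (_ * X)%E]muJ.
    - by apply/measurable_EFinP; exact: measurable_indic.
    - by rewrite lee_fin mulr_ge0.
  have mcf : measurable_fun setT (fun y => (c (f y))%:E).
    by apply/measurable_EFinP; exact: measurableT_comp measurable_c_of mf.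
  rewrite -ge0_integralD//; last 4 first.
  - by move=> y _; rewrite lee_fin.
  - by apply/measurable_EFinP; exact: m_h.
  - by move=> y _; rewrite -EFinM lee_fin mulr_ge0.
  - by apply: measurable_funeM; exact/measurable_EFinP.
  rewrite -ge0_integralD//; last 3 first.
  - by move=> y _; rewrite lee_fin c_of_ge0.
  - by move=> y _; rewrite -EFinM lee_fin !mulr_ge0// indicE.
  - by apply: measurable_funeM; apply/measurable_EFinP; exact: measurable_indic.
  by apply: eq_integral => y _; rewrite -!EFinM -!EFinD; congr EFin; rewrite /h; ring.
have v0 n x : 0 <= v n x by have [] := pv n.
have u0 x : 0 <= u x by have [] := pu.
have hv n x : 0 <= h (v n) x by apply: h_ge0 => //; exact: outside.
have hu x : 0 <= h u x by apply: h_ge0 => //; exact: outside_u.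
pose C := z d * M * (2 * X).
(* The correction [C] is the same along the sequence and at the limit, while the subtracted mass is
   [w] along the sequence and [m] at the limit: the difference is the cost of the lost mass. *)
have main : (\int[mu]_y (h u y)%:E <= (k + C - z d * w)%:E)%E.
  apply: (@fatou_bound _ (fun n y => (h (v n) y)%:E) _ (fun n => (K n + C - z d * w)%:E)).
  - by move=> n; apply/measurable_EFinP; exact: m_h.
  - by move=> n x; rewrite lee_fin.
  - by apply/measurable_EFinP; exact: m_h.
  - by move=> x; rewrite lee_fin.
  - apply: aeW => x; apply: limn_einf_ge => e e0.
    have e20 : 0 < e / 2 by rewrite divr_gt0.
    have c1 : \forall n \near \oo, c (u x) - e / 2 < c (v n x).
      have lsc : \forall q \near u x, c (u x) - e / 2 < c q by apply: c_of_lsc; lra.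
      exact: (vu x _ lsc).
    have c2 : \forall n \near \oo, `|z d * u x - z d * v n x| < e / 2.
      have cz : z d * v n x @[n --> \oo] --> z d * u x.
        by apply: cvgM; [exact: cvg_cst|exact: vu].
      exact: (@cvgr_dist_lt _ _ _ \oo _ _ _ cz).
    near=> n; rewrite lee_fin /h.
    have k1 : c (u x) - e / 2 < c (v n x) by near: n.
    have : `|z d * u x - z d * v n x| < e / 2 by near: n.
    by rewrite ltr_norml => /andP[k2 k3]; lra.
  - move=> n; rewrite EFinB leeBrDr// int_h//.
    by rewrite EFinD leeD2r.
  - apply: cvg_EFin; first by apply: nearW.
    by apply: cvgB; [apply: cvgD => //; exact: cvg_cst|exact: cvg_cst].
have := int_h u m mu_ u0 hu um.
move: main; rewrite EFinB leeBrDr// => main E.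
have : (\int[mu]_y (c (u y))%:E + C%:E <= (k + C - z d * w + z d * m)%:E)%E.
  by rewrite -E [in leRHS]EFinD leeD2r// EFinB leeBrDr.
rewrite -leeBrDr// => /le_trans; apply; rewrite -EFinB lee_fin; lra.
Unshelve. all: by end_near. Qed.

End potential.

(** * Stretching of profiles *)

Section stretch.
Variable R : realType.
Local Notation mu := (@lebesgue_measure R).
Implicit Types (u v : R -> R).

Lemma profile_norm v x : profile v -> v `|x| = v x.
Proof.
move=> [_ vN _]; have [x0|x0] := leP 0 x; first by rewrite ger0_norm.
by rewrite ltr0_norm// vN.
Qed.

Lemma profile_level v (m s : R) : profile v -> continuous v ->
  (\int[mu]_y (v y)%:E = m%:E)%E -> 0 < s ->
  exists2 r, 0 <= r & forall x, (s < v x) = (`|x| < r).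
Proof.
move=> pv cv vm s0; have [v0 _ vd] := pv.
have mv : measurable_fun setT v by exact: continuous_measurable_fun.
have [v0s|sv0] := leP (v 0) s.
  exists 0 => // x; rewrite (le_gtF (normr_ge0 x)); apply/negbTE; rewrite -leNgt.
  exact: le_trans (profile_le0 x pv) v0s.
pose S := [set x | 0 <= x /\ s < v x].
have S0 : S 0 by split.
have Sub : ubound S (m / (2 * s)).
  move=> x [x0 sx]; rewrite ler_pdivlMr ?mulr_gt0//.
  have := profile_mass x pv mv vm; rewrite ger0_norm//; apply: le_trans.
  by rewrite mulrA [x * 2]mulrC ler_wpM2l ?mulr_ge0// ltW.
have Sb : has_ubound S by exists (m / (2 * s)).
exists (sup S); first exact: ub_le_sup.
move=> x; rewrite -(profile_norm x pv); apply/idP/idP.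
  move=> sx.
  have : \forall y \near `|x|, s < v y by exact: (cv `|x| _ (lt_nbhsr sx)).
  move=> /nbhs_ballP[e /= e0 He].
  apply: (@lt_le_trans _ _ (`|x| + e / 2)); first by rewrite ltrDl divr_gt0.
  apply: ub_le_sup => //; split; first by rewrite addr_ge0// divr_ge0// ltW.
  apply: He; rewrite /ball/= opprD addrA subrr sub0r normrN gtr0_norm ?divr_gt0//.
  by lra.
move=> /sup_gt[]; first by exists 0.
by move=> y [y0 sy] xy; apply: lt_le_trans sy _; apply: vd => //; exact: ltW.
Qed.

(** The linear change of variables, read off from level sets: they are centred balls whose radii are
    multiplied by [l]. *)
Lemma stretch_integral v (m l : R) (G : R -> R) : profile v -> continuous v ->
  (\int[mu]_y (v y)%:E = m%:E)%E -> 0 < l ->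
  measurable_fun setT G -> (forall p, 0 <= G p) -> (forall p, p <= 0 -> G p = 0) ->
  (\int[mu]_x (G (v (x / l)))%:E = l%:E * \int[mu]_x (G (v x))%:E)%E.
Proof.
move=> pv cv vm l0 mG G0 Gneg.
have cvl : continuous (fun x : R => v (x / l)).
  move=> x; apply: (@continuous_comp _ _ _ (fun x : R => x / l) v); last exact: cv.
  by apply: cvgM; [exact: cvg_id|exact: cvg_cst].
have level s : 0 < s -> exists2 r, 0 <= r & [set x | s < v x] = ball 0 r /\
    [set x | s < v (x / l)] = ball 0 (l * r).
  move=> s0; have [r r0 Hr] := profile_level pv cv vm s0; exists r => //.
  split; apply/seteqP; split => x /=; rewrite Hr /ball/= sub0r normrN//.
    by rewrite normrM normfV (gtr0_norm l0) ltr_pdivrMr// mulrC.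
  by rewrite normrM normfV (gtr0_norm l0) ltr_pdivrMr// mulrC.
apply: (@equimeasurable_integral _ (fun x => v (x / l)) v l G (ltW l0)) => //.
- exact: continuous_measurable_fun.
- exact: continuous_measurable_fun.
- by move=> s s0; have [r r0 [-> _]] := level s s0; rewrite lebesgue_measure_ball// ltry.
- move=> s s0; have [r r0 [-> ->]] := level s s0.
  rewrite !lebesgue_measure_ball//; last by rewrite mulr_ge0// ltW.
  by rewrite -EFinM mulrnAr.
Qed.

Lemma profile_stretch v (l : R) : profile v -> 0 < l -> profile (fun x => v (x / l)).
Proof.
move=> [v0 vN vd] l0; split => //.
- by move=> y; rewrite mulNr.
- move=> x y x0 xy; apply: vd; first by rewrite divr_ge0// ltW.
  by rewrite ler_pM2r// invr_gt0.
Qed.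

(** The grid of mesh [h] for the stretched profile is the grid of mesh [h / l] for [v]. *)
Lemma half_grid_stretch v (b l : R) : half_grid v b -> 0 < l ->
  half_grid (fun x => v (x / l)) (b / l).
Proof.
move=> gv l0 n h h0; rewrite mulrAC -mulrA.
under eq_bigr do rewrite -!mulrA.
by apply: gv; rewrite divr_gt0.
Qed.

Lemma profile_scale v (a : R) : profile v -> 0 <= a -> profile (fun x => a * v x).
Proof.
move=> [v0 vN vd] a0; split.
- by move=> y; rewrite mulr_ge0.
- by move=> y; rewrite vN.
- by move=> x y x0 xy; rewrite ler_wpM2l// vd.
Qed.

Lemma half_grid_scale v (b a : R) : half_grid v b ->
  half_grid (fun x => a * v x) (a ^+ 2 * b).
Proof.
move=> gv n h h0; under eq_bigr do rewrite -mulrBr exprMn.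
by rewrite -mulr_sumr -mulrA ler_wpM2l ?sqr_ge0//; exact: gv.
Qed.

Lemma half_gridW v (b b' : R) : b <= b' -> half_grid v b -> half_grid v b'.
Proof.
by move=> bb gv n h h0; apply: le_trans (gv n h h0) _; rewrite ler_wpM2r// ltW.
Qed.

Definition tent (x : R) : R := Num.max 0 (1 - `|x|).

Lemma tent_profile : profile tent.
Proof.
split.
- by move=> y; rewrite /tent le_max lexx.
- by move=> y; rewrite /tent normrN.
- move=> x y x0 xy; rewrite /tent (ger0_norm x0) (ger0_norm (le_trans x0 xy)).
  by rewrite ge_max !le_max lexx/=; apply/orP; right; lra.
Qed.

(** Each decrement is between [0] and [h], so its square is at most [h] times itself, and the
    decrements telescope to at most [1]. *)
Lemma tent_half_grid : half_grid tent 1.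
Proof.
move=> n h h0; have [t0 _ td] := tent_profile.
pose x k : R := k%:R * h.
have x0 k : 0 <= x k by rewrite mulr_ge0// ltW.
have xS k : x k.+1 = x k + h by rewrite /x -natr1 mulrDl mul1r.
have d0 k : 0 <= tent (x k) - tent (x k.+1).
  by rewrite subr_ge0 td// xS lerDl ltW.
have dh k : tent (x k) - tent (x k.+1) <= h.
  rewrite /tent !ger0_norm// xS lerBlDr ge_max; apply/andP; split.
    by rewrite addr_ge0// ?(ltW h0)// le_max lexx.
  by rewrite -lerBlDl le_max; apply/orP; right; lra.
apply: (@le_trans _ _ (\sum_(k < n) h * (tent (x k) - tent (x k.+1)))).
  by apply: ler_sum => k _; rewrite expr2; exact: (ler_wpM2r (d0 k) (dh k)).
rewrite -mulr_sumr mulrC ler_wpM2r ?(ltW h0)//.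
have -> : \sum_(k < n) (tent (x k) - tent (x k.+1)) = tent (x 0%N) - tent (x n).
  rewrite -[RHS]opprB -(@telescope_sumr _ 0 n (tent \o x))// big_mkord -sumrN.
  by apply: eq_bigr => k _; rewrite opprB.
have := t0 (x n); have -> : tent (x 0%N) = 1; last by lra.
by rewrite /tent /x mul0r normr0 subr0; apply: max_r.
Qed.

Lemma tent_continuous : continuous tent.
Proof. exact: profile_continuous tent_profile tent_half_grid ler01. Qed.

Lemma tent_mass : exists2 m, 0 < m & (\int[mu]_y (tent y)%:E = m%:E)%E.
Proof.
have [t0 _ td] := tent_profile.
have mt : measurable_fun setT tent by apply: continuous_measurable_fun; exact: tent_continuous.
have ub : (\int[mu]_y (tent y)%:E <= 2%:E)%E.
  rewrite -(@supp_integral _ `[- 1, 1]); last first.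
    move=> y /=; rewrite in_itv/= -ler_norml => /negP; rewrite -ltNge => y1.
    by rewrite /tent; apply: max_l; lra.
  apply: (@le_trans _ _ (\int[mu]_(y in `[(- 1)%R, 1%R]) cst 1%:E y)%E).
    apply: ge0_le_integral => //.
    - by move=> y _; rewrite lee_fin.
    - by apply/measurable_EFinP; exact: measurable_funTS.
    - by move=> y _; rewrite lee_fin /tent ge_max ler01/= gerBl.
  rewrite integral_cst//= mul1e [leLHS]lebesgue_measure_itv/= lte_fin.
  by case: ifP => _ //; rewrite -EFinB lee_fin; lra.
have fin : (\int[mu]_y (tent y)%:E)%E \is a fin_num.
  by rewrite ge0_fin_numE ?(le_lt_trans ub) ?ltry// integral_ge0// => y _; rewrite lee_fin.
exists (fine (\int[mu]_y (tent y)%:E)); last by rewrite fineK.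
have h0 : 0 < 2^-1 :> R by rewrite invr_gt0.
(* Positivity of the mass: at the point [1 / 2] this bound reads [tent (1 / 2) <= m]. *)
have := profile_mass 2^-1 tent_profile mt (esym (fineK fin)).
rewrite (gtr0_norm h0) mulfV// mul1r; apply: lt_le_trans.
by rewrite /tent (gtr0_norm h0) lt_max; apply/orP; right; lra.
Qed.

(** A tent of width [L] and mass [w] has height of order [1 / L], so its Dirichlet energy is of
    order [1 / L ^+ 3] and can be made as small as desired. *)
Lemma flat_profile (w e : R) : 0 < w -> 0 < e ->
  exists u, [/\ profile u, half_grid u e & (\int[mu]_y (u y)%:E = w%:E)%E].
Proof.
move=> w0 e0; have [m m0 tm] := tent_mass.
(* The energy is [w ^+ 2 / m ^+ 2 / L ^+ 3]; the fraction makes [e * L] at least [w ^+ 2 / m ^+ 2],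
   and the [1] gives [L <= L ^+ 3]. *)
pose L := 1 + w ^+ 2 / (m ^+ 2 * e).
have q0 : 0 < w ^+ 2 / (m ^+ 2 * e) by rewrite divr_gt0 ?mulr_gt0 ?exprn_gt0.
have L1 : 1 <= L by rewrite /L; lra.
have L0 : 0 < L by rewrite /L; lra.
pose a := w / (L * m).
have a0 : 0 < a by rewrite divr_gt0// mulr_gt0.
have pt := profile_stretch tent_profile L0.
exists (fun x => a * tent (x / L)); split.
- exact: profile_scale pt (ltW a0).
- apply: (half_gridW _ (half_grid_scale a (half_grid_stretch tent_half_grid L0))).
  have aE : a ^+ 2 * (1 / L) = w ^+ 2 / (m ^+ 2) / L ^+ 3.
    by rewrite /a; field; rewrite !gt_eqF.
  rewrite aE ler_pdivrMr ?exprn_gt0//.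
  apply: (@le_trans _ _ (e * L)).
    rewrite /L mulrDr mulr1 [e * _]mulrC.
    rewrite (_ : w ^+ 2 / (m ^+ 2 * e) * e = w ^+ 2 / m ^+ 2) ?lerDr ?(ltW e0)//.
    by field; rewrite !gt_eqF.
  by rewrite ler_pM2l// -[leLHS]expr1 ler_weXn2l.
- have := @stretch_integral tent m L (fun p => Num.max 0 p) tent_profile
    tent_continuous tm L0.
  have t0 : forall x, Num.max 0 (tent x) = tent x.
    by move=> x; apply: max_r; have [] := tent_profile.
  under eq_integral do rewrite t0.
  under [X in (_ * X)%E]eq_integral do rewrite t0.
  rewrite tm => H.
  under eq_integral do rewrite EFinM.
  rewrite ge0_integralZl//.
  + rewrite H.
    * by rewrite -!EFinM; congr EFin; rewrite /a; field; rewrite !gt_eqF.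
    * by apply: measurable_maxr => //; exact: measurable_cst.
    * by move=> p; rewrite le_max lexx.
    * by move=> p p0; apply: max_l.
  + apply/measurable_EFinP; apply: continuous_measurable_fun.
    apply: (@profile_continuous _ _ (1 / L)) => //.
      exact: half_grid_stretch tent_half_grid L0.
    by rewrite divr_ge0// ltW.
  + by move=> x _; rewrite lee_fin; have [] := pt.
  + by rewrite lee_fin ltW.
Qed.

End stretch.

(** * The infimal energy *)

Section energy_bounds.
Variable R : realType.
Local Notation mu := (@lebesgue_measure R).
Variable z : R -> R.
Hypothesis z_ge0 : forall p : R, 0 < p -> 0 <= z p.
Hypothesis z_noninc : forall p q : R, 0 < p -> p <= q -> z q <= z p.
Hypothesis z_lsc : forall p : R, 0 < p -> forall a : R, a < z p ->
  \forall q \near p, a < z q.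
Local Notation c := (c_of z).
Implicit Types (u psi g : R -> R).

Let c_ge0 := c_of_ge0 z_ge0.
Let mc := measurable_c_of z_ge0 z_lsc.

Lemma energy_split psi g : measurable_fun setT psi -> measurable_fun setT g ->
  (forall y, 0 <= psi y) ->
  (\int[mu]_y (2^-1 * `|g y| ^+ 2 + c `|psi y|)%:E =
   2^-1%:E * \int[mu]_y ((g y) ^+ 2)%:E + \int[mu]_y (c (psi y))%:E)%E.
Proof.
move=> mpsi mg psi0.
have mg2 : measurable_fun setT (fun y => ((g y) ^+ 2)%:E).
  by apply/measurable_EFinP; exact: measurable_funX.
rewrite -ge0_integralZl//; last by move=> y _; rewrite lee_fin sqr_ge0.
rewrite -ge0_integralD//.
- apply: eq_integral => y _; rewrite -EFinM -EFinD (ger0_norm (psi0 y)).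
  by rewrite real_normK ?num_real.
- by move=> y _; rewrite -EFinM lee_fin mulr_ge0// sqr_ge0.
- exact: measurable_funeM.
- by move=> y _; rewrite lee_fin c_ge0.
- by apply/measurable_EFinP; exact: measurableT_comp mc mpsi.
Qed.

Lemma continuous_ae_ge0 u psi : continuous u -> (forall y, 0 <= psi y) ->
  {ae mu, forall x, psi x = u x} -> forall x, 0 <= u x.
Proof.
move=> cu psi0 [N [mN N0 HN]] x; rewrite leNgt; apply/negP => ux.
have : \forall y \near x, u y < 0 by exact: (cu x _ (lt_nbhsl ux)).
move=> /nbhs_ballP[e /= e0 He].
have : (mu (ball x e) <= mu N)%E.
  apply: le_measure; rewrite ?inE//; first exact: measurable_ball.
  move=> y /He uy; apply: HN => /= E; have := psi0 y.
  by rewrite E leNgt uy.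
by rewrite N0 lebesgue_measure_ball ?(ltW e0)// lee_fin leNgt mulrn_wgt0.
Qed.

(** The rearrangement is applied to the continuous representative of [psi]. The energy is exactly
    [b + k] because [b] is the Dirichlet energy of the competitor, which only bounds that of the
    profile. *)
Lemma competitor_profile psi g (w : R) : (forall y, 0 <= psi y) ->
  (\int[mu]_y (psi y)%:E = w%:E)%E -> weak_deriv psi g ->
  (\int[mu]_y (2^-1 * `|g y| ^+ 2 + c `|psi y|)%:E < +oo)%E ->
  exists u (b k : R), [/\ profile u, half_grid u b, 0 <= b /\ 0 <= k,
    (\int[mu]_y (u y)%:E = w%:E)%E /\ (\int[mu]_y (c (u y))%:E = k%:E)%E &
    (\int[mu]_y (2^-1 * `|g y| ^+ 2 + c `|psi y|)%:E = (b + k)%:E)%E].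
Proof.
move=> psi0 psiw wd Efin.
have [Psi [pPsi aePsi]] := weak_deriv_primitive wd.
have [psil [gl _]] := wd.
have mpsi := loc_integrable_measurable psil.
have mg := loc_integrable_measurable gl.
have cPsi := primitive_continuous pPsi.
have mPsi : measurable_fun setT Psi by exact: continuous_measurable_fun.
have Psi0 := continuous_ae_ge0 cPsi psi0 aePsi.
have transfer (G : R -> R) : measurable_fun setT G -> (forall p, 0 <= p -> 0 <= G p) ->
    (\int[mu]_y (G (Psi y))%:E = \int[mu]_y (G (psi y))%:E)%E.
  move=> mG G0; apply: ge0_ae_eq_integral => //.
  - by apply/measurable_EFinP; exact: measurableT_comp mG mPsi.
  - by apply/measurable_EFinP; exact: measurableT_comp mG mpsi.
  - by move=> y _; rewrite lee_fin G0.
  - by move=> y _; rewrite lee_fin G0.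
  - by apply: filterS aePsi; [exact: (ae_filter_ringOfSetsType mu)|move=> y -> _].
have Psiw : (\int[mu]_y (Psi y)%:E = w%:E)%E.
  by rewrite -psiw; apply: (transfer id).
move: Efin; rewrite energy_split//.
set IA := (\int[mu]_y (g y ^+ 2)%:E)%E; set IK := (\int[mu]_y (c (psi y))%:E)%E.
have IA0 : (0 <= IA)%E by apply: integral_ge0 => y _; rewrite lee_fin sqr_ge0.
have IK0 : (0 <= IK)%E by apply: integral_ge0 => y _; rewrite lee_fin c_ge0.
move=> Efin.
have IKfin : IK \is a fin_num.
  rewrite ge0_fin_numE//; apply: le_lt_trans Efin.
  by rewrite leeDr// mule_ge0// lee_fin.
have IAfin : IA \is a fin_num.
  rewrite ge0_fin_numE//.
  have : (2^-1%:E * IA < +oo)%E by apply: le_lt_trans Efin; rewrite leeDl.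
  by apply: contraTT; rewrite -!leNgt !leye_eq => /eqP ->; rewrite gt0_muley ?lte_fin ?invr_gt0.
pose A := fine IA; pose k := fine IK.
have gA : (\int[mu]_x ((g x) ^+ 2)%:E <= A%:E)%E by rewrite fineK.
exists (rearr Psi), (A / 2), k; split.
- exact: rearr_profile Psi0 pPsi Psiw gA.
- exact: rearr_half_grid Psi0 pPsi Psiw gA.
- by split; rewrite ?divr_ge0// fine_ge0.
- have pr := rearr_profile Psi0 pPsi Psiw gA.
  (* Equimeasurability asks for a nonnegative [G], so the mass is computed with the positive part in
     place of the identity. *)
  have maxE (f : R -> R) : (forall y, 0 <= f y) ->
      (\int[mu]_y (Num.max 0%R (f y))%:E = \int[mu]_y (f y)%:E)%E.
    by move=> f0; apply: eq_integral => y _; rewrite max_r.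
  split.
    rewrite -(maxE _ (let: And3 r0 _ _ := pr in r0)) -Psiw -(maxE _ Psi0).
    apply: (rearr_integral Psi0 pPsi Psiw gA (G := fun p => Num.max 0 p)).
    + by apply: measurable_maxr => //; exact: measurable_cst.
    + by move=> p; rewrite le_max lexx.
    + by move=> p p0; apply: max_l.
  rewrite (rearr_integral Psi0 pPsi Psiw gA)//; last by move=> p; exact: c_of_le0.
  by rewrite transfer// fineK.
- by rewrite -(fineK IAfin) -(fineK IKfin) -EFinM -EFinD mulrC.
Qed.

(** [b] bounds the integral of [u' ^+ 2] over a half-line, hence half of the integral over the line:
    it bounds the Dirichlet energy itself, with no further factor. *)
Lemma profile_energy u (b k : R) : profile u -> half_grid u b -> 0 <= b ->
  (\int[mu]_y (c (u y))%:E <= k%:E)%E -> (energy c u <= (b + k)%:E)%E.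
Proof.
move=> pu gu b0 uk.
have [g [pg g2]] := profile_primitive pu gu b0.
have cu := profile_continuous pu gu b0.
have [u0 _ _] := pu.
apply: (@le_trans _ _ (\int[mu]_y (2^-1 * `|g y| ^+ 2 + c `|u y|)%:E)%E).
  by apply: ereal_inf_lbound; exists g => //; exact: primitive_weak_deriv.
rewrite energy_split//; last 2 first.
- exact: continuous_measurable_fun.
- by case: pg => /loc_integrable_measurable.
rewrite EFinD; apply: leeD => //.
apply: (@le_trans _ _ (2^-1%:E * (2 * b)%:E)%E); first by rewrite lee_wpmul2l// lee_fin.
by rewrite -EFinM mulrA mulVf// mul1r.
Qed.

Lemma profile_H1 u (b w : R) : profile u -> half_grid u b -> 0 <= b ->
  (\int[mu]_y (u y)%:E = w%:E)%E -> H1 u.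
Proof.
move=> pu gu b0 uw.
have [g [pg g2]] := profile_primitive pu gu b0.
have cu := profile_continuous pu gu b0.
have [u0 _ _] := pu.
have mu_ : measurable_fun setT u by exact: continuous_measurable_fun.
exists g; split; first exact: primitive_weak_deriv.
split; last by apply: le_lt_trans g2 _; exact: ltry.
(* A profile is bounded by its value at the origin, so [u ^+ 2 <= u 0 * u]. *)
apply: (@le_lt_trans _ _ ((u 0)%:E * w%:E)%E); last by rewrite -EFinM ltry.
rewrite -uw -ge0_integralZl//; last 3 first.
- exact/measurable_EFinP.
- by move=> y _; rewrite lee_fin.
- by rewrite lee_fin.
apply: ge0_le_integral => //.
- by move=> y _; rewrite lee_fin sqr_ge0.
- by apply/measurable_EFinP; exact: measurable_funX.
- by apply: measurable_funeM; exact/measurable_EFinP.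
- by move=> y _; rewrite -EFinM lee_fin expr2 ler_wpM2r// profile_le0.
Qed.

Lemma tau_le_energy psi (w : R) : (forall y, 0 <= psi y) ->
  (\int[mu]_y (psi y)%:E = w%:E)%E -> (tau z w <= energy c psi)%E.
Proof. by move=> psi0 psiw; apply: ereal_inf_lbound; exists psi. Qed.

Lemma tau_ge (w : R) (t : \bar R) :
  (forall psi g, (forall y, 0 <= psi y) -> (\int[mu]_y (psi y)%:E = w%:E)%E ->
    weak_deriv psi g ->
    (t <= \int[mu]_y (2^-1 * `|g y| ^+ 2 + c `|psi y|)%:E)%E) ->
  (t <= tau z w)%E.
Proof.
move=> H; apply: le_ereal_inf_tmp => _ [psi [psi0 psiw] <-].
by apply: le_ereal_inf_tmp => _ [g wd <-]; exact: H.
Qed.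

Lemma tau_ge0 (w : R) : (0 <= tau z w)%E.
Proof.
apply: tau_ge => psi g psi0 _ _; apply: integral_ge0 => y _.
by rewrite lee_fin addr_ge0// mulr_ge0// sqr_ge0.
Qed.

Lemma tau0 : tau z 0 = 0%E.
Proof.
apply/eqP; rewrite eq_le tau_ge0 andbT.
have p0 : profile (fun=> 0 : R) by split.
have g0 : half_grid (fun=> 0 : R) 0.
  by move=> n h _; rewrite mul0r big1// => k _; rewrite subrr expr0n.
have i0 : (\int[mu]_y (0 : R)%:E = 0%:E)%E by rewrite integral0.
apply: (le_trans (@tau_le_energy (fun=> 0) 0 _ i0)) => //.
rewrite -[0%E]/(0%:E) -[X in X%:E](addr0 (0 : R)).
apply: profile_energy => //.
by under eq_integral do rewrite c_of_le0//; rewrite integral0.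
Qed.

Lemma tau_near (w e : R) : (tau z w < +oo)%E -> 0 < e ->
  exists u (b k : R), [/\ profile u, half_grid u b, 0 <= b /\ 0 <= k,
    (\int[mu]_y (u y)%:E = w%:E)%E /\ (\int[mu]_y (c (u y))%:E = k%:E)%E &
    ((b + k)%:E <= tau z w + e%:E)%E].
Proof.
move=> tfin e0.
have tf : tau z w \is a fin_num by rewrite ge0_fin_numE// tau_ge0.
have : (tau z w < tau z w + e%:E)%E by rewrite lteDl// lte_fin.
move=> /ereal_inf_lt[_ [psi [psi0 psiw] <-]].
move=> /ereal_inf_lt[_ [g wd <-]] H.
have [|u [b [k [h1 h2 h3 h4 h5]]]] := competitor_profile psi0 psiw wd.
  by apply: lt_trans H _; rewrite -(fineK tf) -EFinD ltry.
by exists u, b, k; split => //; rewrite -h5 ltW.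
Qed.

(** Flat profiles have negligible Dirichlet energy, and their potential energy is at most [Z] per
    unit of mass. *)
Lemma tau_le_linear (w Z : R) : 0 < w -> (forall p, 0 < p -> z p <= Z) ->
  (tau z w <= (Z * w)%:E)%E.
Proof.
move=> w0 zZ; apply/lee_addgt0Pr => e e0.
have [u [pu gu uw]] := flat_profile w0 e0.
have cu := profile_continuous pu gu (ltW e0).
have mu_ : measurable_fun setT u by exact: continuous_measurable_fun.
have [u0 _ _] := pu.
have Z0 : 0 <= Z by exact: le_trans (z_ge0 ltr01) (zZ _ ltr01).
apply: (le_trans (tau_le_energy u0 uw)); rewrite -EFinD addrC.
apply: profile_energy (ltW e0) _ => //.
rewrite EFinM -uw -ge0_integralZl//; last 2 first.
- exact/measurable_EFinP.
- by move=> y _; rewrite lee_fin.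
apply: ge0_le_integral => //.
- by move=> y _; rewrite lee_fin c_ge0.
- by apply/measurable_EFinP; exact: measurableT_comp mc mu_.
- by apply: measurable_funeM; exact/measurable_EFinP.
- move=> y _; rewrite -EFinM lee_fin /c_of; case: ifPn => [uy|_].
    by rewrite ler_wpM2r// zZ.
  by rewrite mulr_ge0.
Qed.

(* For small mass [x] a competitor of energy at most [(Z + 1) x] has small
   height, where [z] is close to its supremum. *)
Lemma tau_ge_linear (Z d : R) : 0 < d -> (forall p, 0 < p -> z p <= Z) ->
  \forall x \near 0^'+, ((z d * x)%:E <= tau z x)%E.
Proof.
move=> d0 zZ.
have Z0 : 0 <= Z by exact: le_trans (z_ge0 ltr01) (zZ _ ltr01).
near=> x.
have x0 : 0 < x by near: x; exact: nbhs_right_gt.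
have xd : x < d by near: x; exact: nbhs_right_lt.
(* The condition [x < d] gives [u 1 < d / 2]. This one makes the energy less than [d ^+ 2 / 4], so
   [u 0 - u 1 <= d / 2]; together they give [u 0 <= d]. *)
have xd2 : x < d ^+ 2 / (4 * (Z + 1)).
  near: x; apply: nbhs_right_lt; rewrite divr_gt0 ?exprn_gt0// mulr_gt0//.
  by rewrite ltr_wpDl.
apply: tau_ge => psi g psi0 psix wd.
set E := (\int[mu]_y _)%E.
have [big|small] := leP ((Z + 1) * x)%:E E.
  apply: le_trans big; rewrite lee_fin ler_wpM2r ?(ltW x0)//.
  by have := zZ d d0; lra.
have [|u [b [k [pu gu [b0 k0] [ux uk] EE]]]] := competitor_profile psi0 psix wd.
  by apply: lt_trans small _; exact: ltry.
rewrite /E EE in small *; rewrite lte_fin in small.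
have cu := profile_continuous pu gu b0.
have mu_ : measurable_fun setT u by exact: continuous_measurable_fun.
have [u0 _ _] := pu.
have u1 : 2 * u 1 <= x by have := profile_mass 1 pu mu_ ux; rewrite normr1 mulr1.
have u01 : (u 0 - u 1) ^+ 2 <= b.
  by have := gu 1%N 1 ltr01; rewrite big_ord_recl big_ord0 /= !mulr1 addr0.
have ud : u 0 <= d.
  suff : u 0 - u 1 <= d / 2 by lra.
  rewrite leNgt; apply/negP => H.
  have : (d / 2) ^+ 2 < (u 0 - u 1) ^+ 2.
    by rewrite ltr_sqr ?nnegrE//; lra.
  move: xd2; rewrite ltr_pdivlMr ?mulr_gt0 ?ltr_wpDl// exprMn exprVn => xd2.
  have -> : (2 ^+ 2)^-1 = 4^-1 :> R by congr (_^-1); ring.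
  lra.
suff : ((z d * x)%:E <= k%:E)%E.
  by rewrite !lee_fin => H; lra.
rewrite EFinM -ux -uk -ge0_integralZl//; last 3 first.
- exact/measurable_EFinP.
- by move=> y _; rewrite lee_fin.
- by rewrite lee_fin z_ge0.
apply: ge0_le_integral => //.
- by move=> y _; rewrite -EFinM lee_fin mulr_ge0// z_ge0.
- by apply: measurable_funeM; exact/measurable_EFinP.
- by apply/measurable_EFinP; exact: measurableT_comp mc mu_.
- move=> y _; rewrite -EFinM lee_fin; apply: c_of_lower => //.
  exact: le_trans (profile_le0 y pu) ud.
Unshelve. all: by end_near. Qed.

(** The quotient [tau z x / x] is squeezed between [z d] and [Z] for small [x], and [z d] can be
    taken arbitrarily close to [Z]. *)
Lemma tau_derive0 (Z : R) : (forall p, 0 < p -> z p <= Z) ->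
  (forall e, 0 < e -> exists2 d, 0 < d & Z - e < z d) ->
  ((tau z x - tau z 0) * (x^-1)%:E)%E @[x --> 0^'+] --> Z%:E.
Proof.
move=> zZ zsup.
have near_fin : \forall x \near (0 : R)^'+, (tau z x <= (Z * x)%:E)%E /\ 0 < x.
  near=> x; have x0 : 0 < x by near: x; exact: nbhs_right_gt.
  by split => //; exact: tau_le_linear.
have val x : (tau z x <= (Z * x)%:E)%E -> 0 < x ->
    tau z x \is a fin_num.
  by move=> h _; rewrite ge0_fin_numE ?tau_ge0//; apply: le_lt_trans h _; exact: ltry.
apply/fine_cvgP; split.
  apply: filterS near_fin => x [h x0].
  by rewrite tau0 sube0 -(fineK (val x h x0)) -EFinM.
apply/cvgrPdist_le => e e0; have [d d0 zd] := zsup e e0.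
near=> x.
have [h x0] : (tau z x <= (Z * x)%:E)%E /\ 0 < x by near: x.
have lo : ((z d * x)%:E <= tau z x)%E by near: x; exact: (@tau_ge_linear Z).
have vf := val x h x0.
rewrite /= tau0 sube0; move: h lo; rewrite -(fineK vf) -EFinM !lee_fin /=.
set t := fine _ => h lo.
have t1 : t / x <= Z by rewrite ler_pdivrMr.
have t2 : z d <= t / x by rewrite ler_pdivlMr.
by rewrite ger0_norm ?subr_ge0//; lra.
Unshelve. all: by end_near. Qed.

End energy_bounds.

(** * The limit of a minimizing sequence and its stretching *)

Section limit_profile.
Variable R : realType.
Local Notation mu := (@lebesgue_measure R).
Variable z : R -> R.
Hypothesis z_ge0 : forall p : R, 0 < p -> 0 <= z p.
Hypothesis z_noninc : forall p q : R, 0 < p -> p <= q -> z q <= z p.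
Hypothesis z_lsc : forall p : R, 0 < p -> forall a : R, a < z p ->
  \forall q \near p, a < z q.
Local Notation c := (c_of z).

(* [m] is the mass that does not escape to infinity along a minimizing
   sequence; each unit of escaping mass costs at least [z d]. *)
Lemma minimizing_limit (w T : R) : 0 < w -> tau z w = T%:E ->
  exists v (b k m : R), [/\ profile v /\ half_grid v b, 0 <= b /\ 0 <= k,
    (0 <= m <= w) /\ (\int[mu]_y (v y)%:E = m%:E)%E,
    (\int[mu]_y (c (v y))%:E = k%:E)%E &
    forall d, 0 < d -> b + k + z d * (w - m) <= T].
Proof.
move=> w0 tauT.
have tfin : (tau z w < +oo)%E by rewrite tauT ltry.
have T0 : 0 <= T by rewrite -lee_fin -tauT tau_ge0.
have /choice[f Hf] : forall n : nat, exists t : (R -> R) * R * R,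
    [/\ profile t.1.1, half_grid t.1.1 t.1.2, 0 <= t.1.2 /\ 0 <= t.2,
      (\int[mu]_y (t.1.1 y)%:E = w%:E)%E /\ (\int[mu]_y (c (t.1.1 y))%:E = t.2%:E)%E &
      t.1.2 + t.2 <= T + n.+1%:R^-1].
  move=> n; have [|u [b [k [h1 h2 h3 h4 h5]]]] :=
    tau_near z_ge0 z_lsc tfin (_ : 0 < n.+1%:R^-1).
    by rewrite invr_gt0 ltr0n.
  by exists (u, b, k); split => //=; move: h5; rewrite tauT -EFinD lee_fin.
pose u n := (f n).1.1; pose b_ n := (f n).1.2; pose k_ n := (f n).2.
have pu n : profile (u n) by have [] := Hf n.
have gu n : half_grid (u n) (b_ n) by have [] := Hf n.
have b0 n : 0 <= b_ n by have [_ _ []] := Hf n.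
have k0 n : 0 <= k_ n by have [_ _ []] := Hf n.
have uw n : (\int[mu]_y (u n y)%:E = w%:E)%E by have [_ _ _ []] := Hf n.
have uk n : (\int[mu]_y (c (u n y))%:E = (k_ n)%:E)%E by have [_ _ _ []] := Hf n.
have bkT n : b_ n + k_ n <= T + n.+1%:R^-1 by have [] := Hf n.
have cu n : continuous (u n) by exact: profile_continuous (pu n) (gu n) (b0 n).
have mu_ n : measurable_fun setT (u n) by exact: continuous_measurable_fun.
have bkT1 n : b_ n + k_ n <= T + 1.
  by apply: le_trans (bkT n) _; rewrite lerD2l invf_le1 ?ltr0n// ler1n.
(* For the height: [u n 1 <= w / 2], and [u n 0 - u n 1 <= 1 + b_ n <= T + 2]. *)
pose C := T + w + 2.
have bC n : 0 <= b_ n <= C.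
  by rewrite b0/= /C; have := bkT1 n; have := k0 n; lra.
have kC n : `|k_ n| <= C.
  by rewrite ger0_norm// /C; have := bkT1 n; have := b0 n; lra.
have uC n : u n 0 <= C.
  have h1 : 2 * u n 1 <= w by have := profile_mass 1 (pu n) (mu_ n) (uw n); rewrite normr1 mulr1.
  have h2 : (u n 0 - u n 1) ^+ 2 <= b_ n.
    by have := gu n 1%N 1 ltr01; rewrite big_ord_recl big_ord0 /= !mulr1 addr0.
  have h3 : u n 0 - u n 1 <= 1 + b_ n.
    have := sqr_ge0 (u n 0 - u n 1 - 1); rewrite sqrrB expr1n mulr1.
    by have := b0 n; lra.
  by rewrite /C; have := bkT1 n; have := k0 n; lra.
have [phi [v [b [k' [phi_ge pv gv uv [bb kk]]]]]] := profile_selection pu gu bC kC uC.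
have b_ge0 : 0 <= b.
  apply: (@ler_cvg_to _ \oo _ _ (fun=> 0) (fun i => b_ (phi i))) => //.
    exact: cvg_cst.
  by apply: nearW.
have bkT' : b + k' <= T.
  have c1 : b_ (phi i) + k_ (phi i) @[i --> \oo] --> b + k' by exact: cvgD.
  have c2 : T + harmonic i @[i --> \oo] --> T + 0.
    by apply: cvgD; [exact: cvg_cst|exact: cvg_harmonic].
  rewrite -[T]addr0; apply: (ler_cvg_to c1 c2); apply: nearW => i.
  apply: le_trans (bkT (phi i)) _; rewrite lerD2l /harmonic lef_pV2 ?posrE ?ltr0n//.
  by rewrite ler_nat ltnS.
have cv : continuous v by exact: profile_continuous pv gv b_ge0.
have mv : measurable_fun setT v by exact: continuous_measurable_fun.
have [v0 _ _] := pv.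
have vle : (\int[mu]_y (v y)%:E <= w%:E)%E.
  apply: (@fatou_bound _ (fun i y => (u (phi i) y)%:E) _ (fun=> w%:E)).
  - by move=> i; apply/measurable_EFinP; exact: mu_.
  - by move=> i x; rewrite lee_fin; have [] := pu (phi i).
  - exact/measurable_EFinP.
  - by move=> x; rewrite lee_fin.
  - apply: aeW => x.
    have cE : (u (phi i) x)%:E @[i --> \oo] --> (v x)%:E.
      by apply: cvg_EFin; [exact: nearW|exact: uv].
    by rewrite (cvg_limn_einf_sup cE).1.
  - by move=> i; rewrite uw.
  - exact: cvg_cst.
have vge : (0 <= \int[mu]_y (v y)%:E)%E by apply: integral_ge0 => y _; rewrite lee_fin.
have vfin : (\int[mu]_y (v y)%:E)%E \is a fin_num.
  by rewrite ge0_fin_numE//; apply: le_lt_trans vle _; exact: ltry.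
pose m := fine (\int[mu]_y (v y)%:E)%E.
have vm : (\int[mu]_y (v y)%:E = m%:E)%E by rewrite fineK.
have loss d : 0 < d -> (\int[mu]_y (c (v y))%:E <= (k' - z d * (w - m))%:E)%E.
  move=> d0; apply: (@mass_loss _ z z_ge0 z_noninc z_lsc (fun i => u (phi i)) v
    (fun i => k_ (phi i)) k' w m C d) => //.
  by move=> i; rewrite uk.
have cge : (0 <= \int[mu]_y (c (v y))%:E)%E.
  by apply: integral_ge0 => y _; rewrite lee_fin c_of_ge0.
have cfin : (\int[mu]_y (c (v y))%:E)%E \is a fin_num.
  by rewrite ge0_fin_numE//; apply: le_lt_trans (loss 1 ltr01) _; exact: ltry.
(* The [k] returned is the potential energy of the limit, which may be smaller than the limit [k']
   of the potential energies. *)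
exists v, b, (fine (\int[mu]_y (c (v y))%:E)%E), m; split => //.
- by split => //; exact: fine_ge0.
- by split => //; rewrite fine_ge0//= -lee_fin fineK.
- by rewrite fineK.
- by move=> d d0; have := loss d d0; rewrite -(fineK cfin) lee_fin; lra.
Qed.

Lemma profile_minimizer u (b w : R) : profile u -> half_grid u b -> 0 <= b ->
  (\int[mu]_y (u y)%:E = w%:E)%E -> (energy c u <= tau z w)%E ->
  [/\ (forall y, 0 <= u y) /\ (\int[mu]_y (u y)%:E = w%:E)%E,
      energy c u = tau z w, H1 u,
      (exists M : R, forall y, u y <= M) /\ continuous u
    & (forall y, u (- y) = u y) /\
      (forall x y : R, 0 <= x -> x <= y -> u y <= u x)].
Proof.
move=> pu gu b0 uw ue; have [u0 uN ud] := pu; split => //.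
- by apply/eqP; rewrite eq_le ue tau_le_energy.
- exact: profile_H1 pu gu b0 uw.
- split; last exact: profile_continuous pu gu b0.
  by exists (u 0) => y; exact: profile_le0.
Qed.

(* Stretching [v] by [w / m] restores the mass: the Dirichlet part decreases
   and the potential part grows by at most [sup z] per unit of mass. *)
Lemma stretch_minimizer (w T b k m : R) (v : R -> R) : 0 < w -> tau z w = T%:E ->
  profile v -> half_grid v b -> 0 <= b -> 0 <= k -> 0 < m -> m <= w ->
  (\int[mu]_y (v y)%:E = m%:E)%E -> (\int[mu]_y (c (v y))%:E = k%:E)%E ->
  (forall d, 0 < d -> b + k + z d * (w - m) <= T) ->
  let u := fun x => v (x / (w / m)) in
  [/\ profile u, half_grid u (b / (w / m)), (\int[mu]_y (u y)%:E = w%:E)%E &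
    (energy c u <= tau z w)%E].
Proof.
move=> w0 tauT pv gv b0 k0 m0 mw vm vk H u.
pose l := w / m; have l0 : 0 < l by rewrite divr_gt0.
have l1 : 1 <= l by rewrite ler_pdivlMr// mul1r.
have cv := profile_continuous pv gv b0.
have mv : measurable_fun setT v by exact: continuous_measurable_fun.
have [v0 _ _] := pv.
have pu : profile u by exact: profile_stretch.
have gu : half_grid u (b / l) by exact: half_grid_stretch.
have maxE (f : R -> R) : (forall y, 0 <= f y) ->
    (\int[mu]_y (Num.max 0%R (f y))%:E = \int[mu]_y (f y)%:E)%E.
  by move=> f0; apply: eq_integral => y _; rewrite max_r.
have uw : (\int[mu]_y (u y)%:E = w%:E)%E.
  have [u0 _ _] := pu.
  rewrite -(maxE _ u0) (stretch_integral (G := fun p => Num.max 0 p) pv cv vm l0).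
  - by rewrite (maxE _ v0) vm -EFinM /l divfK// gt_eqF.
  - by apply: measurable_maxr => //; exact: measurable_cst.
  - by move=> p; rewrite le_max lexx.
  - by move=> p p0; apply: max_l.
have uk : (\int[mu]_y (c (u y))%:E = (l * k)%:E)%E.
  rewrite (stretch_integral (G := c) pv cv vm l0) ?vk//.
  - exact: measurable_c_of.
  - exact: c_of_ge0.
  - by move=> p; exact: c_of_le0.
split => //.
apply: (le_trans (profile_energy z_ge0 z_lsc pu gu (divr_ge0 b0 (ltW l0)) (k := l * k) _)).
  by rewrite uk.
rewrite tauT lee_fin.
have bl : b / l <= b by rewrite ler_pdivrMr// ler_peMr.
suff : (l - 1) * k <= T - b - k by lra.
have lm : (l - 1) * m = w - m by rewrite /l mulrBl mul1r divfK// gt_eqF.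
(* If no mass is lost, [z] may be unbounded, but then [l = 1] and nothing has to be compensated. *)
move: mw; rewrite le_eqVlt => /predU1P[mw|mw].
  have -> : l = 1 by rewrite /l mw divff// gt_eqF.
  by rewrite subrr mul0r; have := H 1 ltr01; rewrite mw subrr mulr0; lra.
have wm : 0 < w - m by rewrite subr_gt0.
(* Once mass is lost, [H] bounds [z] by this [Z]. Then [k <= Z * m], and the extra cost
   [(l - 1) * k] is at most [Z * (w - m)], which is exactly the available slack. *)
pose Z := (T - b - k) / (w - m).
have zZ d : 0 < d -> z d <= Z.
  by move=> d0; rewrite /Z ler_pdivlMr//; have := H d d0; lra.
have Z0 : 0 <= Z by exact: le_trans (z_ge0 ltr01) (zZ _ ltr01).
have kZ : k <= Z * m.
  rewrite -lee_fin EFinM -vk -vm -ge0_integralZl//; last 2 first.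
  - exact/measurable_EFinP.
  - by move=> y _; rewrite lee_fin.
  apply: ge0_le_integral => //.
  - by move=> y _; rewrite lee_fin c_of_ge0.
  - by apply/measurable_EFinP; apply: measurableT_comp mv; exact: measurable_c_of.
  - by apply: measurable_funeM; exact/measurable_EFinP.
  - move=> y _; rewrite -EFinM lee_fin /c_of; case: ifPn => [vy|_].
      by rewrite ler_wpM2r// zZ.
    by rewrite mulr_ge0.
have : (l - 1) * k <= (l - 1) * (Z * m) by rewrite ler_wpM2l// subr_ge0.
rewrite [X in _ <= X -> _](_ : _ = T - b - k)//.
by rewrite mulrCA lm /Z divfK// gt_eqF.
Qed.

End limit_profile.

Theorem mainTheorem9 (R : realType) (z : R -> R)
  (z_ge0 : forall p : R, 0 < p -> 0 <= z p)
  (z_noninc : forall p q : R, 0 < p -> p <= q -> z q <= z p)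
  (z_lsc : forall p : R, 0 < p -> forall a : R, a < z p ->
             \forall q \near p, a < z q)
  (sqrt_c_int : (\int[@lebesgue_measure R]_(p in `[0%R, 1%R])
                    (Num.sqrt (c_of z p))%:E < +oo)%E)
  (w : R) (w_gt0 : 0 < w)
  (hw : exists d : \bar R,
     ((fun x : R => (tau z x - tau z 0) * (x^-1)%:E) @ 0^'+ --> d)%E /\
     tau z w <> (d * w%:E)%E) :
  exists psi : R -> R,
    [/\ (forall y, 0 <= psi y) /\ (\int[@lebesgue_measure R]_y (psi y)%:E = w%:E)%E,
        energy (c_of z) psi = tau z w,
        H1 psi,
        (exists M : R, forall y, psi y <= M) /\ continuous psi
      & (forall y, psi (- y) = psi y) /\
        (forall x y : R, 0 <= x -> x <= y -> psi y <= psi x)].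
Proof.
(* Profiles of mass [w] exist for every [w > 0], which settles the infinite case. *)
have [tfin|tinf] := ltP (tau z w) +oo%E; last first.
  have [u [pu gu uw]] := flat_profile w_gt0 ltr01.
  exists u; apply: profile_minimizer pu gu ler01 uw _.
  by move: tinf; rewrite leye_eq => /eqP ->; exact: leey.
have tf : tau z w \is a fin_num by rewrite ge0_fin_numE// tau_ge0.
have tauT := esym (fineK tf); set T := fine _ in tauT.
have [v [b [k [m [[pv gv] [b0 k0] [/andP[m0 mw] vm] vk H]]]]] :=
  minimizing_limit z_ge0 z_noninc z_lsc w_gt0 tauT.
move: m0; rewrite le_eqVlt => /predU1P[m0|m_gt0]; last first.
  have [pu gu uw ue] :=
    stretch_minimizer z_ge0 z_lsc w_gt0 tauT pv gv b0 k0 m_gt0 mw vm vk H.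
  exists (fun x => v (x / (w / m))).
  apply: profile_minimizer pu gu _ uw ue.
  by rewrite !divr_ge0// ltW.
exfalso; case: hw => d [dlim]; apply.
pose S := [set z p | p in [set p | 0 < p]].
have S0 : S !=set0 by exists (z 1); exists 1 => //=; exact: ltr01.
(* With [m = 0] the inequality [H] reads [b + k + z p * w <= T], so [z] is bounded and its supremum
   is finite. *)
have Sub : ubound S (T / w).
  move=> _ [p p0 <-]; rewrite ler_pdivlMr//.
  by have := H p p0; rewrite -m0 subr0; lra.
have hsup : has_sup S by split => //; exists (T / w).
pose Z := sup S.
have zZ p : 0 < p -> z p <= Z.
  by move=> p0; apply: ub_le_sup; [exists (T / w)|exists p].
have zsup e : 0 < e -> exists2 p, 0 < p & Z - e < z p.
  by move=> e0; have [_ [p p0 <-] h] := sup_adherent e0 hsup; exists p.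
have dZ : d = Z%:E.
  have cZ := tau_derive0 z_ge0 z_noninc z_lsc zZ zsup.
  exact: (cvg_unique _ dlim cZ).
(* The upper bound is the cost of flat profiles; the lower one, [Z * w <= T], follows from [T / w]
   being an upper bound of [z]. *)
rewrite dZ -EFinM; apply/eqP; rewrite eq_le tau_le_linear//= tauT lee_fin.
by rewrite -ler_pdivlMr//; exact: ge_sup.
Qed.
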